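(* Let $k,h,\ell\in\mathbb{N}$ and let $G$ be an undirected graph with $n$ vertices and $m$ edges such that $G\in\mathrm{TD}_k\mathrm{MW}_h\mathrm{MTD}_\ell$, with a witnessing algebraic expression given. Then the number of triangles (subgraphs isomorphic to $K_3$) of $G$ can be computed in time $O(h^{\omega-1}n+(k+\ell)m)$, where $\omega$ is the matrix multiplication exponent.
   Context: All graphs are finite and simple. Graph operations: $\circ$ and $\bullet$ return the empty graph and the one-vertex graph; $\mathrm{Union}_t$ is disjoint union of $t\ge2$ graphs; $\mathrm{Join}_t$ is disjoint union plus all edges between different arguments; for $G=(V,E)$, $x\notin V$ and $E_x\subseteq\{\{x,v\}\mid v\in V\}$, $\mathrm{Inc}_{x,E_x}(G)=(V\cup\{x\},E\cup E_x)$; for $H$ with $V(H)=\{v_1,\dots,v_t\}$, $\mathrm{Subst}_H(G_1,\dots,G_t)$ replaces each $v_i$ by a disjoint copy of $G_i$, keeps edges inside each $G_i$, and adds all edges between $V(G_i)$ and $V(G_j)$ whenever $\{v_i,v_j\}\in E(H)$. A graph has an algebraic expression over a set of operations if it is (up to renaming) the value of that expression; the empty graph corresponds to the empty expression. The nesting depth of an operation is the maximum number of expression-tree nodes labelled by it on a root-to-leaf path. $\mathrm{td}(G)$ is the least $k$ such that $G$ has an expression over $\{\circ,\mathrm{Union}\}\cup\{\mathrm{Inc}_{x,E_x}\}$ with $\mathrm{Inc}$ nesting depth at most $k$. $\mathrm{TD}_k\mathrm{MW}_h\mathrm{MTD}_\ell$ is the class of graphs having an expression over $\{\circ,\bullet,\mathrm{Union},\mathrm{Join}\}\cup\{\mathrm{Inc}_{x,E_x}\}\cup\{\mathrm{Subst}_H\mid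 |V(H)|\le h\}\cup\{\mathrm{Subst}_H\mid\mathrm{td}(H)\le\ell\}$ with $\mathrm{Inc}$ nesting depth at most $k$; for each $\mathrm{Subst}_H$ with $\mathrm{td}(H)\le\ell$ a tree-depth expression of $H$ is assumed to be given.
   Formalization: The given expression, and its tree-depth expressions, may not contain empty arguments of Union, Join or Subst, nor Subst_H with |V(H)| ≤ 1 (such padding has unbounded length for fixed n, m); h is read as max(h,1), and +1 is added in the time bound for the empty graph. *)

(* Defs.v *)
From HB Require Import structures.
From mathcomp Require Import all_boot all_order all_algebra.
From mathcomp Require Import reals exp.

Set Implicit Arguments.
Unset Strict Implicit.
Unset Printing Implicit Defensive.

Import Order.TTheory GRing.Theory Num.Theory.

Local Open Scope nat_scope.

Record sgraph := SGraph {
  vert :> finType;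
  adj : rel vert;
  adj_sym : symmetric adj;
  adj_irr : irreflexive adj }.

Definition edges (G : sgraph) : {set {set G}} :=
  [set S | [exists x, exists y, adj x y && (S == [set x; y])]].

Definition triangles (G : sgraph) : {set {set G}} :=
  [set S : {set G} | (#|S| == 3) &&
     [forall x in S, forall y in S, (x != y) ==> adj x y]].

(** Algebraic expressions.  An expression with [n] occurrences of [Vertex] and
    [Inc] denotes a graph on the vertices [0, ..., n-1], numbered in the order
    in which these occurrences appear in a left-to-right postorder traversal.
    - [Inc N a] is Inc_{x,E_x}: [N] lists the neighbours of the new vertex,
      which gets the last number; the vertices of [a] keep theirs.
    - [Subst E d es] is Subst_H(es), where H has vertices [0, ..., t-1], with
      [t = size es], and edge list [E].  The annotation [d] is either [None] or
      a tree-depth expression for H; in the latter case the vertices of H are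
      listed in the order in which that expression creates them. *)
Inductive expr : Type :=
| Empty
| Vertex
| Union of seq expr
| Join of seq expr
| Inc of seq nat & expr
| Subst of seq (nat * nat) & option expr & seq expr.

Fixpoint nverts (a : expr) : nat :=
  match a with
  | Empty => 0
  | Vertex => 1
  | Union es | Join es | Subst _ _ es => sumn (map nverts es)
  | Inc _ b => (nverts b).+1
  end.

Definition list_adj (E : seq (nat * nat)) : rel nat :=
  fun i j => ((i, j) \in E) || ((j, i) \in E).

(* Vertex [u] of the substitution is vertex [reshape_offset sh u] of the
   argument number [reshape_index sh u]. *)
Definition subst_adj (H : rel nat) (sh : seq nat) (gs : seq (rel nat)) :
    rel nat := fun u v =>
  let i := reshape_index sh u in
  let j := reshape_index sh v in
  if i == j
  then nth (fun _ _ => false) gs i (reshape_offset sh u) (reshape_offset sh v)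
  else H i j.

Fixpoint eadj (a : expr) : rel nat :=
  match a with
  | Empty | Vertex => fun _ _ => false
  | Union es => subst_adj (fun _ _ => false) (map nverts es) (map eadj es)
  | Join es => subst_adj (fun _ _ => true) (map nverts es) (map eadj es)
  | Inc N b => fun u v =>
      if u == nverts b then (v != u) && (v \in N)
      else if v == nverts b then u \in N
      else eadj b u v
  | Subst E _ es => subst_adj (list_adj E) (map nverts es) (map eadj es)
  end.

Definition denotes (a : expr) (G : sgraph) : Prop :=
  exists2 f : 'I_(nverts a) -> G, bijective f &
    forall i j : 'I_(nverts a), adj (f i) (f j) = eadj a i j.

Fixpoint inc_depth (a : expr) : nat :=
  match a with
  | Empty | Vertex => 0
  | Union es | Join es | Subst _ _ es => foldr maxn 0 (map inc_depth es)
  | Inc _ b => (inc_depth b).+1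
  end.

Definition wf_nbrs (n : nat) (N : seq nat) : bool :=
  uniq N && all (fun i => i < n) N.

Definition wf_edges (t : nat) (E : seq (nat * nat)) : bool :=
  uniq E && all (fun p : nat * nat => p.1 < p.2 < t) E.

Fixpoint wf_td (a : expr) : bool :=
  match a with
  | Empty => true
  | Union es => (1 < size es) && all wf_td es
  | Inc N b => wf_nbrs (nverts b) N && wf_td b
  | Vertex | Join _ | Subst _ _ _ => false
  end.

(* [d] shows that the graph with vertices [0, ..., t-1] and edge list [E] has
   tree-depth at most [l]. *)
Definition td_witness (l t : nat) (E : seq (nat * nat)) (d : expr) : bool :=
  [&& wf_td d, inc_depth d <= l, nverts d == t
    & all (fun i => all (fun j => eadj d i j == list_adj E i j) (iota 0 t))
        (iota 0 t)].

Fixpoint wf_expr (h l : nat) (a : expr) : bool :=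
  match a with
  | Empty | Vertex => true
  | Union es | Join es => (1 < size es) && all (wf_expr h l) es
  | Inc N b => wf_nbrs (nverts b) N && wf_expr h l b
  | Subst E d es =>
      [&& wf_edges (size es) E,
          (if d is Some b then td_witness l (size es) E b else size es <= h)
        & all (wf_expr h l) es]
  end.

(* [a] is an annotated expression witnessing membership of [G] in
   TD_k MW_h MTD_l. *)
Definition witnesses (k h l : nat) (a : expr) (G : sgraph) : Prop :=
  [/\ wf_expr h l a, inc_depth a <= k & denotes a G].

(* The length of an expression for a given graph is unbounded when empty
   arguments and substitutions into graphs with at most one vertex are
   allowed; these operations do not contribute to the graph denoted.  The
   argument of [Inc] may be [Empty]. *)
Fixpoint irredundant (a : expr) : bool :=
  match a with
  | Empty | Vertex => true
  | Union es | Join es =>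
      all (fun b => 0 < nverts b) es && all irredundant es
  | Inc _ b => irredundant b
  | Subst _ d es =>
      [&& 1 < size es, all (fun b => 0 < nverts b) es, all irredundant es
        & if d is Some b then irredundant b else true]
  end.

Definition encode_edges (E : seq (nat * nat)) : seq nat :=
  size E :: flatten [seq [:: p.1; p.2] | p <- E].

Definition encode_seq (s : seq nat) : seq nat := size s :: s.

(* Postfix notation: the code of a node follows those of its arguments. *)
Fixpoint encode (a : expr) : seq nat :=
  match a with
  | Empty => [:: 0]
  | Vertex => [:: 1]
  | Union es => flatten (map encode es) ++ [:: 2; size es]
  | Join es => flatten (map encode es) ++ [:: 3; size es]
  | Inc N b => encode b ++ 4 :: encode_seq N
  | Subst E d es =>
      flatten (map encode es) ++
      (if d is Some _ then 6 else 5) :: size es :: encode_edges E ++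
      (if d is Some b then encode_seq (encode b) else [::])
  end.

(** A word RAM with words of [w] bits: a program uses finitely many registers
    and finitely many arrays indexed by words, and every arithmetic operation,
    test and memory access has unit cost.  The contents of the memory outside
    the input are arbitrary. *)
Inductive binop := Add | Sub | Mul | Div | Mod | Eq | Lt.

Inductive aexp :=
| Lit of nat
| Reg of nat
| Get of nat & aexp
| Bin of binop & aexp & aexp.

Inductive cmd :=
| Skip
| Set_ of nat & aexp
| Put of nat & aexp & aexp
| Seq of cmd & cmd
| If of aexp & cmd & cmd
| While of aexp & cmd.

Record state := State { reg : nat -> nat; arr : nat -> nat -> nat }.

Definition word_state (w : nat) (s : state) : Prop :=
  (forall x, reg s x < 2 ^ w) /\ (forall a i, arr s a i < 2 ^ w).

Definition eval_op (w : nat) (o : binop) (x y : nat) : nat :=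
  match o with
  | Add => (x + y) %% 2 ^ w
  | Sub => (x + (2 ^ w - y)) %% 2 ^ w
  | Mul => (x * y) %% 2 ^ w
  | Div => x %/ y
  | Mod => x %% y
  | Eq => (x == y) %% 2 ^ w
  | Lt => (x < y) %% 2 ^ w
  end.

Fixpoint eval (w : nat) (s : state) (a : aexp) : nat :=
  match a with
  | Lit n => n %% 2 ^ w
  | Reg x => reg s x
  | Get t b => arr s t (eval w s b)
  | Bin o b c => eval_op w o (eval w s b) (eval w s c)
  end.

Fixpoint cost (a : aexp) : nat :=
  match a with
  | Lit _ | Reg _ => 1
  | Get _ b => (cost b).+1
  | Bin _ b c => (cost b + cost c).+1
  end.

Definition upd (T : Type) (f : nat -> T) (i : nat) (v : T) : nat -> T :=
  fun j => if j == i then v else f j.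

Inductive exec (w : nat) : cmd -> state -> nat -> state -> Prop :=
| ExSkip s : exec w Skip s 1 s
| ExSet x a s :
    exec w (Set_ x a) s (cost a).+1
      (State (upd (reg s) x (eval w s a)) (arr s))
| ExPut t a b s :
    exec w (Put t a b) s (cost a + cost b).+1
      (State (reg s)
         (upd (arr s) t (upd (arr s t) (eval w s a) (eval w s b))))
| ExSeq c1 c2 s s1 s2 k1 k2 :
    exec w c1 s k1 s1 -> exec w c2 s1 k2 s2 ->
    exec w (Seq c1 c2) s (k1 + k2) s2
| ExIf a c1 c2 s s' k :
    exec w (if eval w s a != 0 then c1 else c2) s k s' ->
    exec w (If a c1 c2) s ((cost a).+1 + k) s'
| ExWhileF a c s :
    eval w s a = 0 -> exec w (While a c) s (cost a).+1 s
| ExWhileT a c s s1 s2 k1 k2 :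
    eval w s a != 0 -> exec w c s k1 s1 -> exec w (While a c) s1 k2 s2 ->
    exec w (While a c) s ((cost a).+1 + k1 + k2) s2.

Definition runs_within (R : realType) (w : nat) (p : cmd) (s : state) (T : R)
    (Q : state -> Prop) : Prop :=
  exists k s', [/\ exec w p s k s', (k%:R <= T)%R & Q s'].

Definition holds_mx (t : nat) (f : nat -> nat) (A : 'M[nat]_t) : Prop :=
  forall i j : 'I_t, f (i * t + j) = A i j.

(** [omega] is an exponent achieved by matrix multiplication: a program
    multiplies two [t] by [t] integer matrices in time [O(t ^ omega)], given
    words of at least [c] times as many bits as [t] and the entries need.
    Nonnegative entries suffice, integers being differences of these. *)
Definition mm_exponent (R : realType) (omega : R) : Prop :=
  exists (p : cmd) (c : nat) (C : R),
    forall (t b : nat) (A B : 'M[nat]_t) (w : nat) (s : state),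
      0 < t ->
      (forall i j, A i j < b) -> (forall i j, B i j < b) ->
      (t + b) ^ c <= 2 ^ w ->
      word_state w s ->
      reg s 0 = t -> holds_mx (arr s 0) A -> holds_mx (arr s 1) B ->
      runs_within w p s (C * t%:R `^ omega)%R
        (fun s' => holds_mx (arr s' 2) (A *m B)%R).

Definition input_expr (a : expr) (s : state) : Prop :=
  reg s 0 = size (encode a) /\
  forall i, i < size (encode a) -> arr s 0 i = nth 0 (encode a) i.

(* Main.v *)
(** A single pass over the postfix code keeps, for every pending argument, its
    first vertex, its order and its degree sum, and counts the ordered triples
    of pairwise adjacent vertices, i.e. six times the triangles.
    - When [Union], [Join] or [Subst_H] is processed, a new triangle has two
      vertices in one argument and one in another, or its vertices lie in three
      arguments that form a triangle of H.  The former are counted edge by edge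
      from the orders and degree sums; [Join] is a fold of binary joins.  For the
      latter, weighted by the orders of the arguments, one matrix product is used
      if H has at most h vertices; if H is given with a tree-depth expression,
      every vertex of H has at most l later neighbours, so intersecting the
      lists of later neighbours of the ends of all edges takes time O(l) each.
    - The vertices added by [Inc] are recorded as later neighbours of the older
      vertices, at most k for each.  A triangle is charged to its last vertex if
      that vertex was added by [Inc]: at the end, intersecting the lists for all
      edges of G, which are stored as complete bipartite blocks, counts these.
    An operation with t arguments costs O(t h^(omega - 1)) plus O(k + l) for each
    of its edges, and the expression has O(n) operations.  This uses t <= h and
    omega >= 2, which holds since the product of two matrices has t^2 entries to
    be written. *)

Require Import Defs.
From mathcomp Require Import all_boot all_order all_algebra.
From mathcomp Require Import reals exp.
From mathcomp Require Import zify.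

Set Implicit Arguments.
Unset Strict Implicit.
Unset Printing Implicit Defensive.

Local Open Scope nat_scope.

(** * Reasoning about programs *)

(** Counts are kept modulo [2 ^ w] throughout: only the final value [tri_sum], at most n ^ 3, has to
    fit into a word, so intermediate sums need no bound. What must not overflow are addresses and
    counters; they are bounded by the code length, which is polynomial in n because the expression
    is irredundant. The time bound is a credit argument. Each value on the stack holds one credit X,
    proportional to h ^ (omega - 1); an operation takes t >= 2 credits, returns one and spends t -
    1, where t <= 2 (t - 1). Each edge carries credit proportional to k + l, which pays for constant
    work only if k + l > 0. So work on single edges must be shown to occur only when k or l is
    positive, or be charged to t * t <= h * t. Blocks are tied to edges by one identity, quantified
    over all symmetric weights F. Taking for F the number of common later neighbours, the constant
    1, and the indicator of pairs outside the vertex range gives the final count, the number of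
    pairs visited, and the fact that blocks stay inside the graph. *)

Definition wp (w : nat) (c : cmd) (s : state) (Q : nat -> state -> Prop) :
    Prop :=
  exists k s', exec w c s k s' /\ Q k s'.

(** Loop iterations in continuation form: any finished run from [s'] extends to one from [s]. This
    composes by transitivity, so the token loop can be followed by recursion on the expression
    instead of by an indexed invariant. *)
Definition steps (w : nat) (g : aexp) (c : cmd) (s : state) (k : nat)
    (s' : state) : Prop :=
  forall k' s'', exec w (While g c) s' k' s'' ->
    exec w (While g c) s (k + k') s''.

Section Rules.

Variable w : nat.
Implicit Types (s : state) (Q : nat -> state -> Prop).

Lemma wp_weaken c s (Q Q' : nat -> state -> Prop) :
  wp w c s Q -> (forall k s', Q k s' -> Q' k s') -> wp w c s Q'.
Proof. by move=> [k [s' [e q]]] QQ'; exists k, s'; split => //; exact: QQ'. Qed.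

Lemma wp_skip s Q : Q 1 s -> wp w Skip s Q.
Proof. by move=> q; exists 1, s; split => //; exact: ExSkip. Qed.

Lemma wp_set x a s Q :
  Q (cost a).+1 (State (upd (reg s) x (eval w s a)) (arr s)) ->
  wp w (Set_ x a) s Q.
Proof. by move=> q; do 2 eexists; split; [exact: ExSet|]. Qed.

Lemma wp_put t a b s Q :
  Q (cost a + cost b).+1
    (State (reg s) (upd (arr s) t (upd (arr s t) (eval w s a) (eval w s b)))) ->
  wp w (Put t a b) s Q.
Proof. by move=> q; do 2 eexists; split; [exact: ExPut|]. Qed.

Lemma wp_seq c1 c2 s Q :
  wp w c1 s (fun k1 s1 => wp w c2 s1 (fun k2 s2 => Q (k1 + k2) s2)) ->
  wp w (Seq c1 c2) s Q.
Proof.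
move=> [k1 [s1 [e1 [k2 [s2 [e2 q]]]]]].
by exists (k1 + k2), s2; split => //; exact: ExSeq e1 e2.
Qed.

Lemma wp_if a c1 c2 s Q :
  wp w (if eval w s a != 0 then c1 else c2) s
    (fun k s' => Q ((cost a).+1 + k) s') ->
  wp w (If a c1 c2) s Q.
Proof.
by move=> [k [s' [e q]]]; exists ((cost a).+1 + k), s'; split => //; exact: ExIf.
Qed.

Lemma wp_while (I : nat -> state -> Prop) (n : nat) (f : nat -> nat) g c s :
  (forall j s, j < n -> I j s -> eval w s g != 0) ->
  (forall j s, j < n -> I j s -> wp w c s (fun k s' => k <= f j /\ I j.+1 s')) ->
  (forall s, I n s -> eval w s g = 0) ->
  I 0 s ->
  wp w (While g c) s
    (fun k s' => k <= \sum_(0 <= j < n) (f j + (cost g).+1) + (cost g).+1 /\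
                 I n s').
Proof.
move=> gT body gF I0.
suff H d : forall j r, n - j = d -> j <= n -> I j r -> wp w (While g c) r
    (fun k r' => k <= \sum_(j <= i < n) (f i + (cost g).+1) + (cost g).+1 /\
                 I n r') by apply: H I0.
elim: d => [|d IHd] j r nj jn Ij.
  have {nj jn}ej : j = n by lia.
  subst j; rewrite big_geq //; exists (cost g).+1, r; split => //.
  by apply: ExWhileF; exact: gF.
have {}jn : j < n by lia.
have [k1 [s1 [e1 [k1le Ij1]]]] := body _ _ jn Ij.
have [||k2 [s2 [e2 [k2le In]]]] := IHd _ _ _ _ Ij1; [lia|lia|].
exists ((cost g).+1 + k1 + k2), s2; split.
  by apply: ExWhileT e1 e2; exact: gT jn Ij.
by split => //; rewrite (big_ltn jn); lia.
Qed.

Lemma steps_refl g c s : steps w g c s 0 s.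
Proof. by []. Qed.

Lemma steps_trans g c s1 k1 s2 k2 s3 :
  steps w g c s1 k1 s2 -> steps w g c s2 k2 s3 -> steps w g c s1 (k1 + k2) s3.
Proof. by move=> h1 h2 k s /h2 /h1; rewrite addnA. Qed.

Lemma steps1 g c s k s' :
  eval w s g != 0 -> exec w c s k s' -> steps w g c s ((cost g).+1 + k) s'.
Proof. by move=> gT e k' s''; exact: ExWhileT gT e. Qed.

Lemma ltn_pow2 : 0 < 2 ^ w. Proof. by rewrite expn_gt0. Qed.

Lemma eval_op_lt o x y : x < 2 ^ w -> y < 2 ^ w -> eval_op w o x y < 2 ^ w.
Proof.
move=> hx hy; case: o => /=; rewrite ?ltn_mod ?ltn_pow2 //.
  exact: leq_ltn_trans (leq_div _ _) hx.
exact: leq_ltn_trans (leq_mod _ _) hx.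
Qed.

Lemma eval_lt s a : word_state w s -> eval w s a < 2 ^ w.
Proof.
move=> [hr ha]; elim: a => [n|x|t b IHb|o b IHb c IHc] //=.
  by rewrite ltn_mod ltn_pow2.
exact: eval_op_lt.
Qed.

Lemma exec_word c s k s' : exec w c s k s' -> word_state w s -> word_state w s'.
Proof.
elim=> {c s k s'} //=.
- move=> x a s ws; have := eval_lt a ws; case: ws => hr ha av.
  by split => //= y; rewrite /upd; case: eqP.
- move=> t a b s ws; have := eval_lt b ws; case: ws => hr ha av.
  by split => //= u i; rewrite /upd; case: eqP => // _; case: eqP.
- by move=> c1 c2 s s1 s2 k1 k2 _ h1 _ h2 /h1.
- by move=> a c s s1 s2 k1 k2 _ _ h1 _ h2 /h1.
Qed.

End Rules.

(* Every step writes at most one array cell. *)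
Lemma exec_changed w c s k s' t (l : seq nat) :
  exec w c s k s' -> uniq l -> all (fun i => arr s' t i != arr s t i) l ->
  size l <= k.
Proof.
move=> e; elim: e l => {c s k s'}.
- by move=> s [|i l] //=; rewrite eqxx.
- by move=> x a s [|i l] //=; rewrite eqxx.
- move=> t' a b s l ul al /=.
  suff : size l <= 1 by lia.
  change 1 with (size [:: eval w s a]); apply: uniq_leq_size => // i il.
  move: (allP al i il) => /=; rewrite /upd.
  case: (t =P t') => [->|_]; last by rewrite eqxx.
  by rewrite inE; case: (i =P _) => // _; rewrite eqxx.
- move=> c1 c2 s s1 s2 k1 k2 _ h1 _ h2 l ul al.
  rewrite -(count_predC (fun i => arr s1 t i != arr s t i)) -!size_filter.
  apply: leq_add; first by apply: h1; rewrite ?filter_uniq ?filter_all.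
  apply: h2; rewrite ?filter_uniq //; apply/allP => i.
  by rewrite mem_filter /= negbK => /andP[/eqP -> /(allP al)].
- by move=> a c1 c2 s s' k _ h l ul al; have := h l ul al; lia.
- by move=> a c s _ [|i l] //=; rewrite eqxx.
- move=> a c s s1 s2 k1 k2 _ _ h1 _ h2 l ul al.
  rewrite -(count_predC (fun i => arr s1 t i != arr s t i)) -!size_filter.
  rewrite -addnA; apply: leq_trans (leq_addl _ _).
  apply: leq_add; first by apply: h1; rewrite ?filter_uniq ?filter_all.
  apply: h2; rewrite ?filter_uniq //; apply/allP => i.
  by rewrite mem_filter /= negbK => /andP[/eqP -> /(allP al)].
Qed.

(** * Relocating a program *)

Section Shift.

Variables (w dr da : nat).

Fixpoint shift_aexp (a : aexp) : aexp :=
  match a with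
  | Lit n => Lit n
  | Reg x => Reg (dr + x)
  | Get t b => Get (da + t) (shift_aexp b)
  | Bin o b c => Bin o (shift_aexp b) (shift_aexp c)
  end.

Fixpoint shift_cmd (c : cmd) : cmd :=
  match c with
  | Skip => Skip
  | Set_ x a => Set_ (dr + x) (shift_aexp a)
  | Put t a b => Put (da + t) (shift_aexp a) (shift_aexp b)
  | Seq c1 c2 => Seq (shift_cmd c1) (shift_cmd c2)
  | If a c1 c2 => If (shift_aexp a) (shift_cmd c1) (shift_cmd c2)
  | While a c => While (shift_aexp a) (shift_cmd c)
  end.

Definition high (s : state) : state :=
  State (fun x => reg s (dr + x)) (fun t => arr s (da + t)).

Lemma shift_eval s a : eval w s (shift_aexp a) = eval w (high s) a.
Proof. by elim: a => //= [t b ->|o b -> c ->]. Qed.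

Lemma shift_cost a : cost (shift_aexp a) = cost a.
Proof. by elim: a => //= [t b ->|o b -> c ->]. Qed.

Definition agree_low (s s' : state) : Prop :=
  (forall x, x < dr -> reg s' x = reg s x) /\
  (forall t, t < da -> arr s' t = arr s t).

(** States are compared pointwise, since moving an update through [high] yields functions that are
    only extensionally equal. *)
Definition agree (s s' : state) : Prop :=
  reg s =1 reg s' /\ forall t, arr s t =1 arr s' t.

Lemma agree_eval s s' a : agree s s' -> eval w s a = eval w s' a.
Proof.
move=> [hr ha]; elim: a => [//|x|t b IH|o b IHb c IHc] /=.
- exact: hr.
- by rewrite IH; exact: ha.
- by rewrite IHb IHc.
Qed.

Lemma shift_exec c s0 k s0' s :
  exec w c s0 k s0' -> agree (high s) s0 ->
  exists s', [/\ exec w (shift_cmd c) s k s', agree (high s') s0'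
               & agree_low s s'].
Proof.
have ev r r0 a : agree (high r) r0 -> eval w r (shift_aexp a) = eval w r0 a.
  by move=> /agree_eval <-; rewrite shift_eval.
move=> e; elim: e s => {c s0 k s0'}.
- by move=> s0 s eq_s; exists s; split => //; exact: ExSkip.
- move=> x a s0 s eq_s /=; rewrite -(shift_cost a).
  eexists; split; first exact: ExSet.
    split; last by case: eq_s.
    by move=> y /=; rewrite /upd eqn_add2l (ev _ _ _ eq_s); case: eqP => // _; exact: (proj1 eq_s).
  by split => //= y; rewrite /upd; case: eqP => //; lia.
- move=> t a b s0 s eq_s /=; rewrite -(shift_cost a) -(shift_cost b).
  eexists; split; first exact: ExPut.
    split; first by case: eq_s.
    move=> u i /=; rewrite /upd eqn_add2l !(ev _ _ _ eq_s).
    by case: eqP => // _; [case: eqP => // _|]; exact: (proj2 eq_s).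
  by split => //= u; rewrite /upd; case: eqP => //; lia.
- move=> c1 c2 s0 s1 s2 k1 k2 _ IH1 _ IH2 s /IH1 [s' [e1 /IH2 [s'' [e2 eq2 l2]] l1]].
  exists s''; split => //=; first exact: ExSeq e1 e2.
  by split=> x hx; [rewrite (proj1 l2) ?(proj1 l1)|rewrite (proj2 l2) ?(proj2 l1)].
- move=> a c1 c2 s0 s0' k _ IH s eq_s; have [s' [e1 eq1 l1]] := IH s eq_s.
  exists s'; split => //=; rewrite -(shift_cost a); apply: ExIf.
  by rewrite (ev _ _ _ eq_s) (fun_if shift_cmd) in e1 *.
- move=> a c s0 a0 s eq_s; exists s; split => //=.
  by rewrite -(shift_cost a); apply: ExWhileF; rewrite (ev _ _ _ eq_s).
- move=> a c s0 s1 s2 k1 k2 a0 _ IH1 _ IH2 s eq_s.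
  have [s' [e1 /IH2 [s'' [e2 eq2 l2]] l1]] := IH1 s eq_s.
  exists s''; split => //=.
    by rewrite -(shift_cost a); apply: ExWhileT e1 e2; rewrite (ev _ _ _ eq_s).
  by split=> x hx; [rewrite (proj1 l2) ?(proj1 l1)|rewrite (proj2 l2) ?(proj2 l1)].
Qed.

End Shift.

Arguments upd : simpl never.

Definition frame (rs ts : seq nat) (s s' : state) : Prop :=
  (forall x, x \notin rs -> reg s' x = reg s x) /\
  (forall t, t \notin ts -> arr s' t = arr s t).

Lemma frame_refl rs ts s : frame rs ts s s.
Proof. by []. Qed.

Lemma frame_comp rs ts rs1 ts1 rs2 ts2 s1 s2 s3 :
  frame rs1 ts1 s1 s2 -> frame rs2 ts2 s2 s3 ->
  all (mem rs) (rs1 ++ rs2) -> all (mem ts) (ts1 ++ ts2) -> frame rs ts s1 s3.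
Proof.
move=> [r1 a1] [r2 a2]; rewrite !all_cat.
move=> /andP[/allP sr1 /allP sr2] /andP[/allP st1 /allP st2]; split=> x hx.
  by rewrite r2 ?r1 //; apply: contra hx => h; [exact: sr1|exact: sr2].
by rewrite a2 ?a1 //; apply: contra hx => h; [exact: st1|exact: st2].
Qed.

Lemma frame_sub rs ts rs' ts' s s' :
  frame rs' ts' s s' -> all (mem rs) rs' -> all (mem ts) ts' ->
  frame rs ts s s'.
Proof.
move=> f sr st; apply: (frame_comp f (@frame_refl [::] [::] s')).
  by rewrite cats0.
by rewrite cats0.
Qed.

Lemma frame_set rs ts s r a x v :
  frame rs ts s (State r a) -> x \in rs ->
  frame rs ts s (State (upd r x v) a).
Proof.
move=> [hr ha] xr; split=> // y yr; rewrite -hr //= /upd.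
by case: eqP => // yx; rewrite yx xr in yr.
Qed.

Lemma frame_put rs ts s r a t v :
  frame rs ts s (State r a) -> t \in ts ->
  frame rs ts s (State r (upd a t v)).
Proof.
move=> [hr ha] xr; split=> // y yr; rewrite -ha //= /upd.
by case: eqP => // yx; rewrite yx xr in yr.
Qed.

(* Keeps [lia] from reasoning about powers and remainders. *)
Ltac mlia := intros;
  repeat match goal with H : context [modn _ _] |- _ => clear H end;
  lazymatch goal with
  | |- context [expn 2 ?w] => set (M := expn 2 w) in *; clearbody M; lia
  | _ : context [expn 2 ?w] |- _ => set (M := expn 2 w) in *; clearbody M; lia
  | _ => lia
  end.

Ltac wstep := lazymatch goal with
  | |- wp _ (Seq _ _) _ _ => apply: wp_seq
  | |- wp _ (Set_ _ _) _ _ => apply: wp_set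
  | |- wp _ (Put _ _ _) _ _ => apply: wp_put
  | |- wp _ Skip _ _ => apply: wp_skip
  end; simpl.

Ltac frame_tac := simpl;
  repeat first [apply: frame_set; [|by []] | apply: frame_put; [|by []]];
  first [assumption | exact: frame_refl].

Definition incr (x n : nat) : cmd := Set_ x (Bin Add (Reg x) (Lit n)).

(** * A weighted digraph stored as linked lists *)

(* The Boolean selects one of two copies of the data structure; in each of
   them, the arrays number 0 to 4 hold the heads of the lists, the links, the
   list items, the marks and the weights. *)
Definition garr (b : bool) (i : nat) : nat :=
  nth 0 (if b then [:: 15; 16; 17; 18; 19] else [:: 10; 11; 12; 13; 14]) i.
Definition gcnt (b : bool) : nat := if b then 19 else 6.

(** The reversal reflects that a new arc goes to the front of the linked list of its source. *)
Definition out (L : seq (nat * nat)) (u : nat) : seq nat :=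
  [seq p.2 | p <- rev L & p.1 == u].

Lemma out_rcons L u x v :
  out (rcons L (u, x)) v = if u == v then x :: out L v else out L v.
Proof. by rewrite /out rev_rcons /=; case: eqP. Qed.

Lemma mem_out L u x : (x \in out L u) = ((u, x) \in L).
Proof.
apply/mapP/idP => [[[v y]]|ux].
  by rewrite mem_filter mem_rev /= => /andP[/eqP -> ?] ->.
by exists (u, x); rewrite // mem_filter mem_rev /= eqxx.
Qed.

(** Arcs are numbered from 1, so that link 0 ends a list and stops the loop that walks it. The bound
    [e] protects a list when the cell [e.+1] of a new arc is written. *)
Fixpoint chain (nxt dst : nat -> nat) (e y : nat) (l : seq nat) : Prop :=
  if l is x :: l' then [/\ 0 < y <= e, dst y = x & chain nxt dst e (nxt y) l']
  else y = 0.

Lemma chain_ext nxt dst nxt' dst' e e' y l :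
  e <= e' ->
  (forall z, 0 < z <= e -> nxt' z = nxt z /\ dst' z = dst z) ->
  chain nxt dst e y l -> chain nxt' dst' e' y l.
Proof.
move=> ee' h; elim: l y => //= x l IHl y [ye dy c].
have [h1 h2] := h _ ye; rewrite h1 h2; split => //; first lia.
exact: IHl.
Qed.

(** By [ga_mark], marks need no erasing: a mark names the vertex whose list was walked, plus 1 to
    differ from the initial 0, and it stays truthful because arcs are only added. Memory starts out
    arbitrary, hence the restriction to the initialised vertices below [n]. *)
Record graph_at (b : bool) (s : state) (n : nat) (L : seq (nat * nat))
    (W : nat -> nat) : Prop := GraphAt {
  ga_cnt : reg s (gcnt b) = size L;
  ga_out u : u < n ->
    chain (arr s (garr b 1)) (arr s (garr b 2)) (size L)
      (arr s (garr b 0) u) (out L u);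
  ga_mark u x : x < n -> arr s (garr b 3) x = u.+1 -> (u, x) \in L;
  ga_wt x : x < n -> arr s (garr b 4) x = W x;
  ga_lt u x : (u, x) \in L -> x < n }.

Definition init_vertex (b : bool) : cmd :=
  Seq (Put (garr b 0) (Reg 17) (Lit 0))
 (Seq (Put (garr b 3) (Reg 17) (Lit 0))
      (Put (garr b 4) (Reg 17) (Reg 15))).

Definition add_arc (b : bool) : cmd :=
  Seq (incr (gcnt b) 1)
 (Seq (Put (garr b 1) (Reg (gcnt b)) (Get (garr b 0) (Reg 17)))
 (Seq (Put (garr b 2) (Reg (gcnt b)) (Reg 18))
      (Put (garr b 0) (Reg 17) (Reg (gcnt b))))).

(* Sums the weights of the common out-neighbours of two vertices: those of the
   first one are marked while walking through its list. *)
Definition query (b : bool) : cmd :=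
  Seq (Set_ 16 (Get (garr b 0) (Reg 17)))
 (Seq (While (Reg 16)
        (Seq (Put (garr b 3) (Get (garr b 2) (Reg 16))
               (Bin Add (Reg 17) (Lit 1)))
             (Set_ 16 (Get (garr b 1) (Reg 16)))))
 (Seq (Set_ 15 (Lit 0))
 (Seq (Set_ 16 (Get (garr b 0) (Reg 18)))
      (While (Reg 16)
        (Seq (If (Bin Eq (Get (garr b 3) (Get (garr b 2) (Reg 16)))
                   (Bin Add (Reg 17) (Lit 1)))
               (Set_ 15 (Bin Add (Reg 15)
                           (Get (garr b 4) (Get (garr b 2) (Reg 16)))))
               Skip)
             (Set_ 16 (Get (garr b 1) (Reg 16)))))))).

Section Graph.

Variable w : nat.
Local Notation M := (2 ^ w).

Lemma init_vertex_spec b s n L W W' (Q : nat -> state -> Prop) :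
  2 < M ->
  graph_at b s n L W -> reg s 17 = n ->
  (forall x, x < n -> W' x = W x) -> W' n = reg s 15 ->
  (forall x, (n, x) \notin L) ->
  (forall s', frame [::] [:: garr b 0; garr b 3; garr b 4] s s' ->
     graph_at b s' n.+1 L W' -> Q 9 s') ->
  wp w (init_vertex b) s Q.
Proof.
move=> M2 [gc go gm gw gl] r17 WW' W'n nL H.
rewrite /init_vertex; do 5 wstep; apply: H.
  by case: b {gc go gm gw gl} => /=; frame_tac.
case: b gc go gm gw gl => gc go gm gw gl; split; rewrite /= /upd //=.
all: rewrite ?r17 ?mod0n.
all: try by move=> u x /gl; mlia.
all: try (move=> u un; case: eqP => [->|nu]; [|by apply: go; mlia]).
all: try by rewrite ?mod0n; have -> : out L n = [::] by
   apply/eqP; case e: out => [//|x l]; have := nL x; rewrite -mem_out e mem_head.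
all: try by move=> u x xn; case: eqP => [->|nx] //; apply: gm; mlia.
all: by move=> x xn; case: eqP => [->|nx] //; rewrite ?W'n // gw ?WW' //; mlia.
Qed.

Lemma add_arc_spec b s n L W u x (Q : nat -> state -> Prop) :
  size L + 1 < M ->
  graph_at b s n L W -> reg s 17 = u -> reg s 18 = x -> x < n ->
  (forall s', frame [:: gcnt b] [:: garr b 0; garr b 1; garr b 2] s s' ->
     graph_at b s' n (rcons L (u, x)) W -> Q 14 s') ->
  wp w (add_arc b) s Q.
Proof.
move=> LM [gc go gm gw gl] ru rx xn H.
rewrite /add_arc /incr; do 7 wstep; rewrite /=; apply: H.
  by case: b {gc go gm gw gl} => /=; frame_tac.
have M1 : 1 %% M = 1 by rewrite modn_small //; mlia.
case: b gc go gm gw gl => gc go gm gw gl; split; rewrite /= /upd //= ?size_rcons.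
all: rewrite ?gc ?ru ?rx ?M1 ?addn1 ?modn_small; try mlia.
all: try by move=> v y; rewrite mem_rcons inE => /orP[/eqP[_ ->]|/gl] //.
all: try by move=> v y yn my; rewrite mem_rcons inE gm ?orbT.
all: move=> v vn; rewrite out_rcons eq_sym; have := go _ vn; case: eqP => [->|_] /=.
all: rewrite ?eqxx => c.
all: try (split; [by mlia|by []|]).
all: apply: chain_ext c => [|z]; first mlia.
all: by case: eqP => //; mlia.
Qed.

Lemma query_spec b s n L W u v (Q : nat -> state -> Prop) :
  n + 2 < M -> size L < M ->
  graph_at b s n L W -> reg s 17 = u -> reg s 18 = v -> u < n -> v < n ->
  (forall k s', k <= 20 * (size (out L u) + size (out L v) + 1) ->
     frame [:: 15; 16] [:: garr b 3] s s' ->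
     graph_at b s' n L W ->
     reg s' 15 = (\sum_(x <- out L v | x \in out L u) W x) %% M -> Q k s') ->
  wp w (query b) s Q.
Proof.
move=> nM LM G ru rv un vn H.
have M1 : 1 %% M = 1 by rewrite modn_small //; mlia.
rewrite /query; do 3 wstep.
apply: wp_weaken.
  apply: (wp_while (n := size (out L u)) (f := fun=> 9)
    (I := fun j s1 => [/\ frame [:: 16] [:: garr b 3] s s1,
       chain (arr s (garr b 1)) (arr s (garr b 2)) (size L) (reg s1 16)
         (drop j (out L u))
     & forall x, arr s1 (garr b 3) x =
         if x \in take j (out L u) then u.+1 else arr s (garr b 3) x])).
  - move=> j s1 jn [_ c _] /=; move: c; rewrite (drop_nth 0 jn) /=.
    by case=> [/andP[]]; case: (reg s1 16).
  - move=> j s1 jn [fr c mk] /=; move: c; rewrite (drop_nth 0 jn) => -[yL yx c].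
    do 3 wstep; rewrite /=; split => //.
    { case: b {H} G c fr yx mk => G c fr yx mk; split; try frame_tac.
    all: rewrite /= ?/upd /=.
    all: rewrite ?(fr.2 16 isT) ?(fr.2 17 isT) ?(fr.2 11 isT) ?(fr.2 12 isT) //.
    all: move=> x; rewrite (take_nth 0 jn) mem_rcons inE yx mk.
    all: by case: eqP => //= _; rewrite (fr.1 17 isT) ru M1 modn_small //; mlia. }
  - by move=> s1 [_ c _]; move: c; rewrite drop_size.
  - split.
    + by frame_tac.
    + by rewrite drop0 /upd /= ru; exact: (ga_out G un).
    + by rewrite take0.
move=> k1 s1 [k1le [fr1 _ mk]].
have {k1le}k1le : k1 <= 11 * size (out L u) + 2.
  by move: k1le; rewrite sum_nat_const_nat /= subn0; mlia.
rewrite take_size in mk.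
have G1 : graph_at b s1 n L W.
{  case: G => gc go gm gw gl; case: b {H} fr1 mk gc go gm gw => fr1 mk gc go gm gw.
  all: split => //=; rewrite ?(fr1.1 6 isT) ?(fr1.1 19 isT) //.
  all: rewrite ?(fr1.2 10 isT) ?(fr1.2 11 isT) ?(fr1.2 12 isT) ?(fr1.2 14 isT) //.
  all: rewrite ?(fr1.2 15 isT) ?(fr1.2 16 isT) ?(fr1.2 17 isT) ?(fr1.2 19 isT) //.
  all: move=> z x xn; rewrite [arr s1 _ x]mk; case: ifP => [xu [<-]|_]; last exact: gm.
  all: by rewrite -mem_out. }
(* A mark left by an earlier query is harmless: [ga_mark] turns it into an arc, and all arcs from
   [u] have just been marked. *)
have mkE x : x < n -> (arr s1 (garr b 3) x == u.+1) = (x \in out L u).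
  move=> xn; apply/eqP/idP => [|xu]; first by rewrite mem_out; exact: (ga_mark G1 xn).
  by rewrite mk xu.
do 4 wstep.
apply: wp_weaken.
  apply: (wp_while (n := size (out L v)) (f := fun=> 17)
    (I := fun j s2 => [/\ frame [:: 15; 16] [::] s1 s2,
       chain (arr s1 (garr b 1)) (arr s1 (garr b 2)) (size L) (reg s2 16)
         (drop j (out L v))
     & reg s2 15 = (\sum_(x <- take j (out L v) | x \in out L u) W x) %% M])).
  - move=> j s2 jn [_ c _] /=; move: c; rewrite (drop_nth 0 jn) /=.
    by case=> [/andP[]]; case: (reg s2 16).
  - move=> j s2 jn [fr c ac] /=; move: c; rewrite (drop_nth 0 jn) => -[yL yx c].
    have xn : nth 0 (out L v) j < n.
      by apply: (ga_lt G (u := v)); rewrite -mem_out mem_nth.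
    wstep; apply: wp_if; rewrite /= !fr.2 // yx (fr.1 17 isT) (fr1.1 17 isT) ru M1.
    rewrite (@modn_small (u + 1)) ?addn1 ?mkE //; last mlia.
    have -> : ((nth 0 (out L v) j \in out L u) %% M != 0) =
       (nth 0 (out L v) j \in out L u).
      by case: (_ \in _); rewrite ?M1 ?mod0n.
    rewrite (take_nth 0 jn) -cats1 big_cat big_cons big_nil /=.
    case: ifP => xu; do 2 wstep; split => //; split.
    + by frame_tac.
    + by rewrite /= /upd /= fr.2.
    + rewrite /= /upd /= !fr.2 // yx ac (ga_wt G1 xn).
      by rewrite addn0 modnDml.
    + by frame_tac.
    + by rewrite /= /upd /= fr.2.
    + by rewrite /= /upd /= addn0.
  - by move=> s2 [_ c _]; move: c; rewrite drop_size.
  - split.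
    + by frame_tac.
    + by rewrite drop0 /upd /= (fr1.1 18 isT) rv; exact: (ga_out G1 vn).
    + by rewrite take0 big_nil /upd /=.
move=> k2 s2 [k2le [fr2 _ ac]]; apply: H.
- by move: k2le; rewrite sum_nat_const_nat /= subn0; mlia.
- by apply: (frame_comp fr1 fr2); case: (b).
- by case: G1 => gc go gm gw gl; split; rewrite ?fr2.2 ?fr2.1 //; case: (b).
- by rewrite take_size in ac.
Qed.

End Graph.

(** * The stack of arguments and the list of blocks *)

(* The graph of a subexpression occupies the vertices [first], ...,
   [first + order - 1]; [degsum] is twice the number of its edges. *)
Record part := Part { first : nat; order : nat; degsum : nat }.

(* All pairs of a vertex among the [snd b.1] ones from [fst b.1] on and of a
   vertex among the [snd b.2] ones from [fst b.2] on. *)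
Definition block : Type := (nat * nat) * (nat * nat).

Definition part0 : part := Part 0 0 0.
Definition block0 : block := ((0, 0), (0, 0)).

Definition part_block (a b : part) : block :=
  ((first a, order a), (first b, order b)).

(* Six times the number of triangles with exactly two vertices in one of two
   completely joined parts. *)
Definition part_tri (a b : part) : nat :=
  3 * (degsum a * order b + degsum b * order a).

(** The flag [jn] selects a complete join. Without it the parts are concatenated, which serves
    [Union] and also [Subst], whose edges between arguments are credited to the first part
    beforehand. *)
Definition merge_part (jn : bool) (a b : part) : part :=
  Part (first a) (order a + order b)
    (degsum a + degsum b + jn * (2 * (order a * order b))).

Fixpoint merge_tri (jn : bool) (a : part) (bs : seq part) : nat :=
  if bs is b :: bs' then
    jn * part_tri a b + merge_tri jn (merge_part jn a b) bs'
  else 0.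

Fixpoint merge_blocks (jn : bool) (a : part) (bs : seq part) : seq block :=
  if bs is b :: bs' then
    (if jn then [:: part_block a b] else [::]) ++
    merge_blocks jn (merge_part jn a b) bs'
  else [::].

Lemma merge_tri_rcons jn a bs b :
  merge_tri jn a (rcons bs b) =
  merge_tri jn a bs + jn * part_tri (foldl (merge_part jn) a bs) b.
Proof. by elim: bs a => /= [|c bs IH] a; rewrite ?addn0 // IH addnA. Qed.

Lemma merge_blocks_rcons jn a bs b :
  merge_blocks jn a (rcons bs b) =
  merge_blocks jn a bs ++
  (if jn then [:: part_block (foldl (merge_part jn) a bs) b] else [::]).
Proof. by elim: bs a => /= [|c bs IH] a; rewrite ?cats0 // IH catA. Qed.

Lemma size_merge_blocks jn a bs : size (merge_blocks jn a bs) = jn * size bs.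
Proof.
by elim: bs a => /= [|c bs IH] a; rewrite ?muln0 // size_cat IH; case: (jn) => /=; lia.
Qed.

Lemma first_merge jn a bs : first (foldl (merge_part jn) a bs) = first a.
Proof. by elim: bs a => //= b bs IH a; rewrite IH. Qed.

Lemma order_merge jn a bs :
  order (foldl (merge_part jn) a bs) = order a + sumn (map order bs).
Proof. by elim: bs a => /= [|b bs IH] a; rewrite ?addn0 // IH /=; lia. Qed.

Lemma eq_modD d m m' n n' :
  m = m' %[mod d] -> n = n' %[mod d] -> m + n = m' + n' %[mod d].
Proof. by move=> hm hn; rewrite -modnDm hm hn modnDm. Qed.

Lemma eq_modM d m m' n n' :
  m = m' %[mod d] -> n = n' %[mod d] -> m * n = m' * n' %[mod d].
Proof. by move=> hm hn; rewrite -modnMm hm hn modnMm. Qed.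

Lemma eq_mod_mod d m m' : m = m' %[mod d] -> m %% d = m' %[mod d].
Proof. by rewrite modn_mod. Qed.

Ltac mod_tac :=
  repeat first [apply: eq_mod_mod | reflexivity | apply: eq_modD | apply: eq_modM].

Section Tables.

Variable w : nat.
Local Notation M := (2 ^ w).

(** First vertices and orders are exact, since they become addresses and loop bounds; a degree sum
    only enters the count, which is known modulo [2 ^ w] anyway. *)
Record stack_at (s : state) (st : seq part) : Prop := StackAt {
  sa_size : reg s 2 = size st;
  sa_first i : i < size st -> arr s 1 i = first (nth part0 st i);
  sa_order i : i < size st -> arr s 2 i = order (nth part0 st i);
  sa_degsum i : i < size st -> arr s 3 i = degsum (nth part0 st i) %% M }.

Record blocks_at (s : state) (bl : seq block) : Prop := BlocksAt {
  ba_size : reg s 5 = size bl;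
  ba_nth i : i < size bl ->
    ((arr s 4 i, arr s 5 i), (arr s 6 i, arr s 7 i)) = nth block0 bl i }.

Definition input_at (s : state) (code : seq nat) : Prop :=
  reg s 0 = size code /\ forall i, i < size code -> arr s 0 i = nth 0 code i.

Definition edges_at (s : state) (E : seq (nat * nat)) : Prop :=
  [/\ reg s 12 = size E, reg s 1 + 2 * size E + 4 < M &
      forall i, i < size E ->
        arr s 0 (reg s 1 + 3 + 2 * i) = (nth (0, 0) E i).1 /\
        arr s 0 (reg s 1 + 4 + 2 * i) = (nth (0, 0) E i).2].

Lemma stack_at_frame rs ts s s' st :
  frame rs ts s s' -> 2 \notin rs -> 1 \notin ts -> 2 \notin ts -> 3 \notin ts ->
  stack_at s st -> stack_at s' st.
Proof. by move=> [hr ha] ? ? ? ? [? ? ? ?]; split; rewrite ?hr ?ha. Qed.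

Lemma blocks_at_frame rs ts s s' bl :
  frame rs ts s s' -> 5 \notin rs ->
  4 \notin ts -> 5 \notin ts -> 6 \notin ts -> 7 \notin ts ->
  blocks_at s bl -> blocks_at s' bl.
Proof. by move=> [hr ha] ? ? ? ? ? [? ?]; split; rewrite ?hr ?ha. Qed.

Lemma input_at_frame rs ts s s' code :
  frame rs ts s s' -> 0 \notin rs -> 0 \notin ts ->
  input_at s code -> input_at s' code.
Proof. by move=> [hr ha] ? ? [? ?]; split; rewrite ?hr ?ha. Qed.

Lemma edges_at_frame rs ts s s' E :
  frame rs ts s s' -> 12 \notin rs -> 1 \notin rs -> 0 \notin ts ->
  edges_at s E -> edges_at s' E.
Proof. by move=> [hr ha] ? ? ? [? ? ?]; split; rewrite ?hr ?ha. Qed.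

Lemma graph_at_frame rs ts s s' b n L W :
  frame rs ts s s' -> gcnt b \notin rs ->
  garr b 0 \notin ts -> garr b 1 \notin ts -> garr b 2 \notin ts ->
  garr b 3 \notin ts -> garr b 4 \notin ts ->
  graph_at b s n L W -> graph_at b s' n L W.
Proof. by move=> [hr ha] ? ? ? ? ? ? [? ? ? ? ?]; split; rewrite ?hr ?ha. Qed.

Lemma lit_small n : n < M -> n %% M = n.
Proof. exact: modn_small. Qed.

Definition pair_up : cmd :=
  Seq (Set_ 4 (Bin Add (Reg 4) (Bin Mul (Lit 3)
    (Bin Add (Bin Mul (Get 3 (Reg 13)) (Get 2 (Reg 14)))
             (Bin Mul (Get 3 (Reg 14)) (Get 2 (Reg 13)))))))
 (Seq (Set_ 11 (Bin Add (Reg 11) (Bin Mul (Lit 2)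
    (Bin Mul (Get 2 (Reg 13)) (Get 2 (Reg 14))))))
 (Seq (Put 4 (Reg 5) (Get 1 (Reg 13)))
 (Seq (Put 5 (Reg 5) (Get 2 (Reg 13)))
 (Seq (Put 6 (Reg 5) (Get 1 (Reg 14)))
 (Seq (Put 7 (Reg 5) (Get 2 (Reg 14)))
      (incr 5 1)))))).

Lemma blocks_at_push s s' bl b :
  size bl + 1 < M -> blocks_at s bl ->
  reg s' 5 = (reg s 5 + 1) %% M ->
  arr s' 4 = upd (arr s 4) (reg s 5) b.1.1 ->
  arr s' 5 = upd (arr s 5) (reg s 5) b.1.2 ->
  arr s' 6 = upd (arr s 6) (reg s 5) b.2.1 ->
  arr s' 7 = upd (arr s 7) (reg s 5) b.2.2 ->
  blocks_at s' (rcons bl b).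
Proof.
move=> bM [r5 bs] r5' a4 a5 a6 a7; split.
  by rewrite r5' r5 size_rcons lit_small ?bM ?addn1.
move=> i; rewrite size_rcons ltnS nth_rcons a4 a5 a6 a7 r5 /upd => ib.
have [ltib|->] : i < size bl \/ i = size bl by mlia.
  by rewrite (ltn_eqF ltib) ltib bs.
by rewrite ltnn eqxx; case: (b) => [[? ?] [? ?]].
Qed.

Lemma pair_up_spec s st bl T D p q (Q : nat -> state -> Prop) :
  size bl + 3 < M -> stack_at s st -> blocks_at s bl ->
  reg s 13 = p -> reg s 14 = q -> p < size st -> q < size st ->
  reg s 4 = T %% M -> reg s 11 = D %% M ->
  (forall k s', k <= 50 -> frame [:: 4; 5; 11] [:: 4; 5; 6; 7] s s' ->
     blocks_at s' (rcons bl (part_block (nth part0 st p) (nth part0 st q))) ->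
     reg s' 4 = (T + part_tri (nth part0 st p) (nth part0 st q)) %% M ->
     reg s' 11 =
       (D + 2 * (order (nth part0 st p) * order (nth part0 st q))) %% M ->
     Q k s') ->
  wp w pair_up s Q.
Proof.
move=> bM S B rp rq pst qst rT rD H.
rewrite /pair_up /incr; do 13 wstep; apply: H => //; first by frame_tac.
- { apply: (blocks_at_push (s := s)) => //=; first by mlia.
  all: rewrite /= /upd /= ?rp ?rq ?(sa_first S pst) ?(sa_first S qst) //.
  all: by rewrite ?modnDmr ?(sa_order S pst) ?(sa_order S qst). }
- rewrite /= /upd /= rp rq rT !(sa_degsum S) // !(sa_order S) //.
  by rewrite /part_tri; mod_tac.
- rewrite /= /upd /= rp rq rD !(sa_order S) //.
  by mod_tac.
Qed.

Definition merge_one : cmd :=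
  Seq (If (Bin Eq (Reg 7) (Lit 3))
         (Seq (Set_ 13 (Reg 9))
         (Seq (Set_ 14 (Bin Add (Reg 9) (Reg 10))) pair_up))
         Skip)
 (Seq (Put 3 (Reg 9) (Bin Add (Bin Add (Get 3 (Reg 9))
         (Get 3 (Bin Add (Reg 9) (Reg 10)))) (Reg 11)))
 (Seq (Set_ 11 (Lit 0))
 (Seq (Put 2 (Reg 9) (Bin Add (Get 2 (Reg 9))
         (Get 2 (Bin Add (Reg 9) (Reg 10)))))
      (incr 10 1)))).

Definition merge : cmd :=
  Seq (Set_ 10 (Lit 1))
 (Seq (While (Bin Lt (Reg 10) (Reg 8)) merge_one)
      (Set_ 2 (Bin Add (Reg 9) (Lit 1)))).

Lemma stack_at_upd s s' st0 a a' bs :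
  stack_at s (st0 ++ a :: bs) -> reg s' 2 = reg s 2 ->
  arr s' 1 = arr s 1 -> first a' = first a ->
  arr s' 2 =1 upd (arr s 2) (size st0) (order a') ->
  arr s' 3 =1 upd (arr s 3) (size st0) (degsum a' %% M) ->
  stack_at s' (st0 ++ a' :: bs).
Proof.
move=> [r2 h1 h2 h3] r2' a1 fa a2 a3.
split; first by rewrite r2' r2 !size_cat.
all: move=> i; have := (h1 i, h2 i, h3 i); rewrite !size_cat /= => -[[e1 e2] e3] ist.
all: have := (e1 ist, e2 ist, e3 ist); rewrite !nth_cat => -[[{}e1 {}e2] {}e3].
all: rewrite ?a1 ?a2 ?a3 /upd.
- by move: e1; case: ltnP => // h; case: (i - size st0) => //=; rewrite fa.
- move: e2; case: eqP => [->|ni]; first by rewrite ltnn subnn.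
  by case: ltnP => // h; case e: (i - size st0) => [|j] //; mlia.
- move: e3; case: eqP => [->|ni]; first by rewrite ltnn subnn.
  by case: ltnP => // h; case e: (i - size st0) => [|j] //; mlia.
Qed.

Lemma stack_at_take s s' st0 a bs :
  stack_at s (st0 ++ a :: bs) -> reg s' 2 = (size st0).+1 ->
  arr s' 1 = arr s 1 -> arr s' 2 = arr s 2 -> arr s' 3 = arr s 3 ->
  stack_at s' (rcons st0 a).
Proof.
move=> [r2 h1 h2 h3] r2' a1 a2 a3; split; rewrite ?size_rcons //.
all: move=> i ist; have := (h1 i, h2 i, h3 i); rewrite size_cat /= => -[[e1 e2] e3].
all: rewrite ?a1 ?a2 ?a3 ?e1 ?e2 ?e3; try mlia.
all: rewrite nth_cat nth_rcons.
all: have [->|->] : (i < size st0) \/ i = size st0 by mlia.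
all: by rewrite ?ltnn ?eqxx ?subnn.
Qed.

Lemma merge_spec s st0 a bs bl T jn (Q : nat -> state -> Prop) :
  size st0 + size bs + 3 < M -> size bl + size bs + 3 < M ->
  order a + sumn (map order bs) < M ->
  stack_at s (st0 ++ a :: bs) -> blocks_at s bl ->
  reg s 4 = T %% M -> (reg s 7 == 3) = jn -> reg s 8 = (size bs).+1 ->
  reg s 9 = size st0 -> reg s 11 = 0 ->
  (forall k s', k <= 110 * (size bs + 1) ->
     frame [:: 2; 4; 5; 10; 11; 13; 14] [:: 2; 3; 4; 5; 6; 7] s s' ->
     stack_at s' (rcons st0 (foldl (merge_part jn) a bs)) ->
     blocks_at s' (bl ++ merge_blocks jn a bs) ->
     reg s' 4 = (T + merge_tri jn a bs) %% M -> Q k s') ->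
  wp w merge s Q.
Proof.
move=> stM blM oM S B rT r7 r8 r9 r11 H.
have M1 : 1 %% M = 1 by rewrite lit_small; mlia.
have M3 : 3 %% M = 3 by rewrite lit_small; mlia.
rewrite /merge; do 3 wstep.
apply: wp_weaken.
  apply: (wp_while (n := size bs) (f := fun=> 95)
    (I := fun j s1 =>
      [/\ frame [:: 4; 5; 10; 11; 13; 14] [:: 2; 3; 4; 5; 6; 7] s s1,
          stack_at s1 (st0 ++ foldl (merge_part jn) a (take j bs) :: bs),
          blocks_at s1 (bl ++ merge_blocks jn a (take j bs))
        & [/\ reg s1 4 = (T + merge_tri jn a (take j bs)) %% M,
              reg s1 10 = j.+1 & reg s1 11 = 0]])).
  - move=> j s1 jn' [fr _ _ [_ r10 _]] /=.
    by rewrite r10 (fr.1 8 isT) r8 ltnS jn' M1.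
  - move=> j s1 jb [fr S1 B1 [rT1 r10 r11']].
    set c := foldl _ _ _ in S1.
    set nb := nth part0 bs j.
    have e1 : nth part0 (st0 ++ c :: bs) (size st0) = c.
      by rewrite nth_cat ltnn subnn.
    have e2 : nth part0 (st0 ++ c :: bs) (size st0 + j.+1) = nb.
      by rewrite nth_cat ltnNge leq_addr /= addnC addnK.
    have l1 : size st0 < size (st0 ++ c :: bs) by rewrite size_cat /=; mlia.
    have l2 : size st0 + j.+1 < size (st0 ++ c :: bs) by rewrite size_cat /=; mlia.
    have cM : order c + order nb < M.
      apply: leq_ltn_trans oM; rewrite order_merge -addnA leq_add2l.
      rewrite -{2}(cat_take_drop j.+1 bs) map_cat sumn_cat (take_nth part0 jb).
      by rewrite map_rcons sumn_rcons leq_addr.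
    have Tk : T + merge_tri jn a (take j.+1 bs) =
        T + merge_tri jn a (take j bs) + jn * part_tri c nb.
      by rewrite (take_nth part0 jb) merge_tri_rcons addnA.
    have Bk : bl ++ merge_blocks jn a (take j.+1 bs) =
        (bl ++ merge_blocks jn a (take j bs)) ++
        (if jn then [:: part_block c nb] else [::]).
      by rewrite (take_nth part0 jb) merge_blocks_rcons catA.
    have ck : foldl (merge_part jn) a (take j.+1 bs) = merge_part jn c nb.
      by rewrite (take_nth part0 jb) foldl_rcons.
    have jM : j.+1 + 1 < M by move: stM jb; clear; mlia.
    rewrite /merge_one /incr; wstep.
    suff P1 : wp w (If (Bin Eq (Reg 7) (Lit 3))
         (Seq (Set_ 13 (Reg 9))
         (Seq (Set_ 14 (Bin Add (Reg 9) (Reg 10))) pair_up))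
         Skip) s1 (fun k s2 => [/\ k <= 65,
           frame [:: 4; 5; 11; 13; 14] [:: 4; 5; 6; 7] s1 s2,
           blocks_at s2 (bl ++ merge_blocks jn a (take j.+1 bs)),
           reg s2 4 = (T + merge_tri jn a (take j.+1 bs)) %% M
         & reg s2 11 = (jn * (2 * (order c * order nb))) %% M]).
      apply: wp_weaken P1 _ => k2 s2 [k2le fr2 B2 rT2 r11''].
      have S2 : stack_at s2 (st0 ++ c :: bs) by apply: stack_at_frame fr2 _ _ _ _ S1.
      have r9' : reg s2 9 = size st0 by rewrite fr2.1 // fr.1.
      have r10' : reg s2 10 = j.+1 by rewrite fr2.1.
      do 7 wstep; split; first by simpl; mlia.
      have lM : (size st0 + j.+1) %% M = size st0 + j.+1 by rewrite lit_small; mlia.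
      split.
      + have fr3 : frame [:: 4; 5; 10; 11; 13; 14] [:: 2; 3; 4; 5; 6; 7] s s2.
          by apply: (frame_comp fr fr2).
        by frame_tac.
      + rewrite ck; apply: (stack_at_upd S2) => //=; move=> i; rewrite /upd /= r9' r10' lM.
          rewrite (sa_order S2 l1) (sa_order S2 l2) e1 e2.
          by rewrite lit_small.
        rewrite (sa_degsum S2 l1) (sa_degsum S2 l2) e1 e2 r11''.
        by case: eqP => // _; mod_tac.
      + by apply: (@blocks_at_frame [:: 2; 3; 10; 11] [:: 2; 3] s2) B2 => //; frame_tac.
      + by rewrite /upd /= rT2 r10' M1 mod0n (lit_small jM) addn1.
    apply: wp_if; rewrite /= (fr.1 7 isT) M3.
    have -> : ((reg s 7 == 3) %% M != 0) = jn.
      by rewrite r7; case: (jn); rewrite ?M1 ?mod0n.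
    rewrite Tk Bk; have [jt|jf] : jn = true \/ jn = false by case: (jn); [left|right].
      2: by rewrite {1 4 6}jf; wstep; rewrite jf /= ?cats0 ?mul0n ?addn0 ?mod0n -?jf.
    rewrite {1}jt /=.
    have f2 : frame [:: 13; 14] [::] s1 (State (upd (upd (reg s1) 13 (reg s1 9))
        14 ((reg s1 9 + reg s1 10) %% M)) (arr s1)) by frame_tac.
    do 4 wstep; apply: (@pair_up_spec _ (st0 ++ c :: bs)
      (bl ++ merge_blocks jn a (take j bs)) (T + merge_tri jn a (take j bs)) 0
      (size st0) (size st0 + j.+1)) => //=.
    + by rewrite size_cat size_merge_blocks size_take jb; case: (jn); mlia.
    + exact: stack_at_frame f2 _ _ _ _ S1.
    + exact: blocks_at_frame f2 _ _ _ _ _ B1.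
    + by rewrite /upd /= (fr.1 9 isT).
    + by rewrite /upd /= (fr.1 9 isT) r9 r10 lit_small //; mlia.
    + by rewrite /upd /= r11' mod0n.
    move=> k2 s2 k2le fr2; rewrite e1 e2 => B2 rT2 D2; split => //.
    + by simpl; mlia.
    + by apply: (frame_comp f2 fr2).
    + by rewrite jt cats1 -jt.
    + by rewrite jt mul1n -jt.
    + by rewrite D2 jt mul1n.
  - move=> s1 [fr _ _ [_ r10 _]] /=.
    by rewrite r10 (fr.1 8 isT) r8 ltnn mod0n.
  - split.
    + by frame_tac.
    + rewrite take0; apply: (@stack_at_frame [:: 10] [::] s) S => //.
      by frame_tac.
    + rewrite take0 cats0; apply: (@blocks_at_frame [:: 10] [::] s) B => //.
      by frame_tac.
    + by rewrite take0 addn0 /upd /= M1.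
move=> k1 s1 [k1le [fr1 S1 B1 [rT1 r10 r11']]].
rewrite take_size in S1 B1 rT1.
wstep; apply: H => //.
- by move: k1le; rewrite sum_nat_const_nat /=; mlia.
- have fr2 := frame_sub (rs := [:: 2; 4; 5; 10; 11; 13; 14])
    (ts := [:: 2; 3; 4; 5; 6; 7]) fr1 isT isT.
  by frame_tac.
- apply: (stack_at_take S1) => //=; rewrite /upd /= (fr1.1 9 isT) r9 M1.
  by rewrite lit_small ?addn1 //; mlia.
- by apply: (@blocks_at_frame [:: 2] [::] s1) B1 => //; frame_tac.
Qed.

(** * Loops over the edges of a substitution graph *)

Definition each_edge (body : cmd) : cmd :=
  Seq (Set_ 10 (Lit 0))
      (While (Bin Lt (Reg 10) (Reg 12))
        (Seq (Set_ 17 (Get 0 (Bin Add (Bin Add (Reg 1) (Lit 3))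
                               (Bin Mul (Lit 2) (Reg 10)))))
        (Seq (Set_ 18 (Get 0 (Bin Add (Bin Add (Reg 1) (Lit 4))
                               (Bin Mul (Lit 2) (Reg 10)))))
        (Seq body (incr 10 1))))).

(** The invariant [I] has to be insensitive to registers 10, 17 and 18, which the loop itself
    overwrites between two runs of the body. *)
Lemma each_edge_spec s E body (I : nat -> state -> Prop) (f : nat -> nat) rs ts
    (Q : nat -> state -> Prop) :
  edges_at s E ->
  all (fun x => x \notin rs) [:: 1; 10; 12] -> 0 \notin ts ->
  (forall j s1 s2, frame [:: 10; 17; 18] [::] s1 s2 -> I j s1 -> I j s2) ->
  (forall j s1, j < size E -> I j s1 ->
     frame (10 :: 17 :: 18 :: rs) ts s s1 ->
     reg s1 17 = (nth (0, 0) E j).1 -> reg s1 18 = (nth (0, 0) E j).2 ->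
     wp w body s1 (fun k s2 => [/\ k <= f j, I j.+1 s2 & frame rs ts s1 s2])) ->
  I 0 s ->
  (forall k s', k <= \sum_(0 <= j < size E) (f j + 40) + 10 ->
     I (size E) s' -> frame (10 :: 17 :: 18 :: rs) ts s s' -> Q k s') ->
  wp w (each_edge body) s Q.
Proof.
move=> [r12 EM cE] /and4P[rs1 rs10 rs12 _] ts0 Iext body_spec I0 H.
have M1 : 1 %% M = 1 by rewrite lit_small; mlia.
have fr_rs s1 s2 : frame rs ts s1 s2 -> frame (10 :: 17 :: 18 :: rs) ts s1 s2.
  by move/frame_sub; apply; apply/allP => x /= xs; rewrite ?inE xs ?orbT.
have fr10 s1 s2 : frame [:: 10; 17; 18] [::] s1 s2 ->
    frame (10 :: 17 :: 18 :: rs) ts s1 s2.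
  by move/frame_sub; apply => //=; rewrite !inE ?eqxx ?orbT.
have frC s1 s2 s3 : frame (10 :: 17 :: 18 :: rs) ts s1 s2 ->
    frame (10 :: 17 :: 18 :: rs) ts s2 s3 -> frame (10 :: 17 :: 18 :: rs) ts s1 s3.
  by move=> h1 h2; apply: (frame_comp h1 h2); rewrite all_cat; apply/andP; split;
    apply/allP.
rewrite /each_edge /incr; do 2 wstep.
apply: wp_weaken.
  apply: (wp_while (n := size E) (f := fun j => f j + 30)
    (I := fun j s1 => [/\ frame (10 :: 17 :: 18 :: rs) ts s s1, I j s1
                       & reg s1 10 = j])).
  - move=> j s1 jE [fr _ r10] /=.
    by rewrite r10 fr.1 ?inE ?negb_or ?rs12 // r12 jE M1.
  - move=> j s1 jE [fr Ij r10].
    have r1 : reg s1 1 = reg s 1 by rewrite fr.1 ?inE ?negb_or.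
    have a0 : arr s1 0 = arr s 0 by rewrite fr.2.
    have [c1 c2] := cE _ jE.
    have ix c : c < 5 -> ((reg s 1 + c %% M) %% M + (2 %% M * j) %% M) %% M =
        reg s 1 + c + 2 * j.
      move=> c5; rewrite -[RHS](@lit_small _); [by mod_tac|mlia].
    do 5 wstep; set s2 := State _ _.
    have f2 : frame [:: 10; 17; 18] [::] s1 s2 by rewrite /s2; frame_tac.
    have r17 : reg s2 17 = (nth (0, 0) E j).1.
      by rewrite /s2 /upd /= r1 r10 a0 ix.
    have r18 : reg s2 18 = (nth (0, 0) E j).2.
      by rewrite /s2 /upd /= r1 r10 a0 ix.
    apply: wp_weaken (body_spec _ s2 jE (Iext _ _ _ f2 Ij) _ r17 r18) _.
      exact: frC fr (fr10 _ _ f2).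
    move=> k3 s3 [k3le I3 fr3]; wstep; split; first by simpl; mlia.
    have f4 : frame [:: 10; 17; 18] [::] s3
        (State (upd (reg s3) 10 ((reg s3 10 + 1 %% M) %% M)) (arr s3)).
      by frame_tac.
    split.
    + exact: (frC _ _ _ (frC _ _ _ (frC _ _ _ fr (fr10 _ _ f2)) (fr_rs _ _ fr3)) (fr10 _ _ f4)).
    + exact: Iext f4 I3.
    + by rewrite /upd /= fr3.1 // /s2 /upd /= M1 lit_small ?addn1 //; mlia.
  - move=> s1 [fr _ r10] /=.
    by rewrite r10 fr.1 ?inE ?negb_or ?rs12 // r12 ltnn mod0n.
  - split; last by rewrite /upd /= mod0n.
      by apply: fr10; frame_tac.
    by apply: Iext I0; frame_tac.
move=> k1 s1 [k1le [fr1 I1 _]]; apply: H => //.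
move: k1le; rewrite !big_split !sum_nat_const_nat /=; mlia.
Qed.

End Tables.

(* Agreement on the registers and arrays that are not used by the relocated
   multiplication program. *)
Definition low_frame (rs ts : seq nat) (s s' : state) : Prop :=
  (forall x, x < 32 -> x \notin rs -> reg s' x = reg s x) /\
  (forall t, t < 20 -> t \notin ts -> arr s' t = arr s t).

Lemma frame_low rs ts s s' : frame rs ts s s' -> low_frame rs ts s s'.
Proof. by move=> [hr ha]; split=> x _ hx; [exact: hr|exact: ha]. Qed.

Lemma low_frame_comp rs ts rs1 ts1 rs2 ts2 s1 s2 s3 :
  low_frame rs1 ts1 s1 s2 -> low_frame rs2 ts2 s2 s3 ->
  all (mem rs) (rs1 ++ rs2) -> all (mem ts) (ts1 ++ ts2) ->
  low_frame rs ts s1 s3.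
Proof.
move=> [r1 a1] [r2 a2]; rewrite !all_cat.
move=> /andP[/allP sr1 /allP sr2] /andP[/allP st1 /allP st2]; split=> x lx hx.
  by rewrite r2 ?r1 //; apply: contra hx => h; [exact: sr1|exact: sr2].
by rewrite a2 ?a1 //; apply: contra hx => h; [exact: st1|exact: st2].
Qed.

Lemma stack_at_low w rs ts s s' st :
  low_frame rs ts s s' -> 2 \notin rs -> 1 \notin ts -> 2 \notin ts ->
  3 \notin ts -> stack_at w s st -> stack_at w s' st.
Proof. by move=> [hr ha] ? ? ? ? [? ? ? ?]; split; rewrite ?hr ?ha. Qed.

Lemma edges_at_low w rs ts s s' E :
  low_frame rs ts s s' -> 12 \notin rs -> 1 \notin rs -> 0 \notin ts ->
  edges_at w s E -> edges_at w s' E.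
Proof. by move=> [hr ha] ? ? ? [? ? ?]; split; rewrite ?hr ?ha. Qed.

(** * Counting the triangles of a substitution *)

Section Subst.

Variable w : nat.
Local Notation M := (2 ^ w).

Variables (st0 ps : seq part) (E : seq (nat * nat)).
Hypothesis wfE : wf_edges (size ps) E.
Hypothesis sizeM : size st0 + size ps + 2 * size E + 10 < M.

Local Notation ord i := (order (nth part0 ps i)).

Lemma edge_lt j : j < size E ->
  (nth (0, 0) E j).1 < (nth (0, 0) E j).2 < size ps.
Proof.
by move=> jE; case/andP: wfE => _ /allP; apply; rewrite mem_nth.
Qed.

Lemma nth_args i : nth part0 (st0 ++ ps) (size st0 + i) = nth part0 ps i.
Proof. by rewrite nth_cat ltnNge leq_addr /= addKn. Qed.

Lemma order_args s i : stack_at w s (st0 ++ ps) -> i < size ps ->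
  arr s 2 ((size st0 + i) %% M) = ord i.
Proof.
move=> S ips; rewrite lit_small; last by mlia.
by rewrite (sa_order S) ?nth_args // size_cat; mlia.
Qed.

Definition pair_edges : cmd :=
  each_edge (Seq (Set_ 13 (Bin Add (Reg 9) (Reg 17)))
            (Seq (Set_ 14 (Bin Add (Reg 9) (Reg 18))) pair_up)).

Lemma pair_edges_spec s bl T (Q : nat -> state -> Prop) :
  size bl + size E + 3 < M ->
  edges_at w s E -> stack_at w s (st0 ++ ps) -> blocks_at s bl ->
  reg s 4 = T %% M -> reg s 9 = size st0 -> reg s 11 = 0 ->
  (forall k s', k <= 110 * size E + 10 ->
     frame [:: 4; 5; 10; 11; 13; 14; 17; 18] [:: 4; 5; 6; 7] s s' ->
     blocks_at s' (bl ++
       [seq part_block (nth part0 ps p.1) (nth part0 ps p.2) | p <- E]) ->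
     reg s' 4 = (T + \sum_(p <- E)
       part_tri (nth part0 ps p.1) (nth part0 ps p.2)) %% M ->
     reg s' 11 = (\sum_(p <- E) 2 * (ord p.1 * ord p.2)) %% M ->
     Q k s') ->
  wp w pair_edges s Q.
Proof.
move=> blM Es S B rT r9 r11 H.
pose I j s1 :=
  [/\ frame [:: 4; 5; 10; 11; 13; 14; 17; 18] [:: 4; 5; 6; 7] s s1,
      blocks_at s1 (bl ++
       [seq part_block (nth part0 ps p.1) (nth part0 ps p.2) | p <- take j E]),
      reg s1 4 = (T + \sum_(p <- take j E)
       part_tri (nth part0 ps p.1) (nth part0 ps p.2)) %% M &
     reg s1 11 = (\sum_(p <- take j E) 2 * (ord p.1 * ord p.2)) %% M].
apply: (each_edge_spec (I := I) (f := fun=> 60) (rs := [:: 4; 5; 11; 13; 14])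
  (ts := [:: 4; 5; 6; 7]) Es) => //.
- move=> j s1 s2 fr [fr1 B1 rT1 D1]; split.
  + by apply: (frame_comp fr1 fr).
  + exact: blocks_at_frame fr _ _ _ _ _ B1.
  + by rewrite fr.1.
  + by rewrite fr.1.
- move=> j s1 jE [fr1 B1 rT1 D1] _ r17 r18.
  have /andP[lt1 lt2] := edge_lt jE.
  have tk : take j.+1 E = rcons (take j E) (nth (0, 0) E j) by apply: take_nth.
  do 4 wstep; set s2 := State _ _.
  have fr2 : frame [:: 13; 14] [::] s1 s2 by rewrite /s2; frame_tac.
  apply: (@pair_up_spec _ s2 (st0 ++ ps) (bl ++
      [seq part_block (nth part0 ps p.1) (nth part0 ps p.2) | p <- take j E])
      (T + \sum_(p <- take j E)
         part_tri (nth part0 ps p.1) (nth part0 ps p.2))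
      (\sum_(p <- take j E) 2 * (ord p.1 * ord p.2))
      (size st0 + (nth (0, 0) E j).1) (size st0 + (nth (0, 0) E j).2)).
  + by rewrite size_cat size_map size_take jE; mlia.
  + apply: (stack_at_frame fr2) => //.
    exact: (stack_at_frame fr1).
  + exact: blocks_at_frame fr2 _ _ _ _ _ B1.
  + by rewrite /s2 /upd /= (fr1.1 9 isT) r9 r17 lit_small //; mlia.
  + by rewrite /s2 /upd /= (fr1.1 9 isT) r9 r18 lit_small //; mlia.
  + by rewrite size_cat; mlia.
  + by rewrite size_cat; mlia.
  + by rewrite fr2.1.
  + by rewrite fr2.1.
  move=> k3 s3 k3le fr3; rewrite !nth_args => B3 T3 D3.
  have fr13 : frame [:: 4; 5; 11; 13; 14] [:: 4; 5; 6; 7] s1 s3.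
    by apply: (frame_comp fr2 fr3).
  split => //; first by simpl; mlia.
  split.
  + by apply: (frame_comp fr1 fr13).
  + by rewrite tk map_rcons -cats1 catA cats1.
  + by rewrite tk -cats1 big_cat big_seq1 addnA.
  + by rewrite tk -cats1 big_cat big_seq1.
- by split; rewrite ?take0 ?cats0 ?big_nil ?addn0 ?mod0n //.
move=> k s' kle [fr B1 T1 D1] _; rewrite !take_size in B1 T1 D1.
by apply: H => //; move: kle; rewrite sum_nat_const_nat; mlia.
Qed.

(* Each triangle [u < v < x] of the quotient is found at its edge [u v], since
   [x] follows both [u] and [v]. *)
Definition tri_lists : cmd :=
  Seq (Set_ 19 (Lit 0))
 (Seq (Set_ 17 (Lit 0))
 (Seq (While (Bin Lt (Reg 17) (Reg 8))
        (Seq (Set_ 15 (Get 2 (Bin Add (Reg 9) (Reg 17))))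
        (Seq (init_vertex true) (incr 17 1))))
 (Seq (each_edge (add_arc true))
      (each_edge
        (Seq (query true)
             (Set_ 4 (Bin Add (Reg 4) (Bin Mul (Lit 6)
                (Bin Mul (Reg 15)
                  (Bin Mul (Get 2 (Bin Add (Reg 9) (Reg 17)))
                           (Get 2 (Bin Add (Reg 9) (Reg 18))))))))))))).

(** A triangle of the quotient is met once, at the edge between its two smallest vertices, and
    stands for six ordered triples of arguments. *)
Definition tri_out (n : nat -> nat) : nat :=
  \sum_(p <- E) 6 * ((\sum_(x <- out E p.2 | x \in out E p.1) n x) *
                     (n p.1 * n p.2)).

Lemma tri_lists_spec l s T (Q : nat -> state -> Prop) :
  (forall u, size (out E u) <= l) ->
  edges_at w s E -> stack_at w s (st0 ++ ps) ->
  reg s 4 = T %% M -> reg s 9 = size st0 -> reg s 8 = size ps ->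
  (forall k s', k <= 50 * size ps + (200 + 40 * l) * size E + 50 ->
     frame [:: 4; 10; 15; 16; 17; 18; 19] [:: 15; 16; 17; 18; 19] s s' ->
     reg s' 4 = (T + tri_out (fun i => ord i)) %% M -> Q k s') ->
  wp w tri_lists s Q.
Proof.
move=> outl Es S rT r9 r8 H.
have M1 : 1 %% M = 1 by rewrite lit_small //; mlia.
pose W x := ord x.
rewrite /tri_lists /incr; do 5 wstep.
apply: wp_weaken.
  apply: (wp_while (n := size ps) (f := fun=> 30)
    (I := fun j s1 =>
      [/\ frame [:: 15; 17; 19] [:: 15; 18; 19] s s1,
          graph_at true s1 j [::] W & reg s1 17 = j])).
  - move=> j s1 jps [fr _ r17] /=.
    by rewrite r17 (fr.1 8 isT) r8 jps M1.
  - move=> j s1 jps [fr G r17].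
    do 3 wstep; set s2 := State _ _.
    have fr2 : frame [:: 15] [::] s1 s2 by rewrite /s2; frame_tac.
    apply: (@init_vertex_spec _ true s2 j [::] W W) => //.
    + by mlia.
    + exact: graph_at_frame fr2 _ _ _ _ _ _ G.
    + rewrite /s2 /upd /= r17 (fr.1 9 isT) r9 order_args //.
      exact: (stack_at_frame fr).
    + move=> s3 fr3 G3.
      have fr13 : frame [:: 15; 17; 19] [:: 15; 18; 19] s s3.
        have fr12 := frame_comp (rs := [:: 15; 17; 19]) (ts := [:: 15; 18; 19])
            fr fr2 isT isT.
          by apply: (frame_comp fr12 fr3).
      wstep; split => //; split.
      * by frame_tac.
      * apply: (@graph_at_frame [:: 17] [::] s3) G3 => //.
        by frame_tac.
      * by rewrite /upd /= fr3.1 // fr2.1 // r17 M1 lit_small ?addn1 //; mlia.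
  - move=> s1 [fr _ r17] /=.
    by rewrite r17 (fr.1 8 isT) r8 ltnn mod0n.
  - split; first by frame_tac.
      by split => //; rewrite /upd /= mod0n.
    by rewrite /upd /= mod0n.
move=> k1 s1 [k1le [fr1 G1 _]].
have Es1 : edges_at w s1 E by exact: edges_at_frame fr1 _ _ _ Es.
wstep.
apply: (each_edge_spec (I := fun j s2 => graph_at true s2 (size ps) (take j E) W)
  (f := fun=> 14) (rs := [:: 19]) (ts := [:: 15; 16; 17]) Es1) => //.
- by move=> j s2 s3 fr G; exact: graph_at_frame fr _ _ _ _ _ _ G.
- move=> j s2 jE G2 _ r17 r18; have /andP[lt1 lt2] := edge_lt jE.
  apply: (add_arc_spec (L := take j E) (n := size ps) _ G2 r17 r18 lt2) => //.
    by rewrite size_take jE; mlia.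
  move=> s3 fr3 G3; split => //.
  by rewrite (take_nth (0, 0) jE); case: nth G3.
- by rewrite take0.
move=> k2 s2 k2le G2 fr2; rewrite take_size in G2.
have fr02 := frame_comp (rs := [:: 10; 15; 17; 18; 19])
  (ts := [:: 15; 16; 17; 18; 19]) fr1 fr2 isT isT.
have Es2 : edges_at w s2 E by exact: edges_at_frame fr02 _ _ _ Es.
pose term (p : nat * nat) :=
  6 * ((\sum_(x <- out E p.2 | x \in out E p.1) W x) * (W p.1 * W p.2)).
pose I j s3 :=
  [/\ frame [:: 4; 10; 15; 16; 17; 18] [:: 18] s2 s3,
      graph_at true s3 (size ps) E W
    & reg s3 4 = (T + \sum_(p <- take j E) term p) %% M].
apply: (each_edge_spec (I := I) (f := fun=> 50 + 40 * l) (rs := [:: 4; 15; 16])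
  (ts := [:: 18]) Es2) => //.
- move=> j s3 s4 fr [fr3 G3 T3]; split.
  + by apply: (frame_comp fr3 fr).
  + exact: graph_at_frame fr _ _ _ _ _ _ G3.
  + by rewrite fr.1.
- move=> j s3 jE [fr3 G3 T3] _ r17 r18.
  have /andP[lt1 lt2] := edge_lt jE.
  wstep; apply: (query_spec _ _ G3 r17 r18) => //; try mlia.
  move=> k4 s4 k4le fr4 G4 r15.
  have S4 : stack_at w s4 (st0 ++ ps).
    apply: (stack_at_frame fr4) => //; apply: (stack_at_frame fr3) => //.
    exact: (stack_at_frame fr02).
  wstep; split.
  + have := outl (nth (0, 0) E j).1; have := outl (nth (0, 0) E j).2.
    by move: k4le; simpl; mlia.
  + split.
    * have fr34 := frame_comp (rs := [:: 4; 10; 15; 16; 17; 18])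
        (ts := [:: 18]) fr3 fr4 isT isT.
      by frame_tac.
    * apply: (@graph_at_frame [:: 4] [::] s4) G4 => //.
      by frame_tac.
    * rewrite (take_nth (0, 0) jE) -cats1 big_cat big_seq1 addnA.
      rewrite {1}/upd /= !(fr4.1 4, fr4.1 9, fr4.1 17, fr4.1 18) //.
      rewrite (fr3.1 9) // (fr02.1 9) // r9 r17 r18 !order_args //; last first.
        exact: ltn_trans lt1 lt2.
      by rewrite r15 T3; mod_tac.
  + have fr4' := frame_sub (rs := [:: 4; 15; 16]) (ts := [:: 18]) fr4 isT isT.
    by frame_tac.
- split => //; first by rewrite (fr02.1 4 isT) take0 big_nil addn0.
move=> k3 s3 k3le [fr3 G3 T3] _; apply: H.
- move: k1le k2le k3le; rewrite !sum_nat_const_nat /=; mlia.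
- by apply: (frame_comp fr02 fr3).
- by rewrite T3 take_size.
Qed.

End Subst.

(** * Matrix multiplication as a subroutine *)

Definition multiplies (p : cmd) (c : nat) (mmcost : nat -> nat) : Prop :=
  forall (t b : nat) (A B : 'M[nat]_t) (w : nat) (s : state),
    0 < t -> (forall i j, A i j < b) -> (forall i j, B i j < b) ->
    (t + b) ^ c <= 2 ^ w -> word_state w s -> reg s 0 = t ->
    holds_mx (arr s 0) A -> holds_mx (arr s 1) B ->
    exists k s', [/\ exec w p s k s', k <= mmcost t
                   & holds_mx (arr s' 2) (A *m B)%R].

(** The multiplication program may only be started in a state of [w]-bit words. Every command
    preserves this, so it is recovered from the run instead of being carried by each
    specification. *)
Lemma wp_word w c s Q :
  word_state w s -> wp w c s Q ->
  wp w c s (fun k s' => Q k s' /\ word_state w s').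
Proof.
move=> ws [k [s' [e q]]]; exists k, s'; split => //; split => //.
exact: exec_word e ws.
Qed.

Lemma mx_index_inj t a b c d : b < t -> d < t ->
  (a * t + b == c * t + d) = (a == c) && (b == d).
Proof.
move=> bt dt; apply/eqP/andP => [e|[/eqP-> /eqP->]] //.
have t0 : 0 < t by case: (t) bt.
have ac : a = c.
  by have := congr1 (fun x => x %/ t) e; rewrite !divnMDl // !divn_small // !addn0.
by rewrite ac eqxx; move/eqP: e; rewrite ac eqn_add2l.
Qed.

Lemma mx_index_lt t a b : a < t -> b < t -> a * t + b < t * t.
Proof.
move=> at_ bt; apply: (@leq_trans (a.+1 * t)); last by rewrite leq_mul2r at_ orbT.
by rewrite mulSn addnC ltn_add2r.
Qed.

Definition mx_at (t : nat) (f : nat -> nat) (F : nat -> nat -> nat) : Prop :=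
  forall a b, a < t -> b < t -> f (a * t + b) = F a b.

Lemma mx_at_upd t f F u v x : u < t -> v < t -> mx_at t f F ->
  mx_at t (upd f (u * t + v) x)
    (fun a b => if (a == u) && (b == v) then x else F a b).
Proof.
move=> ut vt h a b at_ bt; rewrite /upd mx_index_inj //.
by case: ifP => // _; exact: h.
Qed.

Lemma list_adj_rcons E u v a b :
  list_adj (rcons E (u, v)) a b =
  [|| (a == u) && (b == v), (a == v) && (b == u) | list_adj E a b].
Proof.
rewrite /list_adj !mem_rcons !inE !xpair_eqE.
by case: (a == u); case: (b == v); case: (a == v); case: (b == u);
  case: ((a, b) \in E); case: ((b, a) \in E).
Qed.

(** The inner sum is an entry of a matrix product. Summing over all edges meets each triangle of the
    quotient three times, once per side, and the factor 2 completes its six orderings. *)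
Definition tri_mx (E : seq (nat * nat)) (t : nat) (n : nat -> nat) : nat :=
  \sum_(p <- E)
    2 * ((\sum_(k < t) list_adj E p.1 k * n k * list_adj E k p.2) *
         (n p.1 * n p.2)).

Definition mx_index (i j : nat) : aexp :=
  Bin Add (Bin Mul (Reg i) (Reg 8)) (Reg j).

(** The multiplication program is moved behind registers 0 to 31 and arrays 0 to 19: its dimension
    is in register 32, its factors are the arrays 20 and 21, and the product appears in array 22. *)
Definition tri_mm (p : cmd) : cmd :=
  Seq (Set_ 16 (Bin Mul (Reg 8) (Reg 8)))
 (Seq (Set_ 10 (Lit 0))
 (Seq (While (Bin Lt (Reg 10) (Reg 16))
        (Seq (Put 20 (Reg 10) (Lit 0))
        (Seq (Put 21 (Reg 10) (Lit 0)) (incr 10 1))))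
 (Seq (each_edge
        (Seq (Put 21 (mx_index 17 18) (Lit 1))
        (Seq (Put 21 (mx_index 18 17) (Lit 1))
        (Seq (Put 20 (mx_index 17 18) (Get 2 (Bin Add (Reg 9) (Reg 18))))
             (Put 20 (mx_index 18 17) (Get 2 (Bin Add (Reg 9) (Reg 17))))))))
 (Seq (Set_ 32 (Reg 8))
 (Seq (shift_cmd 32 20 p)
      (each_edge
        (Set_ 4 (Bin Add (Reg 4) (Bin Mul (Lit 2)
          (Bin Mul (Get 22 (mx_index 17 18))
            (Bin Mul (Get 2 (Bin Add (Reg 9) (Reg 17)))
                     (Get 2 (Bin Add (Reg 9) (Reg 18)))))))))))))).

Section Multiply.

Variables (p : cmd) (cm : nat) (mmcost : nat -> nat).
Hypothesis mm : multiplies p cm mmcost.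

Variable w : nat.
Local Notation M := (2 ^ w).

Variables (st0 ps : seq part) (E : seq (nat * nat)) (b : nat).
Hypothesis wfE : wf_edges (size ps) E.
Hypothesis sizeM : size st0 + size ps + 2 * size E + 10 < M.
Hypothesis sqM : size ps * size ps + 1 < M.
Hypothesis ps0 : 0 < size ps.
Hypothesis b1 : 1 < b.
Hypothesis orderb : forall i, i < size ps -> order (nth part0 ps i) < b.
Hypothesis bM : (size ps + b) ^ cm <= M.

Local Notation ord i := (order (nth part0 ps i)).
Local Notation t := (size ps).

Lemma eval_mx_index s i j u v :
  reg s i = u -> reg s j = v -> reg s 8 = t -> u < t -> v < t ->
  eval w s (mx_index i j) = u * t + v.
Proof.
move=> ri rj r8 ut vt; rewrite /= ri rj r8 modnDml lit_small //.
have := mx_index_lt ut vt; mlia.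
Qed.

Lemma tri_mm_spec s T (Q : nat -> state -> Prop) :
  word_state w s ->
  edges_at w s E -> stack_at w s (st0 ++ ps) ->
  reg s 4 = T %% M -> reg s 9 = size st0 -> reg s 8 = t ->
  (forall k s', k <= 30 * (t * t) + 200 * size E + 100 + mmcost t ->
     low_frame [:: 4; 10; 16; 17; 18] [::] s s' ->
     reg s' 4 = (T + tri_mx E t (fun i => ord i)) %% M -> Q k s') ->
  wp w (tri_mm p) s Q.
Proof.
move=> ws Es S rT r9 r8 H.
have elt := edge_lt wfE.
have M1 : 1 %% M = 1 by rewrite lit_small //; mlia.
rewrite /tri_mm /incr; do 5 wstep.
set s0 := State _ _.
have r16 : reg s0 16 = t * t.
  by rewrite /s0 /upd /= r8 lit_small //; mlia.
have f0 : frame [:: 10; 16] [::] s s0 by rewrite /s0; frame_tac.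
have r10 : reg s0 10 = 0 by rewrite /s0 /upd /= mod0n.
have ws0 : word_state w s0.
  have e1 := ExSeq (ExSet w 16 (Bin Mul (Reg 8) (Reg 8)) s)
               (ExSet w 10 (Lit 0) _).
  exact: exec_word e1 ws.
move: s0 r16 f0 r10 ws0 => s0 r16 f0 r10 ws0.
apply: wp_weaken.
  apply: (wp_word ws0).
  apply: (wp_while (n := t * t) (f := fun=> 15)
    (I := fun j s1 =>
      [/\ frame [:: 10] [:: 20; 21] s0 s1, reg s1 10 = j
        & forall i, i < j -> arr s1 20 i = 0 /\ arr s1 21 i = 0])).
  - by move=> j s1 jt [fr rj _] /=; rewrite rj (fr.1 16 isT) r16 jt M1.
  - move=> j s1 jt [fr rj z]; do 5 wstep; split => //; split.
    + by frame_tac.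
    + by rewrite /upd /= rj M1 lit_small ?addn1 //; mlia.
    + move=> i ij; rewrite /upd /= rj mod0n; case: eqP => // ni; apply: z; lia.
  - by move=> s1 [fr rj _] /=; rewrite rj (fr.1 16 isT) r16 ltnn mod0n.
  - by split.
move=> k1 s1 [[k1le [fr1 _ z1]] ws1].
have fr01 := frame_comp (rs := [:: 10; 16]) (ts := [:: 20; 21]) f0 fr1 isT isT.
have Es1 : edges_at w s1 E by exact: edges_at_frame fr01 _ _ _ Es.
pose X F a c := list_adj F a c * ord c.
pose Y F a c : nat := list_adj F a c.
wstep.
pose I2 j s2 := [/\ mx_at t (arr s2 20) (X (take j E)),
  mx_at t (arr s2 21) (Y (take j E)) & frame [:: 10; 17; 18] [:: 20; 21] s1 s2].
suff P2 : wp w (each_edge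
        (Seq (Put 21 (mx_index 17 18) (Lit 1))
        (Seq (Put 21 (mx_index 18 17) (Lit 1))
        (Seq (Put 20 (mx_index 17 18) (Get 2 (Bin Add (Reg 9) (Reg 18))))
             (Put 20 (mx_index 18 17) (Get 2 (Bin Add (Reg 9) (Reg 17))))))))
     s1 (fun k s2 => k <= 90 * size E + 10 /\ I2 (size E) s2).
  apply: (wp_weaken (wp_word ws1 P2)) => k2 s2 [[k2le [X2 Y2 fr2]] ws2].
  rewrite take_size in X2 Y2.
  have fr02 := frame_comp (rs := [:: 10; 16; 17; 18]) (ts := [:: 20; 21])
    fr01 fr2 isT isT.
  have r8' : reg s2 8 = t by rewrite fr02.1.
  do 3 wstep; set s3 := State _ _.
  have ws3 : word_state w s3 by exact: exec_word (ExSet w 32 (Reg 8) s2) ws2.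
  (* One factor carries the orders as column weights, the other is the plain adjacency matrix, so
     entry (i, j) of the product adds up the orders of the common neighbours of i and j. *)
  pose A : 'M[nat]_t := (\matrix_(i, j) X E i j)%R.
  pose B : 'M[nat]_t := (\matrix_(i, j) Y E i j)%R.
  have [k4 [s4 [e4 k4le h4]]] : exists k s', [/\ exec w p (high 32 20 s3) k s',
      k <= mmcost t & holds_mx (arr s' 2) (A *m B)%R].
    apply: (mm (b := b)) => //.
    - move=> i j; rewrite mxE /X; case: list_adj; rewrite ?mul0n ?mul1n ?orderb //.
      by mlia.
    - by move=> i j; rewrite mxE /Y; case: list_adj; mlia.
    - by split=> x *; [exact: ws3.1|exact: ws3.2].
    - by move=> i j; rewrite mxE; exact: X2.
    - by move=> i j; rewrite mxE; exact: Y2.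
  have [s5 [e5 ag5 low5]] := shift_exec e4 (s := s3)
    (conj (fun=> erefl) (fun=> fun=> erefl)).
  have P5 i j : i < t -> j < t -> arr s5 22 (i * t + j) =
      \sum_(k < t) X E i k * Y E k j.
    move=> it jt; have := h4 (Ordinal it) (Ordinal jt); rewrite mxE /= => h.
    have := ag5.2 2 (i * t + j); rewrite /= h => ->.
    by apply: eq_bigr => k _; rewrite !mxE.
  exists k4, s5; split => //.
  (* From here on full frames are lost: of the relocated registers and arrays, only the product in
     array 22 is known. *)
  have lf35 : low_frame [::] [::] s3 s5.
    by split=> x xlt _; [exact: low5.1|exact: low5.2].
  have f3 : frame [:: 32] [::] s2 s3 by rewrite /s3; frame_tac.
  have lf05 : low_frame [:: 10; 16; 17; 18] [::] s s5.
    split=> x xlt hx.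
      rewrite lf35.1 // f3.1 ?fr02.1 //.
      by rewrite inE neq_ltn xlt.
    rewrite lf35.2 // f3.2 // fr02.2 //.
    by rewrite !inE negb_or !neq_ltn xlt (ltn_trans xlt).
  have Es5 : edges_at w s5 E by exact: edges_at_low lf05 _ _ _ Es.
  pose term (q : nat * nat) := 2 *
    ((\sum_(k < t) list_adj E q.1 k * ord k * list_adj E k q.2) *
     (ord q.1 * ord q.2)).
  pose I6 j s6 := frame [:: 4; 10; 17; 18] [::] s5 s6 /\
    reg s6 4 = (T + \sum_(q <- take j E) term q) %% M.
  apply: (each_edge_spec (I := I6) (f := fun=> 60) (rs := [:: 4]) (ts := [::])
    Es5) => //.
  - move=> j s6 s7 fr [fr6 T6]; split; last by rewrite fr.1.
    by apply: (frame_comp fr6 fr).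
  - move=> j s6 jE [fr6 T6] _ r17 r18; have /andP[lt1 lt2] := elt _ jE.
    have lt1' := ltn_trans lt1 lt2.
    have S6 : stack_at w s6 (st0 ++ ps).
      apply: (stack_at_frame fr6) => //; exact: (stack_at_low lf05).
    have r86 : reg s6 8 = t by rewrite fr6.1 // lf05.1.
    have /= ev := eval_mx_index r17 r18 r86 lt1' lt2.
    wstep; rewrite ev; split => //; first split.
    + by frame_tac.
    + rewrite /upd /= r17 r18 T6 (fr6.1 9 isT) lf05.1 // r9.
      rewrite !(order_args wfE sizeM S6) // (fr6.2 22 isT) P5 //.
      rewrite (take_nth (0, 0) jE) -cats1 big_cat big_seq1 addnA.
      by rewrite /term /X /Y; mod_tac.
    + by frame_tac.
  - split; first exact: frame_refl.
    by rewrite take0 big_nil addn0 lf05.1.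
  move=> k6 s6 k6le [fr6 T6] _; apply: H.
  - move: k1le k2le k4le k6le; rewrite !sum_nat_const_nat /=; mlia.
  - by apply: (low_frame_comp lf05 (frame_low fr6)).
  - by rewrite T6 take_size.
apply: (each_edge_spec (I := I2) (f := fun=> 50) (rs := [::]) (ts := [:: 20; 21])
  Es1) => //.
- move=> j s2 s3 fr [X2 Y2 fr2]; split.
  + by move=> a c at_ ct; rewrite fr.2 // X2.
  + by move=> a c at_ ct; rewrite fr.2 // Y2.
  + by apply: (frame_comp fr2 fr).
- move=> j s2 jE [X2 Y2 fr2] _ r17 r18; have /andP[lt1 lt2] := elt _ jE.
  have lt1' := ltn_trans lt1 lt2.
  have fr02 := frame_comp (rs := [:: 10; 16; 17; 18]) (ts := [:: 20; 21])
    fr01 fr2 isT isT.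
  have S2 : stack_at w s2 (st0 ++ ps) by apply: (stack_at_frame fr02).
  have r8' : reg s2 8 = t by rewrite fr02.1.
  have /= ev12 := eval_mx_index r17 r18 r8' lt1' lt2.
  have /= ev21 := eval_mx_index r18 r17 r8' lt2 lt1'.
  do 7 wstep; rewrite !ev12 !ev21.
  set u := (nth _ _ _).1 in lt1 lt1' *; set v := (nth _ _ _).2 in lt1 lt2 *.
  have tk : take j.+1 E = rcons (take j E) (u, v).
    by rewrite (take_nth (0, 0) jE); congr rcons; rewrite /u /v; case: nth.
  set s3 := State _ _.
  have a20 : arr s3 20 =
      upd (upd (arr s2 20) (u * t + v) (ord v)) (v * t + u) (ord u).
    by rewrite /s3 /upd /= (fr02.1 9 isT) r9 r17 r18 !(order_args wfE sizeM S2).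
  have a21 : arr s3 21 = upd (upd (arr s2 21) (u * t + v) 1) (v * t + u) 1.
    by rewrite /s3 /upd /= M1.
  split => //; first split.
  + rewrite tk a20.
    move=> a c at_ ct; rewrite (mx_at_upd _ _ _ (mx_at_upd _ _ _ X2)) //.
    rewrite /X list_adj_rcons.
    case e1: ((a == v) && (c == u)); last case e2: ((a == u) && (c == v)) => //=.
      by rewrite orbT mul1n; case/andP: e1 => _ /eqP->.
    by rewrite mul1n; case/andP: e2 => _ /eqP->.
  + rewrite tk a21.
    move=> a c at_ ct; rewrite (mx_at_upd _ _ _ (mx_at_upd _ _ _ Y2)) //.
    by rewrite /Y list_adj_rcons; case: (_ && _); case: (_ && _).
  + by rewrite /s3; frame_tac.
  + by rewrite /s3; frame_tac.
- split; last exact: frame_refl.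
    by move=> a c at_ ct; rewrite (z1 _ (mx_index_lt at_ ct)).1 take0.
  by move=> a c at_ ct; rewrite (z1 _ (mx_index_lt at_ ct)).2 take0.
move=> k2 s2 k2le I2' _; split => //.
by move: k2le; rewrite sum_nat_const_nat; mlia.
Qed.

End Multiply.

(** * Processing one operation of the expression *)

(* Register 0 and array 0 hold the input; register 1 is the reading position,
   2 the height of the stack in the arrays 1 to 3, 3 the number of vertices so
   far, 4 the running count, 5 the number of blocks in the arrays 4 to 7, and 6
   the number of arcs to vertices added by [Inc].  In [do_args], 7 is the tag, 8
   the number of arguments, 9 the stack position of the first of them, and 11
   the degree sum contributed by the edges between them. *)

Definition do_empty : cmd :=
  Seq (Put 1 (Reg 2) (Reg 3))
 (Seq (Put 2 (Reg 2) (Lit 0))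
 (Seq (Put 3 (Reg 2) (Lit 0))
 (Seq (incr 2 1) (incr 1 1)))).

Definition new_vertex : cmd :=
  Seq (Set_ 17 (Reg 3))
 (Seq (Set_ 15 (Lit 1))
 (Seq (init_vertex false) (incr 3 1))).

Definition do_vertex : cmd :=
  Seq (Put 1 (Reg 2) (Reg 3))
 (Seq (Put 2 (Reg 2) (Lit 1))
 (Seq (Put 3 (Reg 2) (Lit 0))
 (Seq (incr 2 1)
 (Seq (incr 1 1) new_vertex)))).

(** Neighbours are numbered relative to the argument, so its first vertex is added to them. Each
    edge becomes a block with a single pair and an arc to the new vertex. *)
Definition do_inc : cmd :=
  Seq (Set_ 18 (Reg 3))
 (Seq new_vertex
 (Seq (Set_ 12 (Get 0 (Bin Add (Reg 1) (Lit 1))))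
 (Seq (Set_ 9 (Bin Defs.Sub (Reg 2) (Lit 1)))
 (Seq (Set_ 10 (Lit 0))
 (Seq (While (Bin Lt (Reg 10) (Reg 12))
        (Seq (Set_ 17 (Bin Add (Get 1 (Reg 9))
                 (Get 0 (Bin Add (Bin Add (Reg 1) (Lit 2)) (Reg 10)))))
        (Seq (add_arc false)
        (Seq (Put 4 (Reg 5) (Reg 17))
        (Seq (Put 5 (Reg 5) (Lit 1))
        (Seq (Put 6 (Reg 5) (Reg 18))
        (Seq (Put 7 (Reg 5) (Lit 1))
        (Seq (incr 5 1) (incr 10 1)))))))))
 (Seq (Put 2 (Reg 9) (Bin Add (Get 2 (Reg 9)) (Lit 1)))
 (Seq (Put 3 (Reg 9) (Bin Add (Get 3 (Reg 9)) (Bin Mul (Lit 2) (Reg 12))))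
      (Set_ 1 (Bin Add (Bin Add (Reg 1) (Lit 2)) (Reg 12)))))))))).

Definition after_edges : aexp :=
  Bin Add (Bin Add (Reg 1) (Lit 3)) (Bin Mul (Lit 2) (Reg 12)).

(** The tree-depth expression itself is never parsed: its length is read only to skip it. What it
    provides is the order of the vertices of H, which keeps the lists of later neighbours short. *)
Definition do_subst (p : cmd) : cmd :=
  Seq (Set_ 12 (Get 0 (Bin Add (Reg 1) (Lit 2))))
 (Seq pair_edges
 (Seq (If (Bin Eq (Reg 7) (Lit 5))
        (Seq (tri_mm p) (Set_ 1 after_edges))
        (Seq tri_lists
             (Set_ 1 (Bin Add (Bin Add after_edges (Lit 1))
                        (Get 0 after_edges)))))
 (Seq (Put 3 (Reg 9) (Bin Add (Get 3 (Reg 9)) (Reg 11)))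
      (Set_ 11 (Lit 0))))).

Definition do_args (p : cmd) : cmd :=
  Seq (Set_ 8 (Get 0 (Bin Add (Reg 1) (Lit 1))))
 (Seq (Set_ 9 (Bin Defs.Sub (Reg 2) (Reg 8)))
 (Seq (Set_ 11 (Lit 0))
 (Seq (If (Bin Lt (Reg 7) (Lit 5)) (incr 1 2) (do_subst p)) merge))).

Definition do_token (p : cmd) : cmd :=
  Seq (Set_ 7 (Get 0 (Reg 1)))
      (If (Bin Eq (Reg 7) (Lit 0)) do_empty
      (If (Bin Eq (Reg 7) (Lit 1)) do_vertex
      (If (Bin Eq (Reg 7) (Lit 4)) do_inc (do_args p)))).

Definition occurs_at (code : seq nat) (pos : nat) (l : seq nat) : Prop :=
  pos + size l <= size code /\
  forall i, i < size l -> nth 0 code (pos + i) = nth 0 l i.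

Lemma occurs_at_cat code pos l1 l2 :
  occurs_at code pos (l1 ++ l2) ->
  occurs_at code pos l1 /\ occurs_at code (pos + size l1) l2.
Proof.
move=> [sz h]; rewrite size_cat in sz h; split; split; try lia.
  by move=> i il; rewrite h ?nth_cat ?il //; lia.
move=> i il; have := h (size l1 + i); rewrite nth_cat addnA => ->; last lia.
by rewrite ltnNge leq_addr /= addKn.
Qed.

Definition pairs_code (E : seq (nat * nat)) : seq nat :=
  flatten [seq [:: p.1; p.2] | p <- E].

Lemma size_pairs_code E : size (pairs_code E) = 2 * size E.
Proof. by elim: E => //= p E ->; lia. Qed.

Lemma nth_pairs_code E i : i < size E ->
  nth 0 (pairs_code E) (2 * i) = (nth (0, 0) E i).1 /\
  nth 0 (pairs_code E) (2 * i).+1 = (nth (0, 0) E i).2.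
Proof.
elim: E i => // p E IH [|i] // iE; rewrite mulnS; exact: (IH i iE).
Qed.

(** The linear bound covers counters, addresses and literals; the quadratic one covers the
    matrices. *)
Lemma square_large w n : (n + 10) ^ 2 < 2 ^ w ->
  20 * n + 100 <= 2 ^ w /\ n * n + 10 <= 2 ^ w.
Proof. by rewrite -mulnn; set N := 2 ^ w; clearbody N; nia. Qed.

Section Tokens.

Variable w : nat.
Local Notation M := (2 ^ w).

Variable code : seq nat.
Local Notation S := (size code).
Hypothesis codeM : (S + 10) ^ 2 < M.

(** By [rp_bound], stack entries, blocks, vertices and arcs are charged to code words already read,
    so no counter overflows. Stack and blocks are bounded jointly because a join trades each
    argument but one for a block. *)
Record rep (s : state) (pos : nat) (st : seq part) (nv T : nat)
    (bl : seq block) (L : seq (nat * nat)) : Prop := Rep {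
  rp_input : input_at s code;
  rp_pos : reg s 1 = pos;
  rp_stack : stack_at w s st;
  rp_nv : reg s 3 = nv;
  rp_T : reg s 4 = T %% M;
  rp_blocks : blocks_at s bl;
  rp_graph : graph_at false s nv L (fun=> 1);
  rp_arcs u x : (u, x) \in L -> u < x;
  rp_bound : [&& size st + size bl <= pos, nv <= pos & size L <= pos] }.

Lemma stack_at_push s s' st a :
  size st + 1 < M -> stack_at w s st ->
  reg s' 2 = (reg s 2 + 1) %% M ->
  arr s' 1 = upd (arr s 1) (reg s 2) (first a) ->
  arr s' 2 = upd (arr s 2) (reg s 2) (order a) ->
  arr s' 3 = upd (arr s 3) (reg s 2) (degsum a %% M) ->
  stack_at w s' (rcons st a).
Proof.
move=> stM [r2 h1 h2 h3] r2' a1 a2 a3.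
split; first by rewrite r2' r2 size_rcons lit_small ?stM ?addn1.
all: move=> i; rewrite size_rcons ltnS nth_rcons ?a1 ?a2 ?a3 r2 /upd => ist.
all: have [lt|->] : i < size st \/ i = size st by mlia.
all: by rewrite ?(ltn_eqF lt) ?lt ?ltnn ?eqxx ?h1 ?h2 ?h3.
Qed.

Lemma sub_small x y : y <= x -> x < M -> (x + (M - y)) %% M = x - y.
Proof.
move=> yx xM; have -> : x + (M - y) = (x - y) + M by mlia.
by rewrite modnDr lit_small //; mlia.
Qed.

Lemma do_empty_spec s pos st nv T bl L :
  rep s pos st nv T bl L -> pos < S ->
  wp w do_empty s (fun k s' => k <= 50 /\
    rep s' pos.+1 (rcons st (Part nv 0 0)) nv T bl L).
Proof.
move=> [I p1 Sk r3 rT B G A bd] pS; have [M1 _] := square_large codeM.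
have /and3P[b1 b2 b3] := bd.
have l1 : 1 %% M = 1 by rewrite lit_small //; mlia.
rewrite /do_empty /incr; do 9 wstep; split => //.
set s' := State _ _.
have fr : frame [:: 1; 2] [:: 1; 2; 3] s s' by rewrite /s'; frame_tac.
split.
- exact: (input_at_frame fr).
- by rewrite /s' /upd /= p1 l1 lit_small ?addn1 //; mlia.
- apply: (stack_at_push _ Sk) => //; first by mlia.
  + by rewrite /s' /upd /= modnDmr.
  + by rewrite /s' /upd /= r3.
  + by rewrite /s' /upd /= mod0n.
- by rewrite fr.1.
- by rewrite fr.1.
- exact: (blocks_at_frame fr).
- exact: (graph_at_frame fr).
- exact: A.
- by rewrite size_rcons; mlia.
Qed.

Lemma new_vertex_spec s n L (Q : nat -> state -> Prop) :
  n + 1 < M -> 3 < M -> graph_at false s n L (fun=> 1) -> reg s 3 = n ->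
  (forall u x, (u, x) \in L -> u < x) ->
  (forall k s', k <= 50 -> frame [:: 3; 15; 17] [:: 10; 13; 14] s s' ->
     reg s' 3 = n.+1 -> graph_at false s' n.+1 L (fun=> 1) -> Q k s') ->
  wp w new_vertex s Q.
Proof.
move=> nM M3 G r3 A H.
have l1 : 1 %% M = 1 by rewrite lit_small //; mlia.
rewrite /new_vertex /incr; do 5 wstep; set s1 := State _ _.
have fr1 : frame [:: 15; 17] [::] s s1 by rewrite /s1; frame_tac.
apply: (@init_vertex_spec _ false s1 n L (fun=> 1) (fun=> 1)) => //.
- by mlia.
- exact: (graph_at_frame fr1).
- by move=> x; apply/negP => nx; have := ga_lt G nx; have := A _ _ nx; lia.
move=> s2 fr2 G2.
have fr12 := frame_comp (rs := [:: 3; 15; 17]) (ts := [:: 10; 13; 14])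
  fr1 fr2 isT isT.
wstep; apply: H => //.
- by frame_tac.
- by rewrite /upd /= fr2.1 // fr1.1 // r3 l1 lit_small ?addn1 //; mlia.
- apply: (@graph_at_frame [:: 3] [::] s2) G2 => //.
  by frame_tac.
Qed.

Lemma do_vertex_spec s pos st nv T bl L :
  rep s pos st nv T bl L -> pos < S ->
  wp w do_vertex s (fun k s' => k <= 100 /\
    rep s' pos.+1 (rcons st (Part nv 1 0)) nv.+1 T bl L).
Proof.
move=> [I p1 Sk r3 rT B G A bd] pS; have [M1 _] := square_large codeM.
have /and3P[b1 b2 b3] := bd.
have l1 : 1 %% M = 1 by rewrite lit_small //; mlia.
rewrite /do_vertex /incr; do 10 wstep.
set s1 := State _ _.
have fr : frame [:: 1; 2] [:: 1; 2; 3] s s1 by rewrite /s1; frame_tac.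
apply: (@new_vertex_spec s1 nv L) => //; try by mlia.
- exact: (graph_at_frame fr).
move=> k s2 kle fr2 r3' G2; split; first by simpl; mlia.
have fr12 := frame_comp (rs := [:: 1; 2; 3; 15; 17])
  (ts := [:: 1; 2; 3; 10; 13; 14]) fr fr2 isT isT.
split.
- exact: (input_at_frame fr12).
- by rewrite fr2.1 // /s1 /upd /= p1 l1 lit_small ?addn1 //; mlia.
- apply: (stack_at_frame fr2) => //; apply: (stack_at_push _ Sk) => //.
  + by mlia.
  + by rewrite /s1 /upd /= modnDmr.
  + by rewrite /s1 /upd /= r3.
  + by rewrite /s1 /upd /= l1.
- exact: r3'.
- by rewrite fr12.1.
- exact: (blocks_at_frame fr12).
- exact: G2.
- exact: A.
- by rewrite size_rcons; mlia.
Qed.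

Lemma do_inc_spec s pos st f n d nv T bl L N :
  rep s pos (rcons st (Part f n d)) nv T bl L ->
  f + n = nv -> all (fun u => u < n) N ->
  occurs_at code pos (4 :: encode_seq N) ->
  wp w do_inc s (fun k s' => k <= 200 + 100 * size N /\
    rep s' (pos + size N + 2) (rcons st (Part f n.+1 (d + 2 * size N))) nv.+1 T
      (bl ++ [seq ((f + u, 1), (nv, 1)) | u <- N])
      (L ++ [seq (f + u, nv) | u <- N])).
Proof.
move=> [I p1 Sk r3 rT B G A bd] fn ltN [cS cE]; have [M1 _] := square_large codeM.
have /and3P[b1 b2 b3] := bd.
rewrite /encode_seq /= size_rcons in cS cE b1.
have l1 : 1 %% M = 1 by rewrite lit_small //; mlia.
have l2 : 2 %% M = 2 by rewrite lit_small //; mlia.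
rewrite /do_inc /incr; do 3 wstep; set s1 := State _ _.
have fr1 : frame [:: 18] [::] s s1 by rewrite /s1; frame_tac.
apply: (@new_vertex_spec s1 nv L) => //; try by mlia.
- exact: (graph_at_frame fr1).
move=> k2 s2 k2le fr2 r3' G2.
have fr02 := frame_comp (rs := [:: 3; 15; 17; 18])
  (ts := [:: 10; 13; 14]) fr1 fr2 isT isT.
have p2 : reg s2 1 = pos by rewrite fr02.1.
have I2 := input_at_frame fr02 isT isT I.
have Sk2 := stack_at_frame fr02 isT isT isT isT Sk.
do 7 wstep; set s3 := State _ _.
have fr3 : frame [:: 9; 10; 12] [::] s2 s3 by rewrite /s3; frame_tac.
have r12 : reg s3 12 = size N.
  rewrite /s3 /upd /= p2 l1 lit_small; last by mlia.
  by rewrite I2.2; [rewrite cE|mlia].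
have r9 : reg s3 9 = size st.
  rewrite /s3 /upd /= (sa_size Sk2) size_rcons l1 sub_small //; last by mlia.
  by rewrite subn1.
have r10 : reg s3 10 = 0 by rewrite /s3 /upd /= mod0n.
have fr03 := frame_comp (rs := [:: 3; 9; 10; 12; 15; 17; 18])
  (ts := [:: 10; 13; 14]) fr02 fr3 isT isT.
have I3 := input_at_frame fr03 isT isT I.
have Sk3 := stack_at_frame fr03 isT isT isT isT Sk.
have B3 := blocks_at_frame fr03 isT isT isT isT isT B.
have p3 : reg s3 1 = pos by rewrite fr03.1.
have r183 : reg s3 18 = nv by rewrite fr3.1 // fr2.1.
have T3 : reg s3 4 = T %% M by rewrite fr03.1.
have G3 : graph_at false s3 nv.+1 L (fun=> 1) by exact: (graph_at_frame fr3).
have r33 : reg s3 3 = nv.+1 by rewrite fr3.1.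
move: s3 fr3 fr03 r12 r9 r10 I3 Sk3 B3 p3 r183 T3 G3 r33 => s3 _ _ r12 r9 r10.
move=> I3 Sk3 B3 p3 r183 T3 G3 r33.
have szst : size st < size (rcons st (Part f n d)) by rewrite size_rcons.
have top : nth part0 (rcons st (Part f n d)) (size st) = Part f n d.
  by rewrite nth_rcons ltnn eqxx.
apply: wp_weaken.
  apply: (wp_while (n := size N) (f := fun=> 70)
    (I := fun j s4 =>
      [/\ frame [:: 5; 6; 10; 17] [:: 4; 5; 6; 7; 10; 11; 12] s3 s4,
          reg s4 10 = j,
          blocks_at s4 (bl ++ [seq ((f + u, 1), (nv, 1)) | u <- take j N])
        & graph_at false s4 nv.+1
            (L ++ [seq (f + u, nv) | u <- take j N]) (fun=> 1)])).
  - by move=> j s4 jN [fr rj _ _] /=; rewrite rj (fr.1 12 isT) r12 jN l1.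
  - move=> j s4 jN [fr rj B4 G4].
    do 3 wstep; set s5 := State _ _.
    have fr5 : frame [:: 17] [::] s4 s5 by rewrite /s5; frame_tac.
    have Nj : nth 0 N j < n by apply: (allP ltN); rewrite mem_nth.
    have r17 : reg s5 17 = f + nth 0 N j.
      rewrite /s5 /upd /= (fr.1 9 isT) (fr.1 1 isT) (fr.2 1 isT) (fr.2 0 isT).
      rewrite r9 p3 rj l2 (sa_first Sk3) // top /=.
      rewrite modnDml (@lit_small w (pos + 2 + j)); last by mlia.
      rewrite I3.2; last by mlia.
      have -> : nth 0 code (pos + 2 + j) = nth 0 N j.
        by rewrite -addnA (cE (2 + j)) //=; mlia.
      by rewrite lit_small //; mlia.
    have r185 : reg s5 18 = nv by rewrite fr5.1 // fr.1.
    have G5 := graph_at_frame (b := false) fr5 isT isT isT isT isT isT G4.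
    apply: (add_arc_spec _ G5 r17 r185) => //.
      by rewrite size_cat size_map size_take jN; mlia.
    move=> s6 fr6 G6; do 11 wstep; split => //.
    set s7 := State _ _.
    have fr7 : frame [:: 5; 10] [:: 4; 5; 6; 7] s6 s7 by rewrite /s7; frame_tac.
    have tk : take j.+1 N = rcons (take j N) (nth 0 N j) by apply: take_nth.
    have fr57 := frame_comp (rs := [:: 5; 6; 10; 17])
      (ts := [:: 4; 5; 6; 7; 10; 11; 12]) fr5 fr6 isT isT.
    have fr47 := frame_comp (rs := [:: 5; 6; 10; 17])
      (ts := [:: 4; 5; 6; 7; 10; 11; 12]) fr57 fr7 isT isT.
    split.
    + by apply: (frame_comp fr fr47).
    + rewrite /s7 /upd /= fr6.1 // fr5.1 // rj l1 lit_small ?addn1 //; mlia.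
    + rewrite tk map_rcons -rcons_cat.
      apply: (@blocks_at_push w s6) => //=.
      * rewrite size_cat size_map size_take jN; mlia.
      * apply: (blocks_at_frame fr6) => //; exact: (blocks_at_frame fr5).
      * by rewrite /upd /= modnDmr.
      * by rewrite /s7 /upd /= (fr6.1 17 isT) r17.
      * by rewrite /s7 /upd /= l1.
      * by rewrite /s7 /upd /= (fr6.1 18 isT) r185.
      * by rewrite /s7 /upd /= l1.
    + rewrite tk map_rcons -rcons_cat; exact: (graph_at_frame fr7).
  - by move=> s4 [fr rj _ _] /=; rewrite rj (fr.1 12 isT) r12 ltnn mod0n.
  - by rewrite take0 !cats0.
move=> k4 s4 [k4le [fr4 _ B4 G4]]; rewrite take_size in B4 G4.
do 5 wstep; set s5 := State _ _; split.
  by move: k4le; rewrite sum_nat_const_nat /=; mlia.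
have fr5 : frame [:: 1] [:: 2; 3] s4 s5 by rewrite /s5; frame_tac.
have fr35 := frame_comp (rs := [:: 1; 5; 6; 10; 17])
   (ts := [:: 2; 3; 4; 5; 6; 7; 10; 11; 12]) fr4 fr5 isT isT.
split.
- exact: (input_at_frame fr35).
- rewrite /s5 /upd /= !fr4.1 // p3 r12 l2 modnDml lit_small; mlia.
- have := Sk3; rewrite -!cats1 => Sk3'.
  apply: (stack_at_upd Sk3').
  + by rewrite fr35.1.
  + by rewrite fr35.2.
  + by [].
  + move=> i; rewrite /s5 /upd /= !fr4.1 // !fr4.2 // r9 (sa_order Sk3) // top /=.
    by rewrite l1 lit_small ?addn1 //; mlia.
  + move=> i; rewrite /s5 /upd /= !fr4.1 // !fr4.2 // r9 (sa_degsum Sk3) // top /=.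
    by rewrite r12; case: eqP => // _; mod_tac.
- by rewrite fr35.1.
- by rewrite fr35.1.
- exact: (blocks_at_frame fr5).
- exact: (graph_at_frame fr5).
- move=> u x; rewrite mem_cat => /orP[|/mapP[v vN [-> ->]]]; first exact: A.
  by rewrite -fn ltn_add2l; apply: (allP ltN).
- by rewrite !size_cat !size_map size_rcons; mlia.
Qed.

End Tokens.

(** * Operations with several arguments *)

Lemma low_frame_sub rs ts rs' ts' s s' :
  low_frame rs' ts' s s' -> all (mem rs) rs' -> all (mem ts) ts' ->
  low_frame rs ts s s'.
Proof.
move=> [hr ha] /allP sr /allP st; split=> x lx hx; [apply: hr|apply: ha] => //.
  by apply: contra hx => h; exact: sr.
by apply: contra hx => h; exact: st.
Qed.

Lemma blocks_at_low rs ts s s' bl :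
  low_frame rs ts s s' -> 5 \notin rs ->
  4 \notin ts -> 5 \notin ts -> 6 \notin ts -> 7 \notin ts ->
  blocks_at s bl -> blocks_at s' bl.
Proof. by move=> [hr ha] ? ? ? ? ? [? ?]; split; rewrite ?hr ?ha. Qed.

Lemma input_at_low rs ts s s' code :
  low_frame rs ts s s' -> 0 \notin rs -> 0 \notin ts ->
  input_at s code -> input_at s' code.
Proof. by move=> [hr ha] ? ? [? ?]; split; rewrite ?hr ?ha. Qed.

Lemma graph_at_low rs ts s s' n L W :
  low_frame rs ts s s' -> 6 \notin rs ->
  10 \notin ts -> 11 \notin ts -> 12 \notin ts -> 13 \notin ts -> 14 \notin ts ->
  graph_at false s n L W -> graph_at false s' n L W.
Proof. by move=> [hr ha] ? ? ? ? ? ? [? ? ? ? ?]; split; rewrite ?hr ?ha. Qed.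

Definition subst_tag (d : option (seq nat)) : nat := if d is Some _ then 6 else 5.

Definition subst_code (t : nat) (E : seq (nat * nat)) (d : option (seq nat)) :
    seq nat :=
  subst_tag d :: t :: encode_edges E ++
  (if d is Some q then encode_seq q else [::]).

Definition subst_tri (d : option (seq nat)) E t (n : nat -> nat) : nat :=
  if d is Some _ then tri_out E n else tri_mx E t n.

Lemma merge_tri_false a bs : merge_tri false a bs = 0.
Proof. by elim: bs a => //= b bs IH a; rewrite mul0n IH. Qed.

Lemma merge_blocks_false a bs : merge_blocks false a bs = [::].
Proof. by elim: bs a => //= b bs IH a; rewrite IH. Qed.

Section Args.

Variables (p : cmd) (cm : nat) (mmcost : nat -> nat).
Hypothesis mm : multiplies p cm mmcost.

Variable w : nat.
Local Notation M := (2 ^ w).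

Variable code : seq nat.
Local Notation S := (size code).
Hypothesis codeM : (S + 10) ^ 2 < M.
Hypothesis mmM : (2 * S + 2) ^ cm <= M.

Section Subst.

Variables (st0 ps : seq part) (E : seq (nat * nat)) (d : option (seq nat)).
Variable l : nat.
Hypothesis wfE : wf_edges (size ps) E.
Hypothesis outE : forall q, d = Some q -> forall u, size (out E u) <= l.
Hypothesis ps0 : 0 < size ps.

Local Notation ord i := (order (nth part0 ps i)).

Definition subst_cost : nat :=
  50 * size ps + (500 + 40 * l) * size E + 600 +
  (if d is Some _ then 0 else 30 * (size ps * size ps) + mmcost (size ps)).

Definition sum_tri : nat :=
  \sum_(q <- E) part_tri (nth part0 ps q.1) (nth part0 ps q.2).

Definition sum_deg : nat := \sum_(q <- E) 2 * (ord q.1 * ord q.2).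

Lemma do_subst_spec s pos bl T :
  word_state w s -> input_at s code -> reg s 1 = pos ->
  occurs_at code pos (subst_code (size ps) E d) ->
  size st0 + size ps + size bl <= S -> sumn (map order ps) <= S ->
  stack_at w s (st0 ++ ps) -> blocks_at s bl ->
  reg s 4 = T %% M -> reg s 7 = subst_tag d -> reg s 8 = size ps ->
  reg s 9 = size st0 -> reg s 11 = 0 ->
  wp w (do_subst p) s (fun k s' =>
    [/\ k <= subst_cost,
        low_frame [:: 1; 4; 5; 10; 11; 12; 13; 14; 15; 16; 17; 18; 19]
          [:: 3; 4; 5; 6; 7; 15; 16; 17; 18; 19] s s',
        stack_at w s' (st0 ++ Part (first (head part0 ps)) (order (head part0 ps))
            (degsum (head part0 ps) + sum_deg) :: behead ps),
        blocks_at s' (bl ++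
          [seq part_block (nth part0 ps q.1) (nth part0 ps q.2) | q <- E])
      & [/\ reg s' 4 =
           (T + sum_tri + subst_tri d E (size ps) (fun i => ord i)) %% M,
           reg s' 1 = pos + size (subst_code (size ps) E d) & reg s' 11 = 0]]).
Proof.
move=> ws I p1 oc szS ordS Sk B rT r7 r8 r9 r11.
have [M1 M2] := square_large codeM.
have l1 : 1 %% M = 1 by rewrite lit_small //; mlia.
have l2 : 2 %% M = 2 by rewrite lit_small //; mlia.
have l5 : 5 %% M = 5 by rewrite lit_small //; mlia.
have [szoc _] := oc.
have szE : pos + 2 * size E + 3 <= S.
  move: szoc; rewrite /subst_code /encode_edges /= size_cat -/(pairs_code E).
  by rewrite size_pairs_code; mlia.
set pos' := pos + size (subst_code _ _ _).
rewrite /do_subst; do 3 wstep; set s1 := State _ _.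
have fr1 : frame [:: 12] [::] s s1 by rewrite /s1; frame_tac.
have ws1 : word_state w s1.
  exact: exec_word (ExSet w 12 (Get 0 (Bin Add (Reg 1) (Lit 2))) s) ws.
have r12 : reg s1 12 = size E.
  rewrite /s1 /upd /= p1 l2 lit_small; last by mlia.
  by rewrite I.2; [rewrite (oc.2 2)|mlia].
have p11 : reg s1 1 = pos by rewrite fr1.1.
have Es : edges_at w s1 E.
  split => //; first by rewrite p11; mlia.
  rewrite p11 => i iE.
  have [_ h] : occurs_at code (pos + 3) (pairs_code E).
    have := oc; rewrite /subst_code /encode_edges.
    rewrite -[_ :: _ :: _]/([:: subst_tag d; size ps; size E] ++ (pairs_code E ++ _)).
    by move/occurs_at_cat => [_ /occurs_at_cat[]].
  have [e1 e2] := nth_pairs_code iE.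
  rewrite fr1.2 // !I.2; try mlia.
  have -> : pos + 4 + 2 * i = pos + 3 + (2 * i).+1 by lia.
  by rewrite !h ?e1 ?e2 // size_pairs_code; mlia.
move: s1 fr1 ws1 r12 p11 Es => s1 fr1 ws1 r12 p11 Es.
have P1 : wp w pair_edges s1 (fun k s' => [/\ k <= 110 * size E + 10,
    frame [:: 4; 5; 10; 11; 13; 14; 17; 18] [:: 4; 5; 6; 7] s1 s',
    blocks_at s' (bl ++
      [seq part_block (nth part0 ps q.1) (nth part0 ps q.2) | q <- E]),
    reg s' 4 = (T + sum_tri) %% M & reg s' 11 = sum_deg %% M]).
  apply: (pair_edges_spec (st0 := st0) (ps := ps) (E := E) wfE _ (bl := bl)
    (T := T) _ Es); rewrite ?(fr1.1 4) ?(fr1.1 9) ?(fr1.1 11) //; try by mlia.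
    exact: (stack_at_frame fr1).
  exact: (blocks_at_frame fr1).
apply: (wp_weaken (wp_word ws1 P1)) => k2 s2 [[k2le fr2 B2 T2 D2] ws2].
have fr02 := frame_comp (rs := [:: 4; 5; 10; 11; 12; 13; 14; 17; 18])
  (ts := [:: 4; 5; 6; 7]) fr1 fr2 isT isT.
have Sk2 := stack_at_frame fr02 isT isT isT isT Sk.
have Es2 := edges_at_frame fr2 isT isT isT Es.
have r92 : reg s2 9 = size st0 by rewrite fr02.1.
have r82 : reg s2 8 = size ps by rewrite fr02.1.
have r72 : reg s2 7 = subst_tag d by rewrite fr02.1.
have r122 : reg s2 12 = size E by rewrite fr2.1.
have p2 : reg s2 1 = pos by rewrite fr2.1.
have evA s3 : reg s3 1 = pos -> reg s3 12 = size E ->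
    eval w s3 after_edges = pos + 3 + 2 * size E.
  move=> e1 e12; rewrite /= e1 e12 -[RHS](@lit_small w); last by mlia.
  by mod_tac.
have szP : size (pairs_code E) = 2 * size E := size_pairs_code E.
wstep.
suff P : wp w (If (Bin Eq (Reg 7) (Lit 5)) (Seq (tri_mm p) (Set_ 1 after_edges))
      (Seq tri_lists (Set_ 1
        (Bin Add (Bin Add after_edges (Lit 1)) (Get 0 after_edges))))) s2
    (fun k s3 => [/\ k + 120 * size E + 100 <= subst_cost,
       low_frame [:: 1; 4; 10; 15; 16; 17; 18; 19] [:: 15; 16; 17; 18; 19] s2 s3,
       reg s3 4 = (T + sum_tri + subst_tri d E (size ps) (fun i => ord i)) %% M
     & reg s3 1 = pos']).
  apply: wp_weaken P _ => k3 s3 [k3le lf3 T3 p3].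
  have Sk3 := stack_at_low lf3 isT isT isT isT Sk2.
  have r93 : reg s3 9 = size st0 by rewrite lf3.1.
  have lf03 := low_frame_comp
    (rs := [:: 1; 4; 5; 10; 11; 12; 13; 14; 15; 16; 17; 18; 19])
    (ts := [:: 3; 4; 5; 6; 7; 15; 16; 17; 18; 19])
    (frame_low fr02) lf3 isT isT.
  do 3 wstep; set s4 := State _ _.
  have fr4 : frame [:: 11] [:: 3] s3 s4 by rewrite /s4; frame_tac.
  split.
  - by move: k2le k3le; simpl; mlia.
  - by apply: (low_frame_comp lf03 (frame_low fr4)).
  - have e0 : nth part0 (st0 ++ ps) (size st0) = head part0 ps.
      by rewrite nth_cat ltnn subnn nth0.
    have lt0 : size st0 < size (st0 ++ ps) by rewrite size_cat; mlia.
    have eps : ps = head part0 ps :: behead ps by case: (ps) ps0.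
    have Sk3' : stack_at w s3 (st0 ++ head part0 ps :: behead ps) by rewrite -eps.
    apply: (stack_at_upd Sk3') => //.
    + by move=> i; rewrite /s4 /upd; case: eqP => //= ->; rewrite (sa_order Sk3) // e0.
    + move=> i; rewrite /s4 /upd /= r93 (sa_degsum Sk3) // e0 lf3.1 // D2.
      by case: eqP => // _; mod_tac.
  - apply: (blocks_at_frame fr4) => //; exact: (blocks_at_low lf3).
  - by split; rewrite ?fr4.1 // /s4 /upd /= mod0n.
have M1' : (1 %% M != 0) by rewrite l1.
apply: wp_if; rewrite /= r72 l5 /pos' /subst_cost.
case ed: (d) => [q|] /=.
- rewrite mod0n /=; wstep.
  apply: (tri_lists_spec wfE _ (outE ed) Es2 Sk2 T2 r92 r82); first by mlia.
  move=> k3 s3 k3le fr3 T3.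
  have p3 : reg s3 1 = pos by rewrite fr3.1.
  have r123 : reg s3 12 = size E by rewrite fr3.1.
  have a0 : arr s3 0 = arr s 0 by rewrite fr3.2 // fr02.2.
  have /= ev := evA _ p3 r123.
  wstep; rewrite ev l1 a0 (@lit_small w (_ + 1)); last by mlia.
  have oq : nth 0 code (pos + 3 + 2 * size E) = size q.
    have := oc; rewrite ed /subst_code /encode_edges /=.
    rewrite -[_ :: _ :: _]/([:: 6; size ps; size E] ++ (pairs_code E ++ _)).
    move/occurs_at_cat => [_ /occurs_at_cat[_ [_ /(_ 0)]]] /=.
    by rewrite szP addn0 => ->.
  have szq : pos + 3 + 2 * size E + 1 + size q <= S.
    move: szoc; rewrite ed /subst_code /= size_cat -/(pairs_code E) szP /=.
    by mlia.
  rewrite I.2; last by mlia.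
  rewrite oq lit_small; last by mlia.
  split.
  + by move: k3le; simpl; mlia.
  + have lf := low_frame_sub (rs := [:: 1; 4; 10; 15; 16; 17; 18; 19])
      (ts := [:: 15; 16; 17; 18; 19]) (frame_low fr3) isT isT.
    split=> x xlt hx; last by rewrite -(lf.2 x).
    rewrite -(lf.1 x) //= /upd; case: eqP => // x1.
    by rewrite x1 inE in hx.
  + by rewrite /upd /= T3.
  + by rewrite /upd /= size_cat -/(pairs_code E) szP /=; mlia.
- rewrite l1 /=; wstep.
  (* Matrix entries are 0, 1 or orders, and orders are at most [S]; as there are at most [S]
     arguments, the base is at most the [2 * S + 2] of [mmM]. *)
  apply: (tri_mm_spec mm (b := S.+2) wfE _ _ ps0 _ _ _ ws2 Es2 Sk2 T2 r92 r82) => //.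
  + by mlia.
  + have : size ps * size ps <= S * S by apply: leq_mul; mlia.
    by mlia.
  + move=> i ips; apply: (@leq_trans S.+1); last by mlia.
    apply: leq_trans ordS; rewrite -(cat_take_drop i ps) map_cat sumn_cat.
    rewrite (drop_nth part0 ips) /= nth_cat size_take ips ltnn subnn /=.
    by mlia.
  + apply: leq_trans mmM; case: (posnP cm) => [->|c0]; first by rewrite !expn0.
    rewrite leq_exp2r //; mlia.
  move=> k3 s3 k3le lf3 T3.
  have p3 : reg s3 1 = pos by rewrite lf3.1.
  have r123 : reg s3 12 = size E by rewrite lf3.1.
  have /= ev := evA _ p3 r123.
  wstep; rewrite ev; split.
  + by move: k3le; simpl; mlia.
  + split=> x xlt hx; rewrite /= /upd.
      case: eqP => [x1|_]; first by rewrite x1 inE in hx.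
      by apply: lf3.1 => //; apply: contra hx; rewrite !inE; do ![case: eqP => //].
    by apply: lf3.2.
  + by rewrite /upd /= T3.
  + by rewrite /upd /= cats0 -/(pairs_code E) szP; mlia.
Qed.

End Subst.

(** The branch on the tag enters only through its effect, given by [a :: bs], [T'], [bl'] and
    [pos'], and its cost [K]; the final merging is common to all operations with arguments. *)
Lemma do_args_gen s pos st0 ps a bs nv T bl L jn pos' T' bl' K :
  word_state w s -> rep w code s pos (st0 ++ ps) nv T bl L ->
  size ps = (size bs).+1 -> pos + 1 < S -> nth 0 code (pos + 1) = size ps ->
  (reg s 7 == 3) = jn -> order a + sumn (map order bs) <= nv ->
  pos <= pos' -> pos' <= S ->
  size st0 + 1 + size bl' + jn * size bs <= pos' -> size bl' <= S ->
  (forall s1, word_state w s1 -> frame [:: 8; 9; 11] [::] s s1 ->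
     reg s1 8 = size ps -> reg s1 9 = size st0 -> reg s1 11 = 0 ->
     wp w (If (Bin Lt (Reg 7) (Lit 5)) (incr 1 2) (do_subst p)) s1 (fun k s2 =>
       [/\ k <= K, low_frame [:: 1; 4; 5; 10; 11; 12; 13; 14; 15; 16; 17; 18; 19]
             [:: 3; 4; 5; 6; 7; 15; 16; 17; 18; 19] s1 s2,
           stack_at w s2 (st0 ++ a :: bs), blocks_at s2 bl'
         & [/\ reg s2 4 = T' %% M, reg s2 1 = pos' & reg s2 11 = 0]])) ->
  wp w (do_args p) s (fun k s' => k <= K + 110 * size ps + 100 /\
    rep w code s' pos' (rcons st0 (foldl (merge_part jn) a bs)) nv
      (T' + merge_tri jn a bs) (bl' ++ merge_blocks jn a bs) L).
Proof.
move=> ws [I p1 Sk r3 rT B G A bd] szps posS ct r7 ord pp' p'S bd' bl'S H.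
have [M1 M2] := square_large codeM.
have /and3P[b1 b2 b3] := bd; rewrite size_cat in b1.
have l1 : 1 %% M = 1 by rewrite lit_small //; mlia.
rewrite /do_args; do 7 wstep; set s1 := State _ _.
have fr1 : frame [:: 8; 9; 11] [::] s s1 by rewrite /s1; frame_tac.
have r8 : reg s1 8 = size ps.
  rewrite /s1 /upd /= p1 l1 lit_small; last by mlia.
  by rewrite I.2.
have r9 : reg s1 9 = size st0.
  rewrite /s1 /upd /= p1 l1 (@lit_small w (pos + 1)); last by mlia.
  rewrite I.2 // ct (sa_size Sk) size_cat (sub_small codeM); mlia.
have r11 : reg s1 11 = 0 by rewrite /s1 /upd /= mod0n.
have ws1 : word_state w s1.
  have e1 := ExSeq (ExSet w 8 (Get 0 (Bin Add (Reg 1) (Lit 1))) s)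
    (ExSeq (ExSet w 9 (Bin Defs.Sub (Reg 2) (Reg 8)) _) (ExSet w 11 (Lit 0) _)).
  exact: exec_word e1 ws.
have {}H := H s1 ws1 fr1 r8 r9 r11.
apply: (wp_weaken H) => k2 s2 [k2le lf2 Sk2 B2 [T2 p2 r112]].
have lf02 := low_frame_comp
    (rs := [:: 1; 4; 5; 8; 9; 10; 11; 12; 13; 14; 15; 16; 17; 18; 19])
    (ts := [:: 3; 4; 5; 6; 7; 15; 16; 17; 18; 19])
    (frame_low fr1) lf2 isT isT.
apply: (merge_spec (jn := jn) (T := T') _ _ _ Sk2 B2) => //; try by mlia.
- by rewrite lf02.1.
- by rewrite lf2.1 // r8.
- by rewrite lf2.1.
move=> k3 s3 k3le fr3 Sk3 B3 T3; split.
  by move: k2le k3le; simpl; mlia.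
have lf03 := low_frame_comp
    (rs := [:: 1; 2; 4; 5; 8; 9; 10; 11; 12; 13; 14; 15; 16; 17; 18; 19])
    (ts := [:: 2; 3; 4; 5; 6; 7; 15; 16; 17; 18; 19])
    lf02 (frame_low fr3) isT isT.
split => //.
- exact: (input_at_low lf03).
- by rewrite fr3.1.
- by rewrite lf03.1.
- exact: (graph_at_low lf03).
- by rewrite size_rcons size_cat size_merge_blocks; mlia.
Qed.

Lemma do_args_merge s pos st0 a bs nv T bl L tag :
  word_state w s -> rep w code s pos (st0 ++ a :: bs) nv T bl L ->
  reg s 7 = tag -> 1 < tag < 4 ->
  occurs_at code pos [:: tag; (size bs).+1] ->
  order a + sumn (map order bs) <= nv ->
  wp w (do_args p) s (fun k s' => k <= 110 * (size bs).+1 + 200 /\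
    rep w code s' (pos + 2) (rcons st0 (foldl (merge_part (tag == 3)) a bs)) nv
      (T + merge_tri (tag == 3) a bs) (bl ++ merge_blocks (tag == 3) a bs) L).
Proof.
move=> ws rp r7 tag23 [szoc oc] ord.
have [M1 M2] := square_large codeM.
have [I p1 Sk r3 rT B G A bd] := rp.
have /and3P[b1 b2 b3] := bd; rewrite size_cat /= in b1.
have jn_le : (tag == 3) * size bs <= size bs by case: (tag == 3); lia.
apply: wp_weaken (do_args_gen (jn := tag == 3) (K := 50) (bs := bs) (a := a)
  (pos' := pos + 2) (T' := T) (bl' := bl) ws rp _ _ _ _ ord _ _ _ _ _) _ => //.
- by move: szoc => /=; mlia.
- exact: (oc 1).
- by rewrite r7.
- by mlia.
- by mlia.
- by mlia.
- move=> s1 ws1 fr1 r8 r9 r11.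
  have l5 : 5 %% M = 5 by rewrite lit_small //; mlia.
  have l1 : 1 %% M = 1 by rewrite lit_small //; mlia.
  have l2 : 2 %% M = 2 by rewrite lit_small //; mlia.
  have t5 : tag < 5 by lia.
  apply: wp_if; rewrite /= fr1.1 // r7 l5 t5 l1 /= /incr; wstep.
  set s2 := State _ _.
  have fr2 : frame [:: 1] [::] s1 s2 by rewrite /s2; frame_tac.
  have fr02 := frame_comp (rs := [:: 1; 8; 9; 11]) (ts := [::]) fr1 fr2 isT isT.
  split => //.
  + by apply: low_frame_sub (frame_low fr2) _ _.
  + exact: (stack_at_frame fr02).
  + exact: (blocks_at_frame fr02).
  split; rewrite ?fr02.1 // /s2 /upd /= ?fr1.1 // p1 l2 lit_small //; mlia.
- move=> k s' [kle rp']; split => //.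
  by move: kle; simpl; mlia.
Qed.

Lemma do_args_subst s pos st0 a bs E d l nv T bl L :
  let ps := a :: bs in
  wf_edges (size ps) E ->
  (forall q, d = Some q -> forall u, size (out E u) <= l) ->
  word_state w s -> rep w code s pos (st0 ++ ps) nv T bl L ->
  reg s 7 = subst_tag d -> occurs_at code pos (subst_code (size ps) E d) ->
  order a + sumn (map order bs) <= nv ->
  wp w (do_args p) s (fun k s' =>
    k <= subst_cost ps E d l + 110 * size ps + 200 /\
    rep w code s' (pos + size (subst_code (size ps) E d))
      (rcons st0 (foldl (merge_part false)
        (Part (first a) (order a) (degsum a + sum_deg ps E)) bs)) nv
      (T + sum_tri ps E +
         subst_tri d E (size ps) (fun i => order (nth part0 ps i)))
      (bl ++ [seq part_block (nth part0 ps q.1) (nth part0 ps q.2) | q <- E]) L).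
Proof.
move=> ps wfE outE ws rp r7 oc ord.
have [M1 M2] := square_large codeM.
have [I p1 Sk r3 rT B G A bd] := rp.
have /and3P[b1 b2 b3] := bd; rewrite size_cat /= in b1.
have [szoc _] := oc.
have szE : size (subst_code (size ps) E d) >= 3 + 2 * size E.
  by rewrite /subst_code /encode_edges /= size_cat -/(pairs_code E) size_pairs_code; lia.
apply: wp_weaken (do_args_gen (jn := false) (K := subst_cost ps E d l + 50)
  (bs := bs) (a := Part (first a) (order a) (degsum a + sum_deg ps E))
  (pos' := pos + size (subst_code (size ps) E d))
  (T' := T + sum_tri ps E +
         subst_tri d E (size ps) (fun i => order (nth part0 ps i)))
  (bl' := bl ++ [seq part_block (nth part0 ps q.1) (nth part0 ps q.2) | q <- E])
  ws rp _ _ _ _ ord _ _ _ _ _) _ => //.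
- by mlia.
- by rewrite (oc.2 1).
- by rewrite r7; case: (d).
- by mlia.
- by rewrite size_cat size_map; mlia.
- by rewrite size_cat size_map; mlia.
- move=> s1 ws1 fr1 r8 r9 r11.
  have l5 : 5 %% M = 5 by rewrite lit_small //; mlia.
  have t5 : (subst_tag d < 5) = false by case: (d).
  apply: wp_if; rewrite /= fr1.1 // r7 l5 t5 mod0n /=.
  apply: wp_weaken (do_subst_spec wfE outE _ (pos := pos) (bl := bl) (T := T)
    (st0 := st0) ws1 _ _ oc _ _ _ _ _ _ r8 r9 r11) _ => //.
  + exact: (input_at_frame fr1).
  + by rewrite fr1.1.
  + by rewrite /=; mlia.
  + by rewrite /=; mlia.
  + exact: (stack_at_frame fr1).
  + exact: (blocks_at_frame fr1).
  + by rewrite fr1.1.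
  + by rewrite fr1.1.
  by move=> k s' [kle lf Sk' B' H']; split => //; simpl; mlia.
- move=> k s' [kle rp']; split; first by mlia.
  by move: rp'; rewrite merge_tri_false merge_blocks_false addn0 cats0.
Qed.

End Args.

(** * Counting edges and triangles *)

Definition deg_sum (n : nat) (e : rel nat) : nat :=
  \sum_(0 <= u < n) \sum_(0 <= v < n) e u v.

Definition tri_sum (n : nat) (e : rel nat) : nat :=
  \sum_(0 <= u < n) \sum_(0 <= v < n) \sum_(0 <= x < n) e u v * e v x * e u x.

Lemma sum_pick t i (f : nat -> nat) : i < t ->
  \sum_(0 <= j < t) (i == j) * f j = f i.
Proof.
move=> it; rewrite big_mkord (bigD1 (Ordinal it)) //= eqxx mul1n big1 ?addn0 //.
by move=> j /negbTE; rewrite eq_sym -val_eqE /= => ->.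
Qed.

Lemma sum_offsets sh (F : nat -> nat) :
  \sum_(0 <= u < sumn sh) F u =
  \sum_(0 <= i < size sh) \sum_(0 <= u < nth 0 sh i) F (sumn (take i sh) + u).
Proof.
elim: sh F => [|n sh IH] F /=; first by rewrite !big_geq.
rewrite big_nat_recl // take0 /= (@big_cat_nat _ _ _ n) //=; last exact: leq_addr.
congr (_ + _); rewrite -{1}(add0n n) big_addn addKn.
rewrite (eq_bigr (fun u => F (n + u))) => [|u _]; last by rewrite addnC.
rewrite (IH (fun u => F (n + u))); apply: eq_bigr => i _.
by apply: eq_bigr => u _; rewrite addnA.
Qed.

Lemma sum_const (n c : nat) : \sum_(0 <= u < n) c = n * c.
Proof. by rewrite sum_nat_const_nat subn0. Qed.

Lemma sum3_xy n m l (f : nat -> nat -> nat) :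
  \sum_(0 <= u < n) \sum_(0 <= v < m) \sum_(0 <= x < l) f u v =
  (\sum_(0 <= u < n) \sum_(0 <= v < m) f u v) * l.
Proof.
rewrite big_distrl; apply: eq_bigr => u _; rewrite big_distrl.
by apply: eq_bigr => v _; rewrite sum_const mulnC.
Qed.

Lemma sum3_yz n m l (f : nat -> nat -> nat) :
  \sum_(0 <= u < n) \sum_(0 <= v < m) \sum_(0 <= x < l) f v x =
  (\sum_(0 <= v < m) \sum_(0 <= x < l) f v x) * n.
Proof. by rewrite sum_const mulnC. Qed.

Lemma sum3_xz n m l (f : nat -> nat -> nat) :
  \sum_(0 <= u < n) \sum_(0 <= v < m) \sum_(0 <= x < l) f u x =
  (\sum_(0 <= u < n) \sum_(0 <= x < l) f u x) * m.
Proof.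
by rewrite big_distrl; apply: eq_bigr => u _; rewrite sum_const mulnC.
Qed.

Section SubstSums.

Variables (H : rel nat) (sh : seq nat) (gs : seq (rel nat)).

Local Notation t := (size sh).
Local Notation n_ i := (nth 0 sh i).
Local Notation o_ i := (sumn (take i sh)).
Local Notation g_ i := (nth (fun _ _ => false) gs i).
Local Notation h i j := ((i != j) && H i j).
Local Notation e := (subst_adj H sh gs).

Lemma subst_adjE i j u v : i < t -> j < t -> u < n_ i -> v < n_ j ->
  e (o_ i + u) (o_ j + v) = (if i == j then g_ i u v else H i j).
Proof.
by move=> it jt un vn; rewrite /subst_adj -!/(flatten_index _ _ _)
  !flatten_indexKl // !flatten_indexKr.
Qed.

(** Adjacency as a sum of an inner and a cross term, of which at most one is nonzero: products of
    adjacencies can then be expanded termwise. *)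
Lemma subst_adj_nat i j u v : i < t -> j < t -> u < n_ i -> v < n_ j ->
  e (o_ i + u) (o_ j + v) = (i == j) * g_ i u v + h i j :> nat.
Proof.
move=> it jt un vn; rewrite subst_adjE //.
by case: eqP => _ /=; rewrite ?mul1n ?addn0.
Qed.

Lemma subst_sum2 (F : nat -> nat -> nat) :
  \sum_(0 <= u < sumn sh) \sum_(0 <= v < sumn sh) e u v * F u v =
  \sum_(0 <= i < t) \sum_(0 <= u < n_ i) \sum_(0 <= v < n_ i)
    g_ i u v * F (o_ i + u) (o_ i + v) +
  \sum_(0 <= i < t) \sum_(0 <= j < t) h i j *
    \sum_(0 <= u < n_ i) \sum_(0 <= v < n_ j) F (o_ i + u) (o_ j + v).
Proof.
rewrite sum_offsets -big_split /=; apply: eq_big_nat => i /= it.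
rewrite (eq_bigr (fun u => \sum_(0 <= j < t) \sum_(0 <= v < n_ j)
  e (o_ i + u) (o_ j + v) * F (o_ i + u) (o_ j + v))); last first.
  by move=> u _; rewrite sum_offsets.
rewrite exchange_big_nat /=.
rewrite (eq_big_nat _ _ (F2 := fun j => (i == j) * \sum_(0 <= u < n_ i)
   \sum_(0 <= v < n_ j) g_ i u v * F (o_ i + u) (o_ j + v) +
   h i j * \sum_(0 <= u < n_ i) \sum_(0 <= v < n_ j) F (o_ i + u) (o_ j + v))).
  by rewrite big_split /= (@sum_pick t i (fun j => \sum_(0 <= u < n_ i)
    \sum_(0 <= v < n_ j) g_ i u v * F (o_ i + u) (o_ j + v))).
move=> j /= jt; rewrite !big_distrr -big_split /=; apply: eq_big_nat => u /= un.
rewrite !big_distrr -big_split /=; apply: eq_big_nat => v /= vn.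
by rewrite subst_adj_nat // mulnDl mulnA.
Qed.

Lemma deg_sum_subst :
  deg_sum (sumn sh) e = \sum_(0 <= i < t) deg_sum (n_ i) (g_ i) +
    \sum_(0 <= i < t) \sum_(0 <= j < t) h i j * (n_ i * n_ j).
Proof.
have := subst_sum2 (fun _ _ => 1); rewrite /deg_sum.
under eq_bigr do under eq_bigr do rewrite muln1.
move=> ->; congr (_ + _).
  by apply: eq_bigr => i _; apply: eq_bigr => u _; apply: eq_bigr => v _; rewrite muln1.
apply: eq_bigr => i _; apply: eq_bigr => j _; congr (_ * _).
by rewrite !sum_nat_const_nat !subn0 muln1.
Qed.

Hypothesis Hsym : forall i j, H i j = H j i.

Definition tri_parts (n : nat -> nat) : nat :=
  \sum_(0 <= i < t) \sum_(0 <= j < t) \sum_(0 <= k < t)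
    h i j * h j k * h i k * (n i * n j * n k).

(** The three vertices of an ordered triangle lie in one argument, in two, or in three. In the
    second case the vertex that is alone in its argument can take any of the three positions, and
    the other two form an ordered adjacent pair of the other argument. *)
Lemma tri_sum_subst :
  tri_sum (sumn sh) e = \sum_(0 <= i < t) tri_sum (n_ i) (g_ i) +
    3 * \sum_(0 <= i < t) \sum_(0 <= j < t) h i j * (deg_sum (n_ i) (g_ i) * n_ j) +
    tri_parts (fun i => n_ i).
Proof.
pose A i j k := \sum_(0 <= u < n_ i) \sum_(0 <= v < n_ j) \sum_(0 <= x < n_ k)
  e (o_ i + u) (o_ j + v) * e (o_ j + v) (o_ k + x) * e (o_ i + u) (o_ k + x).
have -> : tri_sum (sumn sh) e =
    \sum_(0 <= i < t) \sum_(0 <= j < t) \sum_(0 <= k < t) A i j k.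
  rewrite /tri_sum sum_offsets; apply: eq_bigr => i _.
  under eq_bigr => u _ do rewrite sum_offsets.
  rewrite exchange_big_nat /=; apply: eq_bigr => j _.
  under eq_bigr => u _ do (under eq_bigr => v _ do rewrite sum_offsets;
    rewrite exchange_big_nat /=).
  by rewrite exchange_big_nat.
pose D i := deg_sum (n_ i) (g_ i).
have AE i j k : i < t -> j < t -> k < t -> A i j k =
    (i == j) * ((j == k) * tri_sum (n_ k) (g_ k)) +
    ((i == j) * (h j k * (D j * n_ k)) + (j == k) * (h i k * (D k * n_ i)) +
     (i == k) * (h k j * (D k * n_ j))) +
    h i j * h j k * h i k * (n_ i * n_ j * n_ k).
  move=> it jt kt.
  have AF : A i j k = \sum_(0 <= u < n_ i) \sum_(0 <= v < n_ j)
      \sum_(0 <= x < n_ k) ((i == j) * g_ i u v + h i j) *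
      ((j == k) * g_ j v x + h j k) * ((i == k) * g_ i u x + h i k).
    apply: eq_big_nat => u /= un; apply: eq_big_nat => v /= vn.
    by apply: eq_big_nat => x /= xn; rewrite !subst_adj_nat.
  rewrite AF {AF}.
  (* Of the eight products, those with exactly two inner factors vanish: two coinciding pairs of
     indices force the third to coincide, and then the cross factor is 0. *)
  have PF u v x : ((i == j) * g_ i u v + h i j) *
      ((j == k) * g_ j v x + h j k) * ((i == k) * g_ i u x + h i k) =
    (i == j) * ((j == k) * (g_ k u v * g_ k v x * g_ k u x)) +
    ((i == j) * (h j k * g_ j u v) + (j == k) * (h i k * g_ k v x) +
     (i == k) * (h k j * g_ k u x)) + h i j * h j k * h i k.
    case: (eqVneq i j) => [ij|ij]; case: (eqVneq j k) => [jk|jk] /=.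
    - subst j k; rewrite eqxx /= !mul1n !mul0n !addn0 /=; lia.
    - subst j; rewrite (negbTE jk) /=; case: (H i k); case: (g_ i u v); lia.
    - subst k; rewrite (negbTE ij) /=; case: (H i j); case: (g_ j v x); lia.
    - rewrite !mul0n !add0n; case: (eqVneq i k) => [ik|ik]; last by rewrite !mul0n.
      subst k; rewrite ?(negbTE ij) (Hsym j i).
      by case: (H i j); case: (g_ i u x).
  under eq_bigr => u _ do under eq_bigr => v _ do under eq_bigr => x _ do rewrite PF.
  under eq_bigr => u _ do under eq_bigr => v _ do rewrite !big_split.
  under eq_bigr => u _ do rewrite !big_split.
  rewrite !big_split /=; congr (_ + (_ + _ + _) + _).
  - case: (eqVneq i j) => [ij|_]; last first.
      by rewrite !big1 // => u _; rewrite big1 // => v _; rewrite big1.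
    case: (eqVneq j k) => [jk|_]; last first.
      by rewrite !big1 // => u _; rewrite big1 // => v _; rewrite big1.
    subst j k; rewrite !mul1n; apply: eq_bigr => u _; apply: eq_bigr => v _.
    by apply: eq_bigr => x _; rewrite !mul1n.
  - case: (eqVneq i j) => [ij|_]; last first.
      by rewrite !big1 // => u _; rewrite big1 // => v _; rewrite big1.
    subst j; rewrite mul1n (sum3_xy _ _ _ (fun u v => 1 * (h i k * g_ i u v))).
    rewrite mulnA; congr (_ * _); rewrite /D /deg_sum big_distrr /=.
    apply: eq_bigr => u _; rewrite big_distrr /=.
    by apply: eq_bigr => v _; rewrite mul1n.
  - case: (eqVneq j k) => [jk|_]; last first.
      by rewrite !big1 // => u _; rewrite big1 // => v _; rewrite big1.
    subst k; rewrite mul1n (sum3_yz _ _ _ (fun v x => 1 * (h i j * g_ j v x))).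
    rewrite mulnA; congr (_ * _); rewrite /D /deg_sum big_distrr /=.
    apply: eq_bigr => u _; rewrite big_distrr /=.
    by apply: eq_bigr => v _; rewrite mul1n.
  - case: (eqVneq i k) => [ik|_]; last first.
      by rewrite !big1 // => u _; rewrite big1 // => v _; rewrite big1.
    subst k; rewrite mul1n (sum3_xz _ _ _ (fun u x => 1 * (h i j * g_ i u x))).
    rewrite mulnA; congr (_ * _); rewrite /D /deg_sum big_distrr /=.
    apply: eq_bigr => u _; rewrite big_distrr /=.
    by apply: eq_bigr => v _; rewrite mul1n.
  - by rewrite !sum_const; lia.
rewrite (eq_big_nat _ _ (F2 := fun i => tri_sum (n_ i) (g_ i) +
    (\sum_(0 <= k < t) h i k * (D i * n_ k) +
     \sum_(0 <= k < t) h i k * (D k * n_ i) +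
     \sum_(0 <= k < t) h i k * (D i * n_ k)) +
    \sum_(0 <= j < t) \sum_(0 <= k < t)
      h i j * h j k * h i k * (n_ i * n_ j * n_ k))).
  rewrite !big_split /= -!addnA; congr (_ + _).
  (* The middle sum has its indices the other way round; by symmetry of [H] the three mixed sums are
     equal, whence the factor 3. *)
  rewrite [X in _ + (X + _) = _]exchange_big_nat /=.
  rewrite [X in _ + (X + _) = _](_ : _ = \sum_(0 <= i < t) \sum_(0 <= j < t)
    h i j * (D i * n_ j)); first by rewrite /tri_parts /D; lia.
  apply: eq_bigr => i _; apply: eq_bigr => j _.
  by rewrite eq_sym Hsym.
move=> i /= it.
rewrite (eq_big_nat _ _ (F2 := fun j =>
    (i == j) * tri_sum (n_ i) (g_ i) +
    ((i == j) * (\sum_(0 <= k < t) h i k * (D i * n_ k)) + h i j * (D j * n_ i) +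
     h i j * (D i * n_ j)) +
    \sum_(0 <= k < t) h i j * h j k * h i k * (n_ i * n_ j * n_ k))).
  rewrite !big_split /=.
  rewrite (sum_pick (fun=> tri_sum (n_ i) (g_ i)) it).
  by rewrite (sum_pick (fun=> \sum_(0 <= k < t) h i k * (D i * n_ k)) it).
move=> j /= jt.
rewrite (eq_big_nat _ _ (F2 := fun k =>
    (j == k) * ((i == j) * tri_sum (n_ k) (g_ k)) +
    ((i == j) * (h j k * (D j * n_ k)) + (j == k) * (h i k * (D k * n_ i)) +
     (i == k) * (h k j * (D k * n_ j))) +
    h i j * h j k * h i k * (n_ i * n_ j * n_ k))); last first.
  by move=> k /= kt; rewrite AE // mulnCA.
rewrite !big_split /=.
rewrite (sum_pick (fun k => (i == j) * tri_sum (n_ k) (g_ k)) jt).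
rewrite (sum_pick (fun k => h i k * (D k * n_ i)) jt).
rewrite (sum_pick (fun k => h k j * (D k * n_ j)) it) -big_distrr /=.
by case: eqP => // ->.
Qed.

End SubstSums.

Lemma sum2_recr n (f : nat -> nat -> nat) :
  \sum_(0 <= u < n.+1) \sum_(0 <= v < n.+1) f u v =
  \sum_(0 <= u < n) \sum_(0 <= v < n) f u v +
  \sum_(0 <= u < n) (f u n + f n u) + f n n.
Proof.
rewrite big_nat_recr //= [X in _ + X]big_nat_recr //=.
under eq_bigr do rewrite big_nat_recr //=.
by rewrite !big_split /=; lia.
Qed.

Lemma sum3_recr n (f : nat -> nat -> nat -> nat) :
  \sum_(0 <= u < n.+1) \sum_(0 <= v < n.+1) \sum_(0 <= x < n.+1) f u v x =
  \sum_(0 <= u < n) \sum_(0 <= v < n) \sum_(0 <= x < n) f u v x +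
  \sum_(0 <= u < n) \sum_(0 <= v < n) (f u v n + f u n v + f n u v) +
  \sum_(0 <= u < n) (f u n n + f n u n + f n n u) + f n n n.
Proof.
rewrite big_nat_recr //= sum2_recr.
under eq_bigr do rewrite sum2_recr.
rewrite !big_split /=.
have -> : \sum_(0 <= u < n) \sum_(0 <= v < n) (f u v n + f u n v + f n u v) =
  \sum_(0 <= u < n) \sum_(0 <= v < n) (f u v n + f u n v) +
  \sum_(0 <= u < n) \sum_(0 <= v < n) f n u v.
  by rewrite -big_split; apply: eq_bigr => u _; rewrite -big_split.
lia.
Qed.

Lemma sum_mem n (N : seq nat) (f : nat -> nat) :
  wf_nbrs n N -> \sum_(0 <= u < n) (u \in N) * f u = \sum_(u <- N) f u.
Proof.
move=> /andP[uN /allP ltN].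
transitivity (\sum_(0 <= u < n | u \in N) f u).
  by rewrite [RHS]big_mkcond; apply: eq_bigr => u _; case: ifP; rewrite ?mul1n.
rewrite -big_filter; apply: perm_big; apply: uniq_perm => //.
  by rewrite filter_uniq // iota_uniq.
move=> u; rewrite mem_filter mem_index_iota /=.
by case uin: (u \in N) => //=; rewrite (ltN u uin).
Qed.

Lemma sum2_pick t i j (f : nat -> nat -> nat) : i < t -> j < t ->
  \sum_(0 <= a < t) \sum_(0 <= b < t) ((a == i) && (b == j)) * f a b = f i j.
Proof.
move=> it jt; rewrite -(sum_pick (fun a => f a j) it); apply: eq_bigr => a _.
rewrite -(sum_pick (f a) jt) big_distrr /=; apply: eq_bigr => b _.
by rewrite (eq_sym a) (eq_sym b) mulnA mulnb.
Qed.

(** Since [E] is duplicate-free and lists the smaller end first, the two orientations of all listed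
    edges are pairwise distinct, so no ordered pair is counted twice. *)
Lemma sum_list_adj t E (f : nat -> nat -> nat) : wf_edges t E ->
  \sum_(0 <= i < t) \sum_(0 <= j < t) ((i != j) && list_adj E i j) * f i j =
  \sum_(p <- E) (f p.1 p.2 + f p.2 p.1).
Proof.
elim: E => [|[a b] E IH].
  by move=> _; rewrite big_nil big1 // => i _; rewrite big1 // => j _;
    rewrite /list_adj !in_nil andbF.
move=> /andP[/= /andP[nE uE] /andP[/andP[ab bt] allE]].
have wfE : wf_edges t E by apply/andP.
have nE' : (b, a) \notin E.
  by apply/negP => /(allP allE) /=; lia.
have at_ := ltn_trans ab bt.
rewrite big_cons -IH // /= -(sum2_pick f at_ bt) -(sum2_pick f bt at_).
rewrite -!big_split /=; apply: eq_bigr => i _; rewrite -!big_split /=.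
apply: eq_bigr => j _; rewrite -!mulnDl; congr (_ * _).
rewrite /list_adj !in_cons !xpair_eqE.
case: (eqVneq i a) => [->|ia]; case: (eqVneq j b) => [->|jb] /=.
all: rewrite ?(ltn_eqF ab) ?(gtn_eqF ab) ?(negbTE nE) ?(negbTE nE') //=.
all: rewrite ?andbF ?orbF //=.
case: (eqVneq i b) => [->|ib]; case: (eqVneq j a) => [->|ja] //=.
all: by rewrite ?(ltn_eqF ab) ?(gtn_eqF ab) ?(negbTE nE) ?(negbTE nE').
Qed.

(** * What the tables record about a graph *)

Definition common (L : seq (nat * nat)) (u v : nat) : nat :=
  \sum_(x <- out L v | x \in out L u) 1.

Definition block_sum (F : nat -> nat -> nat) (b : block) : nat :=
  \sum_(0 <= u < b.1.2) \sum_(0 <= v < b.2.2) F (b.1.1 + u) (b.2.1 + v).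

Definition block_pos (b : block) : bool := (0 < b.1.2) && (0 < b.2.2).

(* What processing a graph [e] on the vertices [off], ..., [off + n - 1] adds
   to the tables: the blocks enumerate the edges, the arcs lead to the vertices
   added by [Inc], and [T] counts the triangles without an [Inc] vertex as
   the last vertex. *)
Record trace (k off n : nat) (e : rel nat) (T : nat) (bl : seq block)
    (L : seq (nat * nat)) : Prop := Trace {
  tr_blocks F : (forall u v, F u v = F v u) ->
    \sum_(0 <= u < n) \sum_(0 <= v < n) e u v * F (off + u) (off + v) =
    2 * \sum_(b <- bl) block_sum F b;
  tr_tri : T + 3 * \sum_(0 <= u < n) \sum_(0 <= v < n)
      e u v * common L (off + u) (off + v) = tri_sum n e;
  tr_arcs u x : (u, x) \in L -> (off <= u < x) && (x < off + n);
  tr_out u : size (out L u) <= k;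
  tr_uniq u : uniq (out L u);
  tr_pos : all block_pos bl }.

Lemma out_cat L1 L2 u : out (L1 ++ L2) u = out L2 u ++ out L1 u.
Proof. by rewrite /out rev_cat filter_cat map_cat. Qed.

Lemma out_nil L u : (forall x, (u, x) \notin L) -> out L u = [::].
Proof.
move=> h; case e: (out L u) => [//|x l].
by have := h x; rewrite -mem_out e mem_head.
Qed.

Lemma commonC L u v : uniq (out L u) -> uniq (out L v) ->
  common L u v = common L v u.
Proof.
move=> uu uv; rewrite /common -[LHS]big_filter -[RHS]big_filter; apply: perm_big.
apply: uniq_perm.
- exact: filter_uniq.
- exact: filter_uniq.
by move=> x; rewrite !mem_filter andbC.
Qed.

Lemma common0 L u v : (forall x, (u, x) \in L -> (v, x) \notin L) -> common L u v = 0.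
Proof.
move=> h; rewrite /common big_seq_cond big1 // => x /andP[].
by rewrite !mem_out => vx /h; rewrite vx.
Qed.

Lemma trace_empty k off e : trace k off 0 e 0 [::] [::].
Proof. by split=> [F _||//|u|u|//]; rewrite /tri_sum ?big_nil ?big_geq. Qed.

Lemma trace_vertex k off : trace k off 1 (fun _ _ => false) 0 [::] [::].
Proof. by split=> [F _||//|u|u|//]; rewrite /tri_sum ?big_nil ?big_nat1. Qed.

Section Inc.

Variables (k off n : nat) (e : rel nat) (T : nat) (bl : seq block).
Variables (L : seq (nat * nat)) (N : seq nat).
Hypothesis tr : trace k off n e T bl L.
Hypothesis wfN : wf_nbrs n N.

Let e' : rel nat := fun u v =>
  if u == n then (v != u) && (v \in N) else if v == n then u \in N else e u v.

Lemma out_new u : u < n.+1 ->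
  out [seq (off + v, off + n) | v <- N] (off + u) =
  if u \in N then [:: off + n] else [::].
Proof.
move=> un; case/andP: wfN => uN _.
have e0 : forall l : seq nat, out [seq (off + v, off + n) | v <- l] (off + u) =
   nseq (count_mem u l) (off + n).
  elim/last_ind => // l v IH; rewrite map_rcons out_rcons IH -cats1 count_cat /=.
  by rewrite eqn_add2l addn0; case: eqP => _; rewrite ?addn0 ?addn1.
by rewrite e0 count_uniq_mem //; case: (u \in N).
Qed.

Lemma out_last : out L (off + n) = [::].
Proof.
by apply: out_nil => x; apply/negP => /(tr_arcs tr); lia.
Qed.

Lemma new_notin u : off + n \in out L u = false.
Proof.
by rewrite mem_out; apply/negP => /(tr_arcs tr); lia.
Qed.

Lemma common_inc u v : u < n.+1 -> v < n.+1 ->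
  common (L ++ [seq (off + u, off + n) | u <- N]) (off + u) (off + v) =
  common L (off + u) (off + v) + (u \in N) * (v \in N).
Proof.
move=> un vn; rewrite /common !out_cat !out_new //.
case uN: (u \in N); case vN: (v \in N); rewrite /= ?addn0 ?muln0 //.
- rewrite big_cons mem_head addnC; congr (_ + _).
  rewrite big_seq_cond [RHS]big_seq_cond; apply: eq_bigl => x.
  case xv: (x \in out L (off + v)) => //=; rewrite in_cons.
  by case: eqP => // ex; rewrite ex new_notin in xv.
- rewrite big_seq_cond [RHS]big_seq_cond; apply: eq_bigl => x.
  case xv: (x \in out L (off + v)) => //=; rewrite in_cons.
  by case: eqP => // ex; rewrite ex new_notin in xv.
- by rewrite big_cons new_notin.
Qed.

Lemma out_one u : out [seq (off + v, off + n) | v <- N] u =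
  if (off <= u < off + n.+1) && (u - off \in N) then [:: off + n] else [::].
Proof.
have ltN : forall u, u \in N -> u < n by case/andP: wfN => _ /allP.
have [offu|offu] := leqP off u; last first.
  by rewrite out_nil // => x; apply/negP => /mapP[v _ [eu _]]; lia.
have [un|un] := ltnP u (off + n.+1); last first.
  by rewrite out_nil // => x; apply/negP => /mapP[v /ltN vn [eu _]]; lia.
by rewrite -{1}(subnKC offu) out_new //; lia.
Qed.

(** The count [T] does not change: every new triangle has the new vertex last, and it shows up as
    one more common later neighbour of an edge with both ends in [N]. Each list of later neighbours
    grows by at most one, whence [k.+1]. *)
Lemma trace_inc :
  trace k.+1 off n.+1 e' T
    (bl ++ [seq ((off + u, 1), (off + n, 1)) | u <- N])
    (L ++ [seq (off + u, off + n) | u <- N]).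
Proof.
have ltN : forall u, u \in N -> u < n by case/andP: wfN => _ /allP.
have nN : n \in N = false by apply/negP => /ltN; rewrite ltnn.
have e1 u v : u < n -> v < n -> e' u v = e u v.
  by move=> un vn; rewrite /e' !ltn_eqF.
have e2 u : u < n -> e' u n = (u \in N) by move=> un; rewrite /e' ltn_eqF // eqxx.
have e3 u : u < n -> e' n u = (u \in N).
  by move=> un; rewrite /e' eqxx ltn_eqF.
have e4 : e' n n = false by rewrite /e' !eqxx.
have sumE (F : nat -> nat -> nat) :
    \sum_(0 <= u < n.+1) \sum_(0 <= v < n.+1) e' u v * F u v =
    \sum_(0 <= u < n) \sum_(0 <= v < n) e u v * F u v +
    \sum_(0 <= u < n) (u \in N) * (F u n + F n u).
  rewrite sum2_recr e4 mul0n addn0; congr (_ + _).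
    apply: eq_big_nat => u /= un; apply: eq_big_nat => v /= vn.
    by rewrite e1.
  by apply: eq_big_nat => u /= un; rewrite e2 // e3 // mulnDr.
split.
- move=> F Fsym; rewrite (sumE (fun u v => F (off + u) (off + v))).
  rewrite (tr_blocks tr) // sum_mem // big_cat big_map mulnDr; congr (_ + _).
  rewrite big_distrr /=; apply: eq_bigr => u _.
  by rewrite /block_sum /= !big_nat1 !addn0 Fsym; lia.
- rewrite (sumE (fun u v => common _ (off + u) (off + v))).
  rewrite (eq_big_nat _ _ (F2 := fun u => \sum_(0 <= v < n)
    (e u v * common L (off + u) (off + v) + e u v * ((u \in N) * (v \in N))))).
    2: { move=> u /= un; apply: eq_big_nat => v /= vn.
         by rewrite common_inc ?mulnDr // ltnW. }
  under eq_bigr => u _ do rewrite big_split.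
  (* The edges at the new vertex contribute nothing, because that vertex has no later neighbours. *)
  rewrite big_split /= [X in _ + _ + X]big1_seq ?addn0; last first.
    move=> u; rewrite mem_index_iota /= => un; rewrite !common_inc ?leqnn //; try lia.
    have nolast x : (off + n, x) \notin L by rewrite -mem_out out_last.
    rewrite nN !muln0 !mul0n !addn0 !common0 ?muln0 // => x.
      by rewrite (negbTE (nolast x)).
  rewrite mulnDr addnA (tr_tri tr) /tri_sum sum3_recr e4 !muln0 !addn0.
  rewrite [X in _ = _ + _ + X]big1_seq ?addn0; last first.
    by move=> u _; rewrite !muln0 !mul0n ?muln0.
  congr (_ + _).
    apply: eq_big_nat => u /= un; apply: eq_big_nat => v /= vn.
    by apply: eq_big_nat => x /= xn; rewrite !e1.
  rewrite big_distrr /=; apply: eq_big_nat => u /= un.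
  rewrite big_distrr /=; apply: eq_big_nat => v /= vn.
  rewrite (e1 _ _ un vn) (e2 _ un) (e2 _ vn) (e3 _ un) (e3 _ vn).
  by case: (e u v); case: (u \in N); case: (v \in N).
- move=> u x; rewrite mem_cat => /orP[/(tr_arcs tr)|]; first by lia.
  by case/mapP => v /ltN vn [-> ->]; lia.
- by move=> u; rewrite out_cat size_cat -addn1 addnC leq_add ?(tr_out tr) // out_one;
    case: ifP.
- move=> u; rewrite out_cat cat_uniq (tr_uniq tr) andbT out_one; case: ifP => _ /=; last by apply/hasPn.
  apply/hasPn => x xu; rewrite inE.
  by apply/eqP => ex; rewrite ex new_notin in xu.
- by rewrite all_cat (tr_pos tr) all_map; apply/allP.
Qed.

End Inc.

(** * Arguments placed side by side *)

Section Lists.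

Implicit Types (l : seq (nat * rel nat)) (L : seq (nat * nat)).

Definition orders l : seq nat := map fst l.
Definition graphs l : seq (rel nat) := map snd l.

Local Notation ord_ l i := (nth 0 (orders l) i).
Local Notation off_ l i := (sumn (take i (orders l))).
Local Notation adj_ l i := (nth (fun _ _ => false) (graphs l) i).

(** The analogue of [trace] for arguments laid out consecutively, before any edge between them
    exists. Field [tl_part] keeps arcs inside their argument, which [common_parts] needs. *)
Record trace_list (k off : nat) l (T : nat) (bl : seq block) L : Prop :=
  TraceList {
  tl_blocks F : (forall u v, F u v = F v u) ->
    \sum_(0 <= i < size l) \sum_(0 <= u < ord_ l i) \sum_(0 <= v < ord_ l i)
       adj_ l i u v * F (off + (off_ l i + u)) (off + (off_ l i + v)) =
    2 * \sum_(b <- bl) block_sum F b;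
  tl_tri :
    T + 3 * \sum_(0 <= i < size l) \sum_(0 <= u < ord_ l i)
      \sum_(0 <= v < ord_ l i)
       adj_ l i u v * common L (off + (off_ l i + u)) (off + (off_ l i + v)) =
    \sum_(0 <= i < size l) tri_sum (ord_ l i) (adj_ l i);
  tl_arcs u x : (u, x) \in L -> (off <= u < x) && (x < off + sumn (orders l));
  tl_part i u x : i < size l -> u < ord_ l i ->
    (off + (off_ l i + u), x) \in L -> x < off + (off_ l i + ord_ l i);
  tl_out u : size (out L u) <= k;
  tl_uniq u : uniq (out L u);
  tl_pos : all block_pos bl }.

Lemma trace_nil k off : trace_list k off [::] 0 [::] [::].
Proof. by split=> [F _||//|//|u|u|//]; rewrite ?big_nil ?big_geq. Qed.

Lemma common_ext L L' u v :
  out L u = out L' u -> out L v = out L' v -> common L u v = common L' u v.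
Proof. by rewrite /common => -> ->. Qed.

Lemma trace_cons k off n e l T T' bl bl' L L' :
  trace k off n e T bl L -> trace_list k (off + n) l T' bl' L' ->
  trace_list k off ((n, e) :: l) (T + T') (bl ++ bl') (L ++ L').
Proof.
move=> tr trl.
have addE i u : off + (n + off_ l i + u) = off + n + (off_ l i + u) by lia.
have outL u : u < off + n -> out (L ++ L') u = out L u.
  move=> un; rewrite out_cat [out L' u]out_nil // => x.
  by apply/negP => /(tl_arcs trl); lia.
have outL' u : off + n <= u -> out (L ++ L') u = out L' u.
  move=> un; rewrite out_cat [out L u]out_nil ?cats0 // => x.
  by apply/negP => /(tr_arcs tr); lia.
split.
- move=> F Fsym; rewrite /= big_nat_recl // big_cat mulnDr -(tr_blocks tr) //.
  rewrite -(tl_blocks trl) //; congr (_ + _) => /=.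
  apply: eq_bigr => i _; apply: eq_bigr => u _; apply: eq_bigr => v _.
  by rewrite !addE.
- rewrite /= !big_nat_recl //= -(tr_tri tr) -(tl_tri trl).
  rewrite [X in 3 * (X + _)](_ : _ = \sum_(0 <= u < n) \sum_(0 <= v < n)
     e u v * common L (off + u) (off + v)); last first.
    apply: eq_big_nat => u /= un; apply: eq_big_nat => v /= vn.
    by congr (_ * _); apply: common_ext; apply: outL; lia.
  rewrite [X in 3 * (_ + X)](_ : _ = \sum_(0 <= i < size l)
    \sum_(0 <= u < ord_ l i) \sum_(0 <= v < ord_ l i)
       adj_ l i u v * common L' (off + n + (off_ l i + u))
         (off + n + (off_ l i + v))); first by lia.
  apply: eq_bigr => i _; apply: eq_bigr => u _; apply: eq_bigr => v _.
  by rewrite !addE; congr (_ * _); apply: common_ext; apply: outL'; lia.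
- move=> u x; rewrite mem_cat /= => /orP[/(tr_arcs tr)|/(tl_arcs trl)]; lia.
- move=> [|i] u x /=; rewrite mem_cat ?add0n.
    move=> _ un /orP[/(tr_arcs tr)|/(tl_arcs trl)]; lia.
  rewrite ltnS addE => il un /orP[/(tr_arcs tr)|]; first by lia.
  by move/(tl_part trl il un); lia.
- move=> u; case: (ltnP u (off + n)) => un; first by rewrite outL // (tr_out tr).
  by rewrite outL' // (tl_out trl).
- move=> u; case: (ltnP u (off + n)) => un; first by rewrite outL // (tr_uniq tr).
  by rewrite outL' // (tl_uniq trl).
- by rewrite all_cat (tr_pos tr) (tl_pos trl).
Qed.

Section Subst.

Variables (k off : nat) (l : seq (nat * rel nat)) (T : nat) (bl bl2 : seq block).
Variables (L : seq (nat * nat)) (H : rel nat).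
Hypothesis Hsym : forall i j, H i j = H j i.
Hypothesis trl : trace_list k off l T bl L.

Local Notation h i j := ((i != j) && H i j).

Hypothesis cross : forall F, (forall u v, F u v = F v u) ->
  \sum_(0 <= i < size l) \sum_(0 <= j < size l) h i j *
    \sum_(0 <= u < ord_ l i) \sum_(0 <= v < ord_ l j)
      F (off + (off_ l i + u)) (off + (off_ l j + v)) =
  2 * \sum_(b <- bl2) block_sum F b.
Hypothesis pos2 : all block_pos bl2.

Lemma off_lt i j : i < j -> j < size l -> off_ l i + ord_ l i <= off_ l j.
Proof.
move=> ij jl; rewrite -sumn_rcons -take_nth ?size_map; last by lia.
rewrite -(cat_take_drop i.+1 (take j (orders l))) sumn_cat take_takel //.
exact: leq_addr.
Qed.

(** A common later neighbour would precede the end of the earlier argument and yet follow a vertex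
    of the later one. *)
Lemma common_parts i j u v : i < size l -> j < size l -> i != j ->
  u < ord_ l i -> v < ord_ l j ->
  common L (off + (off_ l i + u)) (off + (off_ l j + v)) = 0.
Proof.
move=> il jl ij un vn; apply: common0 => x ux; apply/negP => vx.
have hu := tl_part trl il un ux; have hv := tl_part trl jl vn vx.
have := tl_arcs trl ux; have := tl_arcs trl vx.
by case: (ltngtP i j) ij => // ij _; have := off_lt ij; lia.
Qed.

(** Substitution creates no arcs, and the ends of a cross edge have no common later neighbour. All
    triangles with vertices in several arguments therefore have to enter the count at once. *)
Lemma trace_subst :
  trace k off (sumn (orders l)) (subst_adj H (orders l) (graphs l))
    (T + 3 * \sum_(0 <= i < size l) \sum_(0 <= j < size l)
         h i j * (deg_sum (ord_ l i) (adj_ l i) * ord_ l j) +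
     tri_parts H (orders l) (fun i => ord_ l i)) (bl ++ bl2) L.
Proof.
have szl : size (orders l) = size l by rewrite size_map.
have trib := subst_sum2 H (orders l) (graphs l).
split.
- move=> F Fsym; rewrite (trib (fun u v => F (off + u) (off + v))) szl.
  by rewrite big_cat mulnDr -(tl_blocks trl) // -cross.
- rewrite (trib (fun u v => common L (off + u) (off + v))) szl.
  rewrite [X in _ + 3 * (_ + X)]big1_seq ?addn0; last first.
    move=> i; rewrite mem_index_iota => /= il.
    apply: big1_seq => j; rewrite mem_index_iota => /= jl.
    case: eqVneq => [//|ij] /=; rewrite [X in _ * X]big1_seq ?muln0 // => u.
    rewrite mem_index_iota => /= un.
    apply: big1_seq => v; rewrite mem_index_iota => /= vn.
    exact: common_parts.
  by rewrite tri_sum_subst // szl -(tl_tri trl); lia.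
- by move=> u x /(tl_arcs trl).
- exact: (tl_out trl).
- exact: (tl_uniq trl).
- by rewrite all_cat (tl_pos trl) pos2.
Qed.

End Subst.

End Lists.

(** * The parts of a substitution *)

Fixpoint parts (off : nat) (l : seq (nat * rel nat)) : seq part :=
  if l is a :: l' then
    Part off a.1 (deg_sum a.1 a.2) :: parts (off + a.1) l'
  else [::].

Lemma size_parts off l : size (parts off l) = size l.
Proof. by elim: l off => //= a l IH off; rewrite IH. Qed.

Lemma nth_parts off l i : i < size l ->
  nth part0 (parts off l) i = Part (off + sumn (take i (orders l)))
    (nth 0 (orders l) i)
    (deg_sum (nth 0 (orders l) i) (nth (fun _ _ => false) (graphs l) i)).
Proof.
elim: l off i => // a l IH off [|i] /= il; first by rewrite addn0.
by rewrite IH // addnA.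
Qed.

Lemma map_order_parts off l : map order (parts off l) = orders l.
Proof. by elim: l off => //= a l IH off; rewrite IH. Qed.

Section Edges.

Variables (off : nat) (l : seq (nat * rel nat)) (E : seq (nat * nat)).
Hypothesis wfE : wf_edges (size l) E.

Local Notation ps := (parts off l).
Local Notation n_ i := (nth 0 (orders l) i).
Local Notation o_ i := (sumn (take i (orders l))).
Local Notation D_ i := (deg_sum (n_ i) (nth (fun _ _ => false) (graphs l) i)).
Local Notation h i j := ((i != j) && list_adj E i j).

Lemma list_adj_sym i j : list_adj E i j = list_adj E j i.
Proof. by rewrite /list_adj orbC. Qed.

Lemma edge_bound q : q \in E -> (q.1 < q.2) && (q.2 < size l).
Proof. by case/andP: wfE => _ /allP; apply. Qed.

Lemma edges_cross F : (forall u v, F u v = F v u) ->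
  \sum_(0 <= i < size l) \sum_(0 <= j < size l) h i j *
    \sum_(0 <= u < n_ i) \sum_(0 <= v < n_ j) F (off + (o_ i + u)) (off + (o_ j + v)) =
  2 * \sum_(b <- [seq part_block (nth part0 ps q.1) (nth part0 ps q.2) | q <- E])
    block_sum F b.
Proof.
move=> Fsym; rewrite (sum_list_adj _ wfE) big_map big_distrr /=.
rewrite big_seq [RHS]big_seq; apply: eq_bigr => q /edge_bound /andP[q12 q2].
have q1 := ltn_trans q12 q2; rewrite !nth_parts //.
rewrite /block_sum /= mul2n -addnn; congr (_ + _).
  by apply: eq_bigr => u _; apply: eq_bigr => v _; rewrite !addnA.
rewrite exchange_big_nat /=; apply: eq_bigr => u _; apply: eq_bigr => v _.
by rewrite Fsym !addnA.
Qed.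

Lemma sum_tri_edges :
  \sum_(q <- E) part_tri (nth part0 ps q.1) (nth part0 ps q.2) =
  3 * \sum_(0 <= i < size l) \sum_(0 <= j < size l) h i j * (D_ i * n_ j).
Proof.
rewrite (sum_list_adj (fun i j => D_ i * n_ j) wfE) big_distrr /=.
rewrite big_seq [RHS]big_seq; apply: eq_bigr => q /edge_bound /andP[q12 q2].
have q1 := ltn_trans q12 q2; rewrite !nth_parts // /part_tri /=; lia.
Qed.

Lemma sum_deg_edges :
  \sum_(q <- E) 2 * (order (nth part0 ps q.1) * order (nth part0 ps q.2)) =
  \sum_(0 <= i < size l) \sum_(0 <= j < size l) h i j * (n_ i * n_ j).
Proof.
rewrite (sum_list_adj (fun i j => n_ i * n_ j) wfE).
rewrite big_seq [RHS]big_seq; apply: eq_bigr => q /edge_bound /andP[q12 q2].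
have q1 := ltn_trans q12 q2; rewrite !nth_parts //=; lia.
Qed.

End Edges.

(** * Triples of vertices of the quotient *)

Definition sum3 (t : nat) (f : nat -> nat -> nat -> nat) : nat :=
  \sum_(0 <= i < t) \sum_(0 <= j < t) \sum_(0 <= k < t) f i j k.

Lemma eq_sum3 t f g : (forall i j k, f i j k = g i j k) -> sum3 t f = sum3 t g.
Proof.
by move=> fg; do 3 (apply: eq_bigr => ? _); rewrite fg.
Qed.

Lemma sum3_swap12 t f : sum3 t f = sum3 t (fun i j k => f j i k).
Proof. exact: exchange_big_nat. Qed.

Lemma sum3_swap23 t f : sum3 t f = sum3 t (fun i j k => f i k j).
Proof. by apply: eq_bigr => i _; exact: exchange_big_nat. Qed.

Lemma sum3D t f g : sum3 t (fun i j k => f i j k + g i j k) = sum3 t f + sum3 t g.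
Proof.
rewrite /sum3 -big_split; apply: eq_bigr => i _; rewrite -big_split.
by apply: eq_bigr => j _; rewrite -big_split.
Qed.

Section Edges.

Variables (t : nat) (E : seq (nat * nat)) (n : nat -> nat).
Hypothesis wfE : wf_edges t E.

Local Notation h i j := ((i != j) && list_adj E i j).
Local Notation e i j := ((i, j) \in E).

Lemma edge_lt2 i j : e i j -> i < j < t.
Proof. by case/andP: wfE => _ /allP h /h. Qed.

Lemma adj_edges i j : h i j = e i j + e j i :> nat.
Proof.
rewrite /list_adj; case eij: (e i j); case eji: (e j i); rewrite ?andbF ?andbT //=.
- by have := edge_lt2 eij; have := edge_lt2 eji; lia.
- by have := edge_lt2 eij; case: eqP => //; lia.
- by have := edge_lt2 eji; case: eqP => //; lia.
Qed.

Lemma sum3_mx : sum3 t (fun i j k => h i j * h j k * h i k * (n i * n j * n k)) =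
  tri_mx E t n.
Proof.
transitivity (\sum_(0 <= i < t) \sum_(0 <= j < t) h i j *
    \sum_(0 <= k < t) h i k * n k * h k j * (n i * n j)).
  apply: eq_bigr => i _; apply: eq_bigr => j _; rewrite big_distrr /=.
  apply: eq_bigr => k _; rewrite [h j k](_ : _ = h k j); first by lia.
  by rewrite eq_sym /list_adj orbC.
rewrite (sum_list_adj _ wfE); apply: eq_bigr => q _.
rewrite mul2n -addnn -(big_mkord xpredT (fun k => list_adj E q.1 k * n k *
  list_adj E k q.2)).
have hl i j : h i j = list_adj E i j.
  by case: eqP => // ->; rewrite /list_adj orbb; case e: (_ \in _) => //;
    have := edge_lt2 e; rewrite ltnn.
congr (_ + _); rewrite big_distrl /=; apply: eq_bigr => k _; rewrite !hl //.
rewrite (_ : list_adj E q.2 k = list_adj E k q.2); last by rewrite /list_adj orbC.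
rewrite (_ : list_adj E k q.1 = list_adj E q.1 k); last by rewrite /list_adj orbC.
lia.
Qed.

Lemma out_uniq u : uniq (out E u).
Proof.
case/andP: wfE => uE _; rewrite map_inj_in_uniq ?filter_uniq ?rev_uniq //.
move=> [a x] [b y]; rewrite !mem_filter /= => /andP[/eqP -> _] /andP[/eqP -> _].
by move=> /= ->.
Qed.

Lemma sum_edges (f : nat -> nat -> nat) :
  \sum_(q <- E) f q.1 q.2 =
  \sum_(0 <= i < t) \sum_(0 <= j < t) e i j * f i j.
Proof.
(* Masking [f] by the order of its arguments makes [sum_list_adj] keep one orientation of each
   edge. *)
transitivity (\sum_(q <- E) ((q.1 < q.2) * f q.1 q.2 + (q.2 < q.1) * f q.2 q.1)).
  rewrite big_seq [RHS]big_seq; apply: eq_bigr => -[a b] /edge_lt2 /andP[ab _] /=.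
  by rewrite ab ltnNge (ltnW ab) mul1n addn0.
rewrite -(sum_list_adj (fun i j => (i < j) * f i j) wfE).
apply: eq_bigr => i _; apply: eq_bigr => j _; rewrite mulnA adj_edges.
congr (_ * _); case eij: (e i j); case eji: (e j i) => //=.
- by have := edge_lt2 eij; have := edge_lt2 eji; lia.
- by have := edge_lt2 eij; lia.
- by have := edge_lt2 eji; lia.
Qed.

(** [F] detects a triangle whose vertices come in increasing order. Exactly one of the six
    permutations sorts a given triangle, so the symmetric summand is the sum of the six permuted
    copies of [F]. *)
Lemma sum3_out : sum3 t (fun i j k => h i j * h j k * h i k * (n i * n j * n k)) =
  tri_out E n.
Proof.
pose g i j k := n i * n j * n k.
pose F i j k := e i j * e j k * e i k * g i j k.
have -> : tri_out E n = 6 * sum3 t F.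
  rewrite /tri_out -big_distrr /=; congr (_ * _).
  transitivity (\sum_(q <- E) \sum_(0 <= k < t)
      e q.2 k * (e q.1 k * g q.1 q.2 k)); last first.
    rewrite (sum_edges (fun i j => \sum_(0 <= k < t) e j k * (e i k * g i j k))).
    apply: eq_bigr => i _; apply: eq_bigr => j _; rewrite big_distrr /=.
    by apply: eq_bigr => k _; rewrite /F !mulnA.
  apply: eq_bigr => q _; rewrite big_mkcond big_distrl /=.
  rewrite (eq_bigr (fun x => e q.1 x * g q.1 q.2 x)); last first.
    move=> x _; rewrite mem_out /g; case: (e q.1 x) => /=; lia.
  rewrite -(@sum_mem t (out E q.2) (fun x => e q.1 x * g q.1 q.2 x)).
    by apply: eq_bigr => k _; rewrite mem_out.
  rewrite /wf_nbrs out_uniq; apply/allP => x; rewrite mem_out.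
  by move=> /edge_lt2 /andP[].
set S := sum3 t F.
have S1 : sum3 t (fun i j k => F i k j) = S by rewrite sum3_swap23.
have S2 : sum3 t (fun i j k => F j i k) = S by rewrite sum3_swap12.
have S3 : sum3 t (fun i j k => F j k i) = S by rewrite sum3_swap12 sum3_swap23.
have S4 : sum3 t (fun i j k => F k j i) = S by rewrite sum3_swap23 S3.
have S5 : sum3 t (fun i j k => F k i j) = S by rewrite sum3_swap12 S4.
transitivity (sum3 t (fun i j k => F i j k + F i k j + F j i k + F j k i +
    F k j i + F k i j)); last by rewrite !sum3D S1 S2 S3 S4 S5 -/S; lia.
apply: eq_sum3 => i j k; rewrite !adj_edges /F.
have -> : g i k j = g i j k by rewrite /g; lia.
have -> : g j i k = g i j k by rewrite /g; lia.
have -> : g j k i = g i j k by rewrite /g; lia.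
have -> : g k j i = g i j k by rewrite /g; lia.
have -> : g k i j = g i j k by rewrite /g; lia.
rewrite -/(g i j k).
(* Edges lead from smaller to larger vertices, so neither of the two cyclic orientations of a
   triangle occurs. *)
have z1 : ~~ [&& e i j, e j k & e k i].
  by apply/negP => /and3P[/edge_lt2 h1 /edge_lt2 h2 /edge_lt2 h3]; lia.
have z2 : ~~ [&& e j i, e k j & e i k].
  by apply/negP => /and3P[/edge_lt2 h1 /edge_lt2 h2 /edge_lt2 h3]; lia.
move: z1 z2 (g i j k); case: (e i j); case: (e j k); case: (e k i);
  case: (e j i); case: (e k j); case: (e i k) => //= _ _ G; lia.
Qed.

End Edges.

Lemma sum1_recr n (f : nat -> nat) :
  \sum_(0 <= i < n.+1) f i = \sum_(0 <= i < n) f i + f n.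
Proof. by rewrite big_nat_recr. Qed.

Lemma sum_orders (sh : seq nat) m : m <= size sh ->
  sumn (take m sh) = \sum_(0 <= i < m) nth 0 sh i.
Proof.
elim: m => [|m IH] msh; first by rewrite take0 big_geq.
by rewrite (take_nth 0) // sumn_rcons big_nat_recr //= IH // ltnW.
Qed.

(** * A join as a fold of binary joins *)

Section Join.

Variables (off : nat) (a : nat * rel nat) (l : seq (nat * rel nat)).

Local Notation l' := (a :: l).
Local Notation p0 := (Part off a.1 (deg_sum a.1 a.2)).
Local Notation bs := (parts (off + a.1) l).
Local Notation n_ i := (nth 0 (orders l') i).
Local Notation o_ i := (sumn (take i (orders l'))).
Local Notation D_ i := (deg_sum (n_ i) (nth (fun _ _ => false) (graphs l') i)).

(** The degree sum of the prefix [P] already includes the edges added by the earlier joins. Hence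
    the next [part_tri] accounts for triangles across three arguments as well as those across two,
    and no separate count is needed. *)
Lemma merge_prefix m : m < size l' ->
  let P := foldl (merge_part true) p0 (take m bs) in
  [/\ order P = o_ m.+1,
      degsum P = \sum_(0 <= i < m.+1) D_ i +
        \sum_(0 <= i < m.+1) \sum_(0 <= j < m.+1) (i != j) * (n_ i * n_ j),
      merge_tri true p0 (take m bs) =
        3 * \sum_(0 <= i < m.+1) \sum_(0 <= j < m.+1) (i != j) * (D_ i * n_ j) +
        sum3 m.+1 (fun i j k => (i != j) * (j != k) * (i != k) * (n_ i * n_ j * n_ k))
    & forall F, (forall u v, F u v = F v u) ->
      \sum_(0 <= i < m.+1) \sum_(0 <= j < m.+1) (i != j) *
        \sum_(0 <= u < n_ i) \sum_(0 <= v < n_ j)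
          F (off + (o_ i + u)) (off + (o_ j + v)) =
      2 * \sum_(b <- merge_blocks true p0 (take m bs)) block_sum F b].
Proof.
elim: m => [|m IH] ml.
  rewrite take0 /=; split; rewrite /sum3 ?big_nat1 ?eqxx ?mul0n ?take0 /= ?addn0 //.
  by move=> F _; rewrite !big_nat1 eqxx mul0n big_nil muln0.
have ml0 : m < size l' by exact: ltnW.
have {IH} := IH ml0; set P := foldl _ _ _ => -[oP dP tP bP].
have mbs : m < size bs by rewrite size_parts.
have nb : nth part0 bs m = Part (off + o_ m.+1) (n_ m.+1) (D_ m.+1).
  by have := nth_parts off ml.
have o_S : o_ m.+2 = o_ m.+1 + n_ m.+1.
  by rewrite (take_nth 0) ?size_map // sumn_rcons.
have neq i : i < m.+1 -> (i != m.+1) = true /\ (m.+1 != i) = true.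
  by move=> im; rewrite !neq_ltn im orbT.
rewrite (take_nth part0) // foldl_rcons -/P nb; split.
- by rewrite o_S -oP.
- rewrite [LHS](_ : _ = degsum P + D_ m.+1 + 2 * (order P * n_ m.+1)); last first.
    by rewrite -(mul1n (2 * _)).
  rewrite dP oP [in RHS]sum1_recr [in RHS]sum2_recr eqxx mul0n addn0.
  rewrite [X in _ = _ + (_ + X)](_ : _ = 2 * (o_ m.+1 * n_ m.+1)); first by lia.
  rewrite sum_orders ?size_map // big_distrl big_distrr; apply: eq_big_nat => i /= /neq[-> ->].
  by rewrite /= !mul1n; lia.
- rewrite merge_tri_rcons -/P tP mul1n.
  rewrite -[part_tri _ _]/(3 * (degsum P * n_ m.+1 + D_ m.+1 * order P)).
  rewrite [in RHS]sum2_recr eqxx mul0n addn0 /sum3 [in RHS]sum3_recr eqxx !mul0n !addn0.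
  rewrite [X in _ = 3 * (_ + X) + _](_ : _ =
    (\sum_(0 <= i < m.+1) D_ i) * n_ m.+1 + D_ m.+1 * o_ m.+1); last first.
    rewrite sum_orders ?size_map // big_distrl big_distrr -big_split.
    by apply: eq_big_nat => i /= /neq[-> ->]; rewrite !mul1n.
  rewrite [X in _ = _ + (_ + X)]big1_seq ?addn0; last first.
    by move=> i _; rewrite !muln0 !mul0n.
  rewrite [X in _ = _ + (_ + X)](_ : _ = 3 * ((\sum_(0 <= i < m.+1)
    \sum_(0 <= j < m.+1) (i != j) * (n_ i * n_ j)) * n_ m.+1)).
    by rewrite dP oP; lia.
  rewrite big_distrl big_distrr; apply: eq_big_nat => i /= /neq[ni1 ni2].
  rewrite big_distrl big_distrr; apply: eq_big_nat => j /= /neq[nj1 nj2].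
  by rewrite ni1 ni2 nj1 nj2 !mul1n !muln1; lia.
- move=> F Fsym; rewrite merge_blocks_rcons -/P big_cat big_seq1 mulnDr -bP //.
  have fP : first P = off by rewrite /P first_merge.
  rewrite -[block_sum _ _]/(\sum_(0 <= u < order P) \sum_(0 <= v < n_ m.+1)
    F (first P + u) (off + o_ m.+1 + v)) oP fP.
  rewrite sum2_recr eqxx mul0n addn0; congr (_ + _).
  rewrite sum_offsets size_take size_map ml big_distrr.
  apply: eq_big_nat => i /andP[_ im]; have [-> ->] := neq _ im.
  rewrite !mul1n nth_take // take_takel; last exact: ltnW.
  rewrite -[RHS]/(2 * _) mul2n -addnn; congr (_ + _); last rewrite exchange_big_nat /=.
    by apply: eq_bigr => u _; apply: eq_bigr => v _; rewrite !addnA.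
  by apply: eq_bigr => u _; apply: eq_bigr => v _; rewrite Fsym !addnA.
Qed.

End Join.

(** * Induction on expressions and later neighbours *)

Fixpoint each (P : expr -> Prop) (es : seq expr) : Prop :=
  if es is e :: es' then P e /\ each P es' else True.

(** Arguments are nested inside [seq] and [option], so their induction hypotheses have to be
    supplied by an explicit fixpoint. *)
Lemma expr_nested_ind (P : expr -> Prop) :
  P Empty -> P Vertex ->
  (forall es, each P es -> P (Union es)) ->
  (forall es, each P es -> P (Join es)) ->
  (forall N b, P b -> P (Inc N b)) ->
  (forall E d es, (if d is Some b then P b else True) -> each P es ->
     P (Subst E d es)) ->
  forall a, P a.
Proof.
move=> h0 h1 hU hJ hI hS; fix IH 1.
case=> [||es|es|N b|E [b|] es].
- exact: h0.
- exact: h1.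
- by apply: hU; elim: es => //= e es IHes; split.
- by apply: hJ; elim: es => //= e es IHes; split.
- exact: hI (IH b).
- apply: hS; first exact: IH.
  by elim: es => //= e es IHes; split.
- apply: hS => //.
  by elim: es => //= e es IHes; split.
Qed.

Lemma each_mem P es i : each P es -> i < size es -> P (nth Empty es i).
Proof. by elim: es i => //= e es IH [|i] [Pe Pes] //=; exact: IH. Qed.

Definition later (a : expr) (u : nat) : nat :=
  \sum_(0 <= x < nverts a) (u < x) * eadj a u x.

Lemma offset_ex sh u : u < sumn sh ->
  exists i v, [/\ i < size sh, v < nth 0 sh i & u = sumn (take i sh) + v].
Proof.
elim: sh u => //= n sh IH u; case: (ltnP u n) => un us.
  by exists 0, u.
have [|i [v [ish vn e]]] := IH (u - n); first by lia.
by exists i.+1, v; split => //=; lia.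
Qed.

(** In creation order, a later neighbour of [u] is added by an [Inc] above [u] in the tree, and each
    such [Inc] adds at most one; unions add no edges. *)
Lemma later_le a u : wf_td a -> later a u <= inc_depth a.
Proof.
elim/expr_nested_ind: a u => //=.
- by move=> u _; rewrite /later big_geq.
- move=> es IH u /andP[_ wf]; rewrite /later /=.
  have [us|us] := ltnP u (sumn (map nverts es)); last first.
    rewrite big1_seq // => x; rewrite mem_index_iota => /andP[_ xs].
    by rewrite ltnNge (leq_trans (ltnW xs) us).
  have [i [v [ish vn ->]]] := offset_ex us; rewrite size_map in ish.
  have eE j x : j < size es -> x < nth 0 (map nverts es) j ->
    (sumn (take i (map nverts es)) + v < sumn (take j (map nverts es)) + x) *
     subst_adj (fun _ _ => false) (map nverts es) (map eadj es)
      (sumn (take i (map nverts es)) + v) (sumn (take j (map nverts es)) + x) =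
    (i == j) * ((v < x) * eadj (nth Empty es j) v x).
    move=> js xn; rewrite subst_adjE ?size_map //.
    case: eqP => [<-|_]; rewrite ?muln0 //= mul1n ltn_add2l.
    by rewrite (nth_map Empty).
  rewrite sum_offsets size_map.
  rewrite (eq_big_nat _ _ (F2 := fun j => (i == j) * later (nth Empty es j) v)).
    rewrite (@sum_pick _ i (fun j => later (nth Empty es j) v)) //.
    have wfi : wf_td (nth Empty es i) by exact: (all_nthP Empty wf _ ish).
    apply: leq_trans (each_mem IH ish v wfi) _.
    elim: (es) i ish {eE vn us wfi} => //= e es' IHes [|i] /= ie.
      exact: leq_maxl.
    by apply: leq_trans (IHes i ie) _; exact: leq_maxr.
  move=> j /andP[_ js]; rewrite /later big_distrr /= -(nth_map Empty 0) //.
  by apply: eq_big_nat => x /andP[_ xn]; rewrite eE.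
- move=> N b IH u /andP[/andP[uN _] wf]; rewrite /later /= big_nat_recr //=.
  have [un|un] := ltnP u (nverts b); last first.
    rewrite [X in X + _]big1_seq ?add0n; last first.
      move=> x; rewrite mem_index_iota => /andP[_ xs].
      by rewrite ltnNge (leq_trans (ltnW xs) un).
    by case: (u \in N) => /=; lia.
  rewrite -(addn1 (inc_depth b)); apply: leq_add; last by rewrite mulnb; case: (_ && _).
  apply: leq_trans (IH u wf); apply: eq_leq; apply: eq_big_nat => x /andP[_ xn].
  by rewrite !ltn_eqF.
Qed.

(** This is where the annotation is used: its vertices are those of H in the same order, so
    [out E u] is the set of later neighbours counted by [later]. *)
Lemma td_out l t E d u : wf_edges t E -> td_witness l t E d ->
  size (out E u) <= l.
Proof.
move=> wfE /and4P[wf dl /eqP nd /allP h].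
apply: leq_trans (leq_trans (later_le u wf) dl).
have wfo : wf_nbrs t (out E u).
  rewrite /wf_nbrs (out_uniq wfE); apply/allP => x; rewrite mem_out.
  by case/andP: wfE => _ /allP hE /hE /andP[].
rewrite -sum1_size -(sum_mem (fun=> 1) wfo) /later nd.
rewrite big_nat [X in _ <= X]big_nat; apply: leq_sum => x /andP[_ xt].
rewrite muln1 mem_out; case ux: (_ \in _) => //.
have /andP[ux1 _] : u < x < t by case/andP: wfE => _ /allP /(_ _ ux).
have ut : u < t by exact: ltn_trans ux1 xt.
have um : u \in iota 0 t by rewrite mem_iota.
have xm : x \in iota 0 t by rewrite mem_iota.
by have /eqP -> := allP (h u um) x xm; rewrite /list_adj ux ux1.
Qed.

(** In a tree-depth expression only [Inc] creates vertices. This yields [0 < l] for such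
    substitutions, so constant work per edge of H fits into the budget of k + l per edge. *)
Lemma td_depth_gt0 d : wf_td d -> 0 < nverts d -> 0 < inc_depth d.
Proof.
elim/expr_nested_ind: d => //= es IH /andP[_]; elim: es IH => //= e es IHes.
move=> [He Hes] /andP[we wes]; rewrite addn_gt0 leq_max.
by move=> /orP[/(He we) -> //|/(IHes Hes wes) ->]; rewrite orbT.
Qed.

Lemma part_eta (a : part) : a = Part (first a) (order a) (degsum a).
Proof. by case: a. Qed.

Lemma merge_false a bs : foldl (merge_part false) a bs =
  Part (first a) (order a + sumn (map order bs)) (degsum a + sumn (map degsum bs)).
Proof.
elim: bs a => [|b bs IH] a /=; first by rewrite !addn0 -part_eta.
by rewrite IH /= mul0n addn0 !addnA.
Qed.

Lemma merge_blocks_pos jn a bs : 0 < order a -> all (fun b => 0 < order b) bs ->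
  all block_pos (merge_blocks jn a bs).
Proof.
elim: bs a => //= b bs IH a a0 /andP[b0 bs0]; rewrite all_cat IH //=.
  by case: (jn); rewrite //= /block_pos /= a0 b0.
by rewrite addn_gt0 a0.
Qed.

Lemma sumn_degsum off l : sumn (map degsum (parts off l)) =
  \sum_(0 <= i < size l) deg_sum (nth 0 (orders l) i)
     (nth (fun _ _ => false) (graphs l) i).
Proof.
elim: l off => [|a l IH] off /=; first by rewrite big_geq.
by rewrite IH big_nat_recl.
Qed.

(** * Tables after a join, a union or a substitution *)

Section Nodes.

Variables (k off : nat) (l : seq (nat * rel nat)) (T : nat) (bl : seq block).
Variables (L : seq (nat * nat)).
Hypothesis l0 : 0 < size l.
Hypothesis lpos : all (fun n => 0 < n) (orders l).
Hypothesis trl : trace_list k off l T bl L.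

Local Notation ps := (parts off l).
Local Notation a := (head part0 ps).
Local Notation bs := (behead ps).
Local Notation sub H := (subst_adj H (orders l) (graphs l)).
Local Notation N := (sumn (orders l)).

Lemma join_node :
  foldl (merge_part true) a bs = Part off N (deg_sum N (sub (fun _ _ => true))) /\
  trace k off N (sub (fun _ _ => true)) (T + merge_tri true a bs)
    (bl ++ merge_blocks true a bs) L.
Proof.
case: l l0 lpos trl => [//|c l'] _ pos tr.
have szl : size l' < size (c :: l') by [].
have := merge_prefix off szl.
rewrite take_oversize ?size_parts // => -[oP dP tP bP].
split.
  rewrite [LHS]part_eta first_merge; congr Part.
    by apply: etrans oP _; rewrite take_oversize // size_map.
  apply: etrans dP _; rewrite deg_sum_subst size_map; congr (_ + _).
  by apply: eq_bigr => i _; apply: eq_bigr => j _; rewrite andbT.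
have tr' := @trace_subst k off (c :: l') T bl
  (merge_blocks true (Part off c.1 (deg_sum c.1 c.2)) (parts (off + c.1) l')) L
  (fun _ _ => true) (fun _ _ => erefl) tr.
have {}tr' := tr' _ _.
rewrite -[head part0 _]/(Part off c.1 (deg_sum c.1 c.2)).
rewrite -[behead _]/(parts (off + c.1) l') tP.
have -> : T + (3 *
     \sum_(0 <= i < (size l').+1) \sum_(0 <= j < (size l').+1)
       (i != j) * (deg_sum (nth 0 (orders (c :: l')) i)
          (nth (fun _ _ => false) (graphs (c :: l')) i) *
          nth 0 (orders (c :: l')) j) +
   sum3 (size l').+1 (fun i j k0 => (i != j) * (j != k0) * (i != k0) *
      (nth 0 (orders (c :: l')) i * nth 0 (orders (c :: l')) j *
       nth 0 (orders (c :: l')) k0))) =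
  T + 3 * \sum_(0 <= i < size (c :: l')) \sum_(0 <= j < size (c :: l'))
     ((i != j) && true) * (deg_sum (nth 0 (orders (c :: l')) i)
          (nth (fun _ _ => false) (graphs (c :: l')) i) *
          nth 0 (orders (c :: l')) j) +
   tri_parts (fun _ _ => true) (orders (c :: l')) (fun i => nth 0 (orders (c :: l')) i).
  rewrite addnA /tri_parts size_map; congr (_ + _ * _ + _).
    by apply: eq_bigr => i _; apply: eq_bigr => j _; rewrite andbT.
  by apply: eq_sum3 => i j k0; rewrite !andbT.
apply: tr'.
  move=> F Fsym; rewrite -bP //; apply: eq_bigr => i _; apply: eq_bigr => j _.
  by rewrite andbT.
have c0 : 0 < c.1 by case/andP: pos.
have pos' : all (fun n => 0 < n) (orders l') by case/andP: pos.
apply: merge_blocks_pos => //.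
by move: pos'; rewrite -(map_order_parts (off + c.1) l') all_map.
Qed.

Lemma union_node :
  foldl (merge_part false) a bs = Part off N (deg_sum N (sub (fun _ _ => false))) /\
  trace k off N (sub (fun _ _ => false)) T bl L.
Proof.
split.
  rewrite merge_false -(map_order_parts off l); case e: ps => [|b bs'] /=.
    by have := size_parts off l; rewrite e; case: (l) l0.
  congr Part.
    by case: (l) e l0 => // c l' /= [<- _].
  rewrite -[RHS]/(deg_sum (sumn (order b :: map order bs')) _).
  rewrite -[order b :: _]/(map order (b :: bs')) -e map_order_parts deg_sum_subst.
  rewrite size_map -(sumn_degsum off) e /= -[LHS]addn0; congr (_ + _).
  by rewrite big1 // => i _; rewrite big1 // => j _; rewrite andbF.
have := @trace_subst k off l T bl [::] L (fun _ _ => false) (fun _ _ => erefl) trl.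
rewrite cats0 /tri_parts !big1 ?addn0 ?muln0 => [h|i _|i _].
- apply: h => // F _; rewrite big_nil big1 // => i _; rewrite big1 // => j _.
  by rewrite andbF.
- by rewrite big1 // => j _; rewrite big1 // => x _; rewrite andbF.
- by rewrite big1 // => j _; rewrite andbF.
Qed.

Lemma subst_node E d : wf_edges (size l) E ->
  foldl (merge_part false) (Part (first a) (order a) (degsum a + sum_deg ps E)) bs =
    Part off N (deg_sum N (sub (list_adj E))) /\
  trace k off N (sub (list_adj E))
    (T + sum_tri ps E + subst_tri d E (size l) (fun i => order (nth part0 ps i)))
    (bl ++ [seq part_block (nth part0 ps q.1) (nth part0 ps q.2) | q <- E]) L.
Proof.
move=> wfE; split.
  rewrite merge_false /= -(map_order_parts off l); case e: ps => [|b bs'] /=.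
    by have := size_parts off l; rewrite e; case: (l) l0.
  congr Part.
    by case: (l) e l0 => // c l' /= [<- _].
  rewrite -[RHS]/(deg_sum (sumn (order b :: map order bs')) _).
  rewrite -[order b :: _]/(map order (b :: bs')) -e map_order_parts deg_sum_subst.
  rewrite size_map -(sumn_degsum off) -(sum_deg_edges off wfE) e /=.
  by rewrite /sum_deg /=; lia.
have -> : subst_tri d E (size l) (fun i => order (nth part0 ps i)) =
    tri_parts (list_adj E) (orders l) (fun i => nth 0 (orders l) i).
  transitivity (sum3 (size l) (fun i j x =>
    ((i != j) && list_adj E i j) * ((j != x) && list_adj E j x) *
    ((i != x) && list_adj E i x) * (order (nth part0 ps i) *
      order (nth part0 ps j) * order (nth part0 ps x)))).
    symmetry; case: d => [q|].
      exact: (@sum3_out (size l) E (fun i => order (nth part0 ps i)) wfE).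
    exact: (@sum3_mx (size l) E (fun i => order (nth part0 ps i)) wfE).
  rewrite /tri_parts size_map; apply: eq_big_nat => i /andP[_ il].
  apply: eq_big_nat => j /andP[_ jl]; apply: eq_big_nat => x /andP[_ xl].
  by rewrite !nth_parts.
rewrite /sum_tri (sum_tri_edges off wfE); apply: trace_subst => //.
- exact: list_adj_sym.
- by move=> F Fsym; exact: edges_cross.
rewrite all_map; apply/allP => q /(edge_bound wfE) /andP[q12 q2] /=.
have q1 := ltn_trans q12 q2.
rewrite /block_pos /= !nth_parts //=.
have pos i : i < size l -> 0 < nth 0 (orders l) i.
  by move=> il; apply: (allP lpos); rewrite mem_nth // size_map.
by rewrite !pos.
Qed.

End Nodes.

Lemma trace_weaken k k' off n e T bl L :
  k <= k' -> trace k off n e T bl L -> trace k' off n e T bl L.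
Proof. by move=> kk' [? ? ? h ? ?]; split => // u; exact: leq_trans (h u) kk'. Qed.

Definition graph_list (es : seq expr) : seq (nat * rel nat) :=
  [seq (nverts e, eadj e) | e <- es].

Lemma orders_graph_list es : orders (graph_list es) = map nverts es.
Proof. by rewrite /orders /graph_list -map_comp. Qed.

Lemma graphs_graph_list es : graphs (graph_list es) = map eadj es.
Proof. by rewrite /graphs /graph_list -map_comp. Qed.

Definition degs (a : expr) : nat := deg_sum (nverts a) (eadj a).

Definition guard : aexp := Bin Lt (Reg 1) (Reg 0).

(** For H with at most h vertices, this lets the edges be charged to the vertices through
    [t * t <= h * t]. *)
Lemma wf_edges_size t E : wf_edges t E -> size E <= t * t.
Proof.
move=> /andP[uE /allP hE].
rewrite -{1}(size_iota 0 t) -{2}(size_iota 0 t) -(size_allpairs (fun i j => (i, j))).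
apply: uniq_leq_size => // -[i j] /hE /= /andP[ij jt].
by apply/allpairsP; exists (i, j); rewrite !mem_iota /= (ltn_trans ij jt) jt.
Qed.

Lemma size_le_sumn (ns : seq nat) : all (fun n => 0 < n) ns -> size ns <= sumn ns.
Proof. by elim: ns => //= n ns IH /andP[n0 /IH]; lia. Qed.

(** * Reading the code: correctness and credits *)

Section Parse.

Variables (p : cmd) (cm : nat) (mmcost : nat -> nat).
Hypothesis mm : multiplies p cm mmcost.

Variable w : nat.
Local Notation M := (2 ^ w).

Variable code : seq nat.
Local Notation S := (size code).
Hypothesis codeM : (S + 10) ^ 2 < M.
Hypothesis mmM : (2 * S + 2) ^ cm <= M.

Variables (k h l D : nat).
Hypothesis D0 : 0 < D.
Hypothesis hD : h <= D.
Hypothesis mmD : forall t, 0 < t <= h -> mmcost t <= D * t.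

Variables (X Y : nat).
Hypothesis XD : 4000 * D <= X.
Hypothesis Ykl : 600 * (k + l) <= Y.

Local Notation rep := (rep w code).
Local Notation body := (do_token p).

Lemma token_steps s pos st nv T bl L tag (Q : nat -> state -> Prop) :
  word_state w s -> rep s pos st nv T bl L -> pos < S ->
  nth 0 code pos = tag -> tag < 7 ->
  (forall s1, word_state w s1 -> rep s1 pos st nv T bl L -> reg s1 7 = tag ->
     wp w (if tag == 0 then do_empty else if tag == 1 then do_vertex else
           if tag == 4 then do_inc else do_args p) s1 Q) ->
  exists c c' s', [/\ steps w guard body s c s', word_state w s',
                      c <= c' + 30 & Q c' s'].
Proof.
move=> ws rp pS ct tag7 H; have [M1 M2] := square_large codeM.
have [I p1 Sk r3 rT B G A bd] := rp.
have l1 : 1 %% M = 1 by rewrite lit_small //; mlia.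
pose s1 := State (upd (reg s) 7 (arr s 0 (reg s 1))) (arr s).
have fr : frame [:: 7] [::] s s1 by rewrite /s1; frame_tac.
have e1 : exec w (Set_ 7 (Get 0 (Reg 1))) s 3 s1 := ExSet w 7 (Get 0 (Reg 1)) s.
have ws1 : word_state w s1 by exact: exec_word e1 ws.
have rp1 : rep s1 pos st nv T bl L.
  split; [exact: (input_at_frame fr)|by rewrite fr.1|exact: (stack_at_frame fr)|
    by rewrite fr.1|by rewrite fr.1|exact: (blocks_at_frame fr)|
    exact: (graph_at_frame fr)|exact: A|exact: bd].
have r7 : reg s1 7 = tag by rewrite /s1 /upd /= p1 I.2.
clearbody s1.
have [c' [s' [e' q]]] := H s1 ws1 rp1 r7.
have ifE n c1 c2 r c : n < 7 -> exec w (if tag == n then c1 else c2) s1 c r ->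
    exec w (If (Bin Eq (Reg 7) (Lit n)) c1 c2) s1 (4 + c) r.
  move=> n7 ex; apply: (@ExIf w (Bin Eq (Reg 7) (Lit n)) c1 c2).
  rewrite /= r7 (@lit_small w n); last by mlia.
  by move: ex; case: (tag == n); rewrite ?l1 ?mod0n.
have [cc [ccle ex]] : exists cc, cc <= c' + 12 /\ exec w
   (If (Bin Eq (Reg 7) (Lit 0)) do_empty
   (If (Bin Eq (Reg 7) (Lit 1)) do_vertex
   (If (Bin Eq (Reg 7) (Lit 4)) do_inc (do_args p)))) s1 cc s'.
  case t0: (tag == 0) e' => e'.
    by exists (4 + c'); split; [lia|apply: ifE => //; rewrite t0].
  suff [cc [ccle ex]] : exists cc, cc <= c' + 8 /\ exec w
      (If (Bin Eq (Reg 7) (Lit 1)) do_vertex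
      (If (Bin Eq (Reg 7) (Lit 4)) do_inc (do_args p))) s1 cc s'.
    by exists (4 + cc); split; [lia|apply: ifE => //; rewrite t0].
  case t1: (tag == 1) e' => e'.
    by exists (4 + c'); split; [lia|apply: ifE => //; rewrite t1].
  have ex : exec w (If (Bin Eq (Reg 7) (Lit 4)) do_inc (do_args p)) s1 (4 + c') s'.
    exact: ifE.
  by exists (4 + (4 + c')); split; [lia|apply: ifE => //; rewrite t1].
have eb : exec w body s (3 + cc) s' by apply: ExSeq e1 ex.
exists (4 + (3 + cc)), c', s'; split.
- apply: (@steps1 w guard body s) => //.
  by rewrite /= p1 I.1 pS l1.
- exact: exec_word eb ws.
- by lia.
- exact: q.
Qed.

(* The spare [X] on the left pays for handling the value of [a] as an argument
   of another operation. *)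
Definition parsed (a : expr) : Prop :=
  forall s pos st nv T bl L, word_state w s -> rep s pos st nv T bl L ->
  occurs_at code pos (encode a) ->
  exists c s' T' bl' L',
    [/\ steps w guard body s c s' /\ word_state w s',
        c + X <= X * (3 * nverts a + 2 * (nverts a == 0)) + Y * degs a,
        rep s' (pos + size (encode a)) (rcons st (Part nv (nverts a) (degs a)))
          (nv + nverts a) (T + T') (bl ++ bl') (L ++ L')
      & trace (inc_depth a) nv (nverts a) (eadj a) T' bl' L'].

(** Nonempty arguments leave a full credit [X] each, as the allowance for the empty graph disappears
    from their bounds. *)
Lemma parse_list es kk s pos st nv T bl L :
  each parsed es -> all (fun e => 0 < nverts e) es ->
  foldr maxn 0 (map inc_depth es) <= kk ->
  word_state w s -> rep s pos st nv T bl L ->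
  occurs_at code pos (flatten (map encode es)) ->
  exists c s' T' bl' L',
    [/\ steps w guard body s c s' /\ word_state w s',
        c + X * size es <= X * (3 * sumn (map nverts es)) +
          Y * sumn (map degs es),
        rep s' (pos + size (flatten (map encode es)))
          (st ++ parts nv (graph_list es))
          (nv + sumn (map nverts es)) (T + T') (bl ++ bl') (L ++ L')
      & trace_list kk nv (graph_list es) T' bl' L'].
Proof.
elim: es s pos st nv T bl L => [|e es IH] s pos st nv T bl L /=.
  move=> _ _ _ ws rp _; exists 0, s, 0, [::], [::].
  rewrite !addn0 !cats0 !muln0; split.
  - by split => //; exact: steps_refl.
  - by [].
  - exact: rp.
  - exact: trace_nil.
move=> [Pe Pes] /andP[e0 es0]; rewrite geq_max => /andP[ke kes] ws rp.
move=> /occurs_at_cat[oe oes].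
have [c1 [s1 [T1 [bl1 [L1 [[st1 ws1] c1le rp1 tr1]]]]]] := Pe _ _ _ _ _ _ _ ws rp oe.
have [c2 [s2 [T2 [bl2 [L2 [[st2 ws2] c2le rp2 tr2]]]]]] :=
  IH _ _ _ _ _ _ _ Pes es0 kes ws1 rp1 oes.
exists (c1 + c2), s2, (T1 + T2), (bl1 ++ bl2), (L1 ++ L2); split.
- by split => //; exact: steps_trans st1 st2.
- by move: c1le c2le; rewrite (gtn_eqF e0) muln0 addn0 !mulnDr mulnS; lia.
- by rewrite size_cat !addnA !catA -cat_rcons in rp2 *.
- by apply: trace_cons tr2; apply: trace_weaken tr1.
Qed.

Lemma deg_sum_inc n e N : wf_nbrs n N ->
  deg_sum n.+1 (fun u v => if u == n then (v != u) && (v \in N)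
                           else if v == n then u \in N else e u v) =
  deg_sum n e + 2 * size N.
Proof.
move=> wfN; rewrite /deg_sum sum2_recr !eqxx /= addn0; congr (_ + _).
  by apply: eq_big_nat => u /andP[_ un]; apply: eq_big_nat => v /andP[_ vn];
    rewrite !ltn_eqF.
rewrite -sum1_size -(sum_mem (fun=> 1) wfN) big_distrr /=.
apply: eq_big_nat => u /andP[_ un]; rewrite ?eqxx !(ltn_eqF un) /=.
by case: (u \in N).
Qed.

Lemma sumn_degs es : sumn (map degs es) =
  \sum_(0 <= i < size (graph_list es)) deg_sum (nth 0 (orders (graph_list es)) i)
     (nth (fun _ _ => false) (graphs (graph_list es)) i).
Proof.
rewrite -(sumn_degsum 0); elim: es {1}0 => //= e es IH off.
by rewrite (IH (off + nverts e)).
Qed.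

Lemma all_pos es :
  all (fun e => 0 < nverts e) es -> all (fun n => 0 < n) (orders (graph_list es)).
Proof. by rewrite orders_graph_list all_map. Qed.

Lemma degs_subst H es :
  sumn (map degs es) <= deg_sum (sumn (map nverts es))
    (subst_adj H (map nverts es) (map eadj es)).
Proof.
rewrite sumn_degs -orders_graph_list -graphs_graph_list deg_sum_subst.
by rewrite [size (orders _)]size_map leq_addr.
Qed.

(** An edge of H yields at least one edge of the graph because the arguments are nonempty; this
    transfers its cost to the edges of the graph. *)
Lemma degs_edges E es : wf_edges (size es) E -> all (fun e => 0 < nverts e) es ->
  sumn (map degs es) + 2 * size E <= deg_sum (sumn (map nverts es))
    (subst_adj (list_adj E) (map nverts es) (map eadj es)).
Proof.
move=> wfE /all_pos pos.
have wfE' : wf_edges (size (graph_list es)) E by rewrite size_map.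
rewrite sumn_degs -orders_graph_list -graphs_graph_list deg_sum_subst.
rewrite [size (orders _)]size_map leq_add2l.
rewrite -(sum_deg_edges 0 wfE') -sum1_size big_distrr /= big_seq [X in _ <= X]big_seq.
apply: leq_sum => q /(edge_bound wfE') /andP[q12 q2].
have q1 := ltn_trans q12 q2; rewrite !nth_parts //= muln1 leq_pmulr //.
have p_ i : i < size (graph_list es) -> 0 < nth 0 (orders (graph_list es)) i.
  by move=> il; apply: (all_nthP 0 pos); rewrite size_map.
by rewrite muln_gt0 !p_.
Qed.

Lemma each_parsed es :
  each (fun e => wf_expr h l e -> inc_depth e <= k -> irredundant e -> parsed e) es ->
  all (wf_expr h l) es -> foldr maxn 0 (map inc_depth es) <= k ->
  all irredundant es -> each parsed es.
Proof.
elim: es => //= e es IH [Pe Pes] /andP[wfe wfes].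
rewrite geq_max => /andP[de des] /andP[ie ies].
by split; [exact: Pe|exact: IH].
Qed.

Lemma head_parts off es : 0 < size es ->
  parts off (graph_list es) =
    head part0 (parts off (graph_list es)) :: behead (parts off (graph_list es)).
Proof. by case: es. Qed.

Lemma parsed_args (jn : bool) es : each parsed es -> 1 < size es ->
  all (fun e => 0 < nverts e) es ->
  parsed (if jn then Join es else Union es).
Proof.
move=> IH sz pos s ps st nv T bl L ws rp oc.
set a := if jn then _ else _ in oc *.
have [M1 M2] := square_large codeM.
have nva : nverts a = sumn (map nverts es) by rewrite /a; case: (jn).
have da : inc_depth a = foldr maxn 0 (map inc_depth es) by rewrite /a; case: (jn).
have ea : eadj a = subst_adj (fun _ _ => jn) (map nverts es) (map eadj es).
  by rewrite /a; case: (jn).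
have ca : encode a = flatten (map encode es) ++ [:: if jn then 3 else 2; size es].
  by rewrite /a; case: (jn).
move: oc; rewrite ca => /occurs_at_cat[oc1 oc2].
have dle : foldr maxn 0 (map inc_depth es) <= inc_depth a by rewrite da.
have [c1 [s1 [T1 [bl1 [L1 [[st1 ws1] c1le rp1 tr1]]]]]] :=
  parse_list IH pos dle ws rp oc1.
have l0 : 0 < size (graph_list es) by rewrite size_map ltnW.
have epos := all_pos pos.
have es0 : 0 < size es by exact: ltnW.
set pp := parts nv (graph_list es) in rp1.
have epp : pp = head part0 pp :: behead pp by exact: head_parts.
have szbs : (size (behead pp)).+1 = size es.
  by rewrite size_behead size_parts size_map prednK.
have ordpp : order (head part0 pp) + sumn (map order (behead pp)) =
    sumn (map nverts es).
  rewrite -orders_graph_list -(map_order_parts nv) -/pp {3}epp.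
  by [].
rewrite epp in rp1.
set pos1 := ps + size _ in rp1 oc2.
have pS : pos1 < S by case: oc2 => /=; lia.
have ct : nth 0 code pos1 = if jn then 3 else 2.
  by have := oc2.2 0 isT; rewrite addn0.
have tag23 : 1 < (if jn then 3 else 2) < 4 by case: (jn).
have tagE : (if jn then 3 else 2) == 3 = jn by case: (jn).
have ordle : order (head part0 pp) + sumn (map order (behead pp)) <=
  nv + sumn (map nverts es) by rewrite ordpp leq_addl.
pose Q kk s' := kk <= 110 * size es + 200 /\
  rep s' (pos1 + 2) (rcons st (foldl (merge_part jn) (head part0 pp) (behead pp)))
    (nv + sumn (map nverts es)) (T + T1 + merge_tri jn (head part0 pp) (behead pp))
    ((bl ++ bl1) ++ merge_blocks jn (head part0 pp) (behead pp)) (L ++ L1).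
have H s2 : word_state w s2 ->
    rep s2 pos1 (st ++ head part0 pp :: behead pp) (nv + sumn (map nverts es))
      (T + T1) (bl ++ bl1) (L ++ L1) ->
    reg s2 7 = (if jn then 3 else 2) ->
    wp w (if (if jn then 3 else 2) == 0 then do_empty
          else if (if jn then 3 else 2) == 1 then do_vertex
          else if (if jn then 3 else 2) == 4 then do_inc else do_args p) s2 Q.
  move=> ws2 rp2 r7.
  have := do_args_merge p codeM mmM ws2 rp2 r7 tag23 _ ordle.
  rewrite szbs tagE => /(_ oc2).
  rewrite (_ : (if (if jn then 3 else 2) == 0 then do_empty
          else if (if jn then 3 else 2) == 1 then do_vertex
          else if (if jn then 3 else 2) == 4 then do_inc else do_args p) =
    do_args p) //.
  by case: (jn).
have tag7 : (if jn then 3 else 2) < 7 by case: (jn).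
have [c2 [c2' [s2 [st2 ws2 c2le [c2'le rp2]]]]] := token_steps ws1 rp1 pS ct tag7 H.
have node : foldl (merge_part jn) (head part0 pp) (behead pp) =
    Part nv (nverts a) (degs a) /\
    trace (inc_depth a) nv (nverts a) (eadj a)
      (T1 + merge_tri jn (head part0 pp) (behead pp))
      (bl1 ++ merge_blocks jn (head part0 pp) (behead pp)) L1.
  rewrite /degs nva ea -orders_graph_list -graphs_graph_list.
  case: (jn) => /=; first exact: join_node.
  by rewrite merge_tri_false merge_blocks_false addn0 cats0; exact: union_node.
case: node => eP tr2; rewrite eP in rp2.
exists (c1 + c2), s2, (T1 + merge_tri jn (head part0 pp) (behead pp)),
  (bl1 ++ merge_blocks jn (head part0 pp) (behead pp)), L1; split.
- by split => //; exact: steps_trans st1 st2.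
- have N0 : nverts a != 0.
    by rewrite nva -lt0n; have := size_le_sumn epos; rewrite orders_graph_list
      size_map; lia.
  rewrite (negbTE N0) nva.
  have dd : Y * sumn (map degs es) <= Y * degs a.
    rewrite leq_mul2l /degs nva ea; apply/orP; right; exact: degs_subst.
  (* Of the [size es] credits one is handed on; the others, at least one, pay for the merging. *)
  have Xt : X * size es = X * (size es).-1 + X.
    by rewrite addnC -mulnS prednK.
  have Xt' : 4000 * (size es).-1 <= X * (size es).-1.
    by rewrite leq_mul2r; apply/orP; right; move: XD D0; nia.
  by move: c1le c2le c2'le; lia.
- have -> : ps + size (flatten (map encode es) ++ [:: if jn then 3 else 2; size es]) =
    pos1 + 2 by rewrite size_cat addnA.
  by move: rp2; rewrite -!catA -!addnA nva.
- exact: tr2.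
Qed.

Lemma parsed_inc N b : 0 < k -> wf_nbrs (nverts b) N -> parsed b -> parsed (Inc N b).
Proof.
move=> k0 wfN IH s ps st nv T bl L ws rp oc.
have [M1 M2] := square_large codeM.
have /occurs_at_cat[oc1 oc2] : occurs_at code ps (encode b ++ 4 :: encode_seq N).
  exact: oc.
have [c1 [s1 [T1 [bl1 [L1 [[st1 ws1] c1le rp1 tr1]]]]]] := IH _ _ _ _ _ _ _ ws rp oc1.
set pos1 := ps + size (encode b) in rp1 oc2.
have pS : pos1 < S by case: oc2 => /=; lia.
have ct : nth 0 code pos1 = 4 by have := oc2.2 0 isT; rewrite addn0.
have ltN : all (fun u => u < nverts b) N by case/andP: wfN.
have [c2 [c2' [s2 [st2 ws2 c2le [c2'le rp2]]]]] := token_steps ws1 rp1 pS ct isT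
  (fun s2 ws2 rp2 _ => do_inc_spec codeM rp2 erefl ltN oc2).
have dE : degs (Inc N b) = degs b + 2 * size N by exact: deg_sum_inc.
exists (c1 + c2), s2, T1, (bl1 ++ [seq ((nv + u, 1), (nv + nverts b, 1)) | u <- N]),
  (L1 ++ [seq (nv + u, nv + nverts b) | u <- N]); split.
- by split => //; exact: steps_trans st1 st2.
- rewrite -[nverts (Inc N b)]/(nverts b).+1 dE eqn0Ngt ltn0Sn /= muln0 addn0.
  have X1 : 4000 <= X by move: XD D0; nia.
  (* The assumption [0 < k] makes [Y] at least 600, which covers constant work for each
     neighbour. *)
  have Y1 : 600 * size N <= Y * size N by rewrite leq_mul2r; apply/orP; right;
    move: Ykl k0; lia.
  (* The new vertex brings [3 * X], of which [2 * X] may have to replace the allowance of an empty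
     argument; one [X] is left to pay for the token. *)
  have e1 : X * (3 * (nverts b).+1) = X * (3 * nverts b) + X + X + X by rewrite mulnS; lia.
  have e2 : Y * (degs b + 2 * size N) = Y * degs b + 2 * (Y * size N) by lia.
  rewrite e1 e2; move: c1le c2le c2'le.
  rewrite mulnDr; case: (nverts b == 0); rewrite ?muln1 ?muln0; lia.
- have -> : size (encode (Inc N b)) = size (encode b) + (size N).+2.
    by rewrite /= size_cat.
  rewrite dE -[nverts (Inc N b)]/(nverts b).+1 !addnS.
  by move: rp2; rewrite -!catA /pos1 !addnA addn2.
- exact: trace_inc.
Qed.

Lemma parsed_subst E d es : each parsed es -> 1 < size es ->
  all (fun e => 0 < nverts e) es -> wf_edges (size es) E ->
  (if d is Some b then td_witness l (size es) E b else size es <= h) ->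
  parsed (Subst E d es).
Proof.
move=> IH sz pos wfE hd s ps st nv T bl L ws rp oc.
set a := Subst _ _ _ in oc *.
have [M1 M2] := square_large codeM.
pose q := if d is Some b then Some (encode b) else None.
have ca : encode a = flatten (map encode es) ++ subst_code (size es) E q.
  by rewrite /a /subst_code /q /=; case: (d).
move: oc; rewrite ca => /occurs_at_cat[oc1 oc2].
have [c1 [s1 [T1 [bl1 [L1 [[st1 ws1] c1le rp1 tr1]]]]]] :=
  parse_list IH pos (leqnn _) ws rp oc1.
have l0 : 0 < size (graph_list es) by rewrite size_map ltnW.
have epos := all_pos pos.
have es0 : 0 < size es by exact: ltnW.
have wfE' : wf_edges (size (graph_list es)) E by rewrite size_map.
have [fp tr2] := subst_node l0 epos tr1 q wfE'.
set pp := parts nv (graph_list es) in rp1 fp tr2.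
have epp : pp = head part0 pp :: behead pp by exact: head_parts.
have szpp : size pp = size es by rewrite size_parts size_map.
have ordpp : order (head part0 pp) + sumn (map order (behead pp)) =
    sumn (map nverts es).
  rewrite -orders_graph_list -(map_order_parts nv) -/pp {3}epp.
  by [].
set pos1 := ps + size _ in rp1 oc2.
have pS : pos1 < S by case: oc2 => /=; lia.
have ct : nth 0 code pos1 = subst_tag q by have := oc2.2 0 isT; rewrite addn0.
have tag7 : subst_tag q < 7 by case: (q).
(* Without a tree-depth expression the lists of later neighbours may be long, but they are not
   traversed and the hypothesis [outE] is vacuous, so the bound 0 can be used. *)
pose l_ := if d is Some _ then l else 0.
have outE x : q = Some x -> forall u, size (out E u) <= l_.
  by rewrite /q /l_; case: (d) hd => // b td _ u; exact: td_out wfE td.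
have ordle : order (head part0 pp) + sumn (map order (behead pp)) <=
  nv + sumn (map nverts es) by rewrite ordpp leq_addl.
pose Q kk s' := kk <= subst_cost mmcost pp E q l_ + 110 * size es + 200 /\
  rep s' (pos1 + size (subst_code (size es) E q))
    (rcons st (Part nv (nverts a) (degs a)))
    (nv + nverts a)
    (T + T1 + sum_tri pp E +
       subst_tri q E (size es) (fun i => order (nth part0 pp i)))
    ((bl ++ bl1) ++
       [seq part_block (nth part0 pp r.1) (nth part0 pp r.2) | r <- E]) (L ++ L1).
have H s2 : word_state w s2 ->
    rep s2 pos1 (st ++ pp) (nv + sumn (map nverts es))
      (T + T1) (bl ++ bl1) (L ++ L1) ->
    reg s2 7 = subst_tag q ->
    wp w (if subst_tag q == 0 then do_empty
          else if subst_tag q == 1 then do_vertex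
          else if subst_tag q == 4 then do_inc else do_args p) s2 Q.
  move=> ws2 rp2 r7.
  have wfE2 : wf_edges (size (head part0 pp :: behead pp)) E by rewrite -epp szpp.
  have rp3 : rep s2 pos1 (st ++ head part0 pp :: behead pp)
    (nv + sumn (map nverts es)) (T + T1) (bl ++ bl1) (L ++ L1) by rewrite -epp.
  have oc3 : occurs_at code pos1
     (subst_code (size (head part0 pp :: behead pp)) E q) by rewrite -epp szpp.
  have := do_args_subst mm codeM mmM wfE2 outE ws2 rp3 r7 oc3 ordle.
  rewrite -epp szpp fp orders_graph_list graphs_graph_list.
  by rewrite /Q; case: (q).
have [c2 [c2' [s2 [st2 ws2 c2le [c2'le rp2]]]]] := token_steps ws1 rp1 pS ct tag7 H.
exists (c1 + c2), s2, (T1 + sum_tri pp E +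
       subst_tri q E (size es) (fun i => order (nth part0 pp i))),
  (bl1 ++ [seq part_block (nth part0 pp r.1) (nth part0 pp r.2) | r <- E]), L1; split.
- by split => //; exact: steps_trans st1 st2.
- have N0 : nverts a != 0.
    rewrite -lt0n; have := size_le_sumn epos; rewrite orders_graph_list.
    by rewrite size_map /=; lia.
  rewrite (negbTE N0) muln0 addn0.
  have dd : Y * (sumn (map degs es) + 2 * size E) <= Y * degs a.
    by rewrite leq_mul2l; apply/orP; right; exact: degs_edges.
  have Xt : X * size es = X * (size es).-1 + X.
    by rewrite addnC -mulnS prednK.
  have t2 : size es <= 2 * (size es).-1 by lia.
  have Xt' : 4000 * D * (size es).-1 <= X * (size es).-1.
    by rewrite leq_mul2r; apply/orP; right.
  have Dt : (size es).-1 <= D * (size es).-1 by rewrite leq_pmull.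
  have Dt' : D * size es <= 2 * (D * (size es).-1).
    by rewrite mulnCA leq_mul2l t2 orbT.
  (* With a tree-depth expression, [0 < l] lets [Y] pay for the edges of H; otherwise there are at
     most [t * t <= D * t] of them, and the vertex credits pay for these and for the matrix
     product. *)
  have sc : subst_cost mmcost pp E q l_ + 110 * size es + 230 <=
      4000 * (D * (size es).-1) + Y * (2 * size E).
    rewrite /subst_cost szpp /q /l_; case: (d) hd => [b td|th].
      have l1 : 0 < l.
        case/and4P: td => wfb db /eqP nb _.
        by apply: leq_trans db; apply: td_depth_gt0 => //; rewrite nb; lia.
      have YE : (600 * l) * size E <= Y * size E.
        by rewrite leq_mul2r; apply/orP; right; move: Ykl; lia.
      have lE : size E <= l * size E by rewrite leq_pmull.
      by rewrite mulnDl; move: YE lE Dt t2; rewrite -!mulnA; lia.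
    have th' : 0 < size es <= h by rewrite es0 th.
    have := mmD th'; have Et := wf_edges_size wfE.
    have tD : size es * size es <= D * size es.
      by rewrite leq_mul2r; apply/orP; right; exact: leq_trans th hD.
    by rewrite muln0 addn0; lia.
  have mD : 4000 * (D * (size es).-1) <= X * (size es).-1 by rewrite mulnA.
  by move: c1le c2le c2'le; rewrite -[nverts a]/(sumn (map nverts es)); lia.
- have -> : ps + size (flatten (map encode es) ++ subst_code (size es) E q) =
    pos1 + size (subst_code (size es) E q) by rewrite size_cat addnA.
  by move: rp2; rewrite -!catA -!addnA.
- have := tr2; rewrite orders_graph_list graphs_graph_list size_map.
  exact.
Qed.

Lemma parse a : wf_expr h l a -> inc_depth a <= k -> irredundant a -> parsed a.
Proof.
elim/expr_nested_ind: a.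
- move=> _ _ _ s pos st nv T bl L ws rp [oc1 oc2] /=; rewrite /= in oc1.
  have c0 : nth 0 code pos = 0 by have := oc2 0 isT; rewrite addn0.
  have pS : pos < S by lia.
  have [c [c' [s' [st' ws' cle [c'le rp']]]]] :=
    token_steps ws rp pS c0 isT (fun s1 ws1 rp1 _ => do_empty_spec codeM rp1 pS).
  exists c, s', 0, [::], [::]; split.
  + by [].
  (* The empty graph is allowed [2 * X]: one for its token and one to hand on. *)
  + by move: XD D0; rewrite /degs; lia.
  + by rewrite !addn0 !cats0 addn1 /degs /deg_sum big_geq.
  + exact: trace_empty.
- move=> _ _ _ s pos st nv T bl L ws rp [oc1 oc2] /=; rewrite /= in oc1.
  have c0 : nth 0 code pos = 1 by have := oc2 0 isT; rewrite addn0.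
  have pS : pos < S by lia.
  have [c [c' [s' [st' ws' cle [c'le rp']]]]] :=
    token_steps ws rp pS c0 isT (fun s1 ws1 rp1 _ => do_vertex_spec codeM rp1 pS).
  exists c, s', 0, [::], [::]; split.
  + by [].
  + by move: XD D0; rewrite /degs; lia.
  + by rewrite !addn0 !cats0 !addn1 /degs /deg_sum !big_nat1.
  + exact: trace_vertex.
- move=> es IH /andP[sz wf] dp /andP[pos irr].
  exact: (@parsed_args false es (each_parsed IH wf dp irr) sz pos).
- move=> es IH /andP[sz wf] dp /andP[pos irr].
  exact: (@parsed_args true es (each_parsed IH wf dp irr) sz pos).
- move=> N b IH /andP[wfN wfb] /= dp irr; apply: parsed_inc => //.
    exact: leq_ltn_trans dp.
  by apply: IH => //; exact: ltnW.
- move=> E d es _ IH /and3P[wfE hd wf] dp /and4P[sz pos irr _].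
  apply: parsed_subst => //; exact: each_parsed.
Qed.

End Parse.

(** * The whole program *)

Definition count_pairs : cmd :=
  Seq (Set_ 20 (Lit 0))
      (While (Bin Lt (Reg 20) (Reg 5))
        (Seq (Set_ 21 (Lit 0))
        (Seq (While (Bin Lt (Reg 21) (Get 5 (Reg 20)))
               (Seq (Set_ 17 (Bin Add (Get 4 (Reg 20)) (Reg 21)))
               (Seq (Set_ 22 (Lit 0))
               (Seq (While (Bin Lt (Reg 22) (Get 7 (Reg 20)))
                      (Seq (Set_ 18 (Bin Add (Get 6 (Reg 20)) (Reg 22)))
                      (Seq (query false)
                      (Seq (Set_ 4 (Bin Add (Reg 4) (Bin Mul (Lit 6) (Reg 15))))
                           (incr 22 1)))))
                    (incr 21 1)))))
             (incr 20 1)))).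

Definition triangle_program (p : cmd) : cmd :=
  Seq (Set_ 1 (Lit 0))
 (Seq (Set_ 2 (Lit 0))
 (Seq (Set_ 3 (Lit 0))
 (Seq (Set_ 4 (Lit 0))
 (Seq (Set_ 5 (Lit 0))
 (Seq (Set_ 6 (Lit 0))
 (Seq (While guard (do_token p))
 (Seq (If (Reg 6) count_pairs Skip)
      (Set_ 0 (Bin Div (Reg 4) (Lit 6)))))))))).

Section Count.

Variable w : nat.
Local Notation M := (2 ^ w).

Variables (k n : nat) (bl : seq block) (L : seq (nat * nat)).
Hypothesis nM : n + size bl + size L + 10 < M.
Hypothesis outk : forall u, size (out L u) <= k.
Hypothesis inside : forall b u v, b \in bl -> u < b.1.2 -> v < b.2.2 ->
  (b.1.1 + u < n) && (b.2.1 + v < n).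
Hypothesis pos : all block_pos bl.

Local Notation C u v := (6 * common L u v).

Lemma block_at s j : blocks_at s bl -> j < size bl ->
  [/\ arr s 4 j = (nth block0 bl j).1.1, arr s 5 j = (nth block0 bl j).1.2,
      arr s 6 j = (nth block0 bl j).2.1 & arr s 7 j = (nth block0 bl j).2.2].
Proof. by move=> B jb; have <- := ba_nth B jb. Qed.

(** Applying [inside] to the last vertices on the two sides of a nonempty block bounds the ends of
    both ranges. *)
Lemma block_fits j : j < size bl ->
  (nth block0 bl j).1.1 + (nth block0 bl j).1.2 <= n /\
  (nth block0 bl j).2.1 + (nth block0 bl j).2.2 <= n.
Proof.
move=> jb; set b := nth _ _ _; have bbl : b \in bl by rewrite mem_nth.
have /andP[p1 p2] := allP pos b bbl.
have l1 : b.1.2.-1 < b.1.2 by rewrite prednK.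
have l2 : b.2.2.-1 < b.2.2 by rewrite prednK.
have := inside bbl l1 l2; move: (b) p1 p2 => -[[o1 n1] [o2 n2]] /=; clear; lia.
Qed.

Lemma count_pairs_spec s T :
  blocks_at s bl -> graph_at false s n L (fun=> 1) -> reg s 4 = T %% M ->
  wp w count_pairs s (fun c s' =>
    c <= (40 * k + 300) * \sum_(b <- bl) block_sum (fun _ _ => 1) b + 10 /\
    reg s' 4 = (T + \sum_(b <- bl) block_sum (fun u v => C u v) b) %% M).
Proof.
move=> B G rT.
have l1 : 1 %% M = 1 by rewrite lit_small //; mlia.
rewrite /count_pairs /incr; do 2 wstep.
pose K := 40 * k + 80.
apply: wp_weaken.
  apply: (wp_while (n := size bl)
    (f := fun j => (nth block0 bl j).1.2 * ((nth block0 bl j).2.2 * K + 40) + 40)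
    (I := fun j s1 =>
      [/\ frame [:: 4; 15; 16; 17; 18; 20; 21; 22] [:: 13] s s1, reg s1 20 = j,
          graph_at false s1 n L (fun=> 1)
        & reg s1 4 = (T + \sum_(b <- take j bl) block_sum (fun u v => C u v) b) %% M])).
  - move=> j s1 jb [fr r20 _ _] /=.
    by rewrite r20 (fr.1 5 isT) (ba_size B) jb l1.
  - move=> j s1 jb [fr r20 G1 T1].
    have [a4 a5 a6 a7] := block_at B jb.
    have [in1 in2] := block_fits jb.
    set b := nth block0 bl j in a4 a5 a6 a7 in1 in2 *.
    set T' := T + _ in T1.
    do 3 wstep; apply: wp_weaken.
      apply: (wp_while (n := b.1.2) (f := fun _ => b.2.2 * K + 30)
        (I := fun i s2 =>
          [/\ frame [:: 4; 15; 16; 17; 18; 20; 21; 22] [:: 13] s s2,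
              reg s2 20 = j /\ reg s2 21 = i,
              graph_at false s2 n L (fun=> 1)
            & reg s2 4 = (T' + \sum_(0 <= u < i) \sum_(0 <= v < b.2.2)
                C (b.1.1 + u) (b.2.1 + v)) %% M])).
      + move=> i s2 ib [fr2 [r202 r21] _ _] /=.
        by rewrite r21 r202 (fr2.2 5 isT) a5 ib l1.
      + move=> i s2 ib [fr2 [r202 r21] G2 T2].
        set T'' := T' + _ in T2.
        do 5 wstep; set s3 := State _ _.
        have fr3 : frame [:: 17; 22] [::] s2 s3 by rewrite /s3; frame_tac.
        have r17 : reg s3 17 = b.1.1 + i.
          by rewrite /s3 /upd /= r202 r21 (fr2.2 4 isT) a4 lit_small //; mlia.
        have r22 : reg s3 22 = 0 by rewrite /s3 /upd /= mod0n.
        have G3 := graph_at_frame (b := false) fr3 isT isT isT isT isT isT G2.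
        have T3 : reg s3 4 = T'' %% M by rewrite fr3.1.
        have r203 : reg s3 20 = j by rewrite fr3.1.
        have r213 : reg s3 21 = i by rewrite fr3.1.
        have fr03 := frame_comp (rs := [:: 4; 15; 16; 17; 18; 20; 21; 22])
          (ts := [:: 13]) fr2 fr3 isT isT.
        move: s3 fr3 r17 r22 G3 T3 r203 r213 fr03 => s3 _ r17 r22 G3 T3 r203 r213 fr03.
        apply: wp_weaken.
          apply: (wp_while (n := b.2.2) (f := fun _ => 40 * k + 70)
            (I := fun v s4 =>
              [/\ frame [:: 4; 15; 16; 18; 22] [:: 13] s3 s4, reg s4 22 = v,
                  graph_at false s4 n L (fun=> 1)
                & reg s4 4 = (T'' + \sum_(0 <= v' < v)
                    C (b.1.1 + i) (b.2.1 + v')) %% M])).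
          * move=> v s4 vb [fr4 r224 _ _] /=.
            by rewrite r224 (fr4.1 20 isT) r203 (fr4.2 7 isT) (fr03.2 7 isT) a7 vb l1.
          * move=> v s4 vb [fr4 r224 G4 T4].
            do 3 wstep; set s5 := State _ _.
            have fr5 : frame [:: 18] [::] s4 s5 by rewrite /s5; frame_tac.
            have r175 : reg s5 17 = b.1.1 + i by rewrite fr5.1 // fr4.1.
            have r185 : reg s5 18 = b.2.1 + v.
              rewrite /s5 /upd /= r224 (fr4.1 20 isT) r203 (fr4.2 6 isT).
              by rewrite (fr03.2 6 isT) a6 lit_small //; mlia.
            have G5 := graph_at_frame (b := false) fr5 isT isT isT isT isT isT G4.
            apply: (query_spec _ _ G5 r175 r185); try by mlia.
            move=> c6 s6 c6le fr6 G6 r15; do 3 wstep; split.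
              have := outk (b.1.1 + i); have := outk (b.2.1 + v).
              by move: c6le; simpl; mlia.
            have fr46 := frame_comp (rs := [:: 4; 15; 16; 18; 22]) (ts := [:: 13])
              fr5 fr6 isT isT.
            have fr36 := frame_comp (rs := [:: 4; 15; 16; 18; 22]) (ts := [:: 13])
              fr4 fr46 isT isT.
            split.
            -- by frame_tac.
            -- by rewrite /upd /= fr6.1 // fr5.1 // r224 l1 lit_small ?addn1 //; mlia.
            -- apply: (@graph_at_frame [:: 4; 22] [::] s6) G6 => //.
               by frame_tac.
            -- rewrite /upd /= (fr6.1 4) // (fr5.1 4) // T4 r15 sum1_recr addnA.
               by rewrite /common; mod_tac.
          * move=> s4 [fr4 r224 _ _] /=.
            by rewrite r224 (fr4.1 20 isT) r203 (fr4.2 7 isT) (fr03.2 7 isT) a7 ltnn mod0n.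
          * by split => //; rewrite big_geq // addn0.
        move=> c4 s4 [c4le [fr4 _ G4 T4]]; wstep; split.
          by move: c4le; rewrite sum_const /= /K; clear; lia.
        have fr04 := frame_comp (rs := [:: 4; 15; 16; 17; 18; 20; 21; 22])
          (ts := [:: 13]) fr03 fr4 isT isT.
        split.
        * by frame_tac.
        * rewrite /upd /= (fr4.1 20 isT) (fr4.1 21 isT) r203 r213 l1.
          by rewrite lit_small ?addn1 //; mlia.
        * apply: (@graph_at_frame [:: 21] [::] s4) G4 => //.
          by frame_tac.
        * by rewrite /upd /= T4 sum1_recr addnA.
      + move=> s2 [fr2 [r202 r21] _ _] /=.
        by rewrite r21 r202 (fr2.2 5 isT) a5 ltnn mod0n.
      + split.
        * by frame_tac.
        * by rewrite /upd /= mod0n.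
        * apply: (@graph_at_frame [:: 21] [::] s1) G1 => //.
          by frame_tac.
        * by rewrite big_geq // addn0.
    move=> c2 s2 [c2le [fr2 [r202 _] G2 T2]]; wstep; split.
      by move: c2le; rewrite sum_const /= /K; clear; nia.
    split.
    + by frame_tac.
    + by rewrite /upd /= r202 l1 lit_small ?addn1 //; mlia.
    + apply: (@graph_at_frame [:: 20] [::] s2) G2 => //.
      by frame_tac.
    + by rewrite /upd /= T2 (take_nth block0 jb) -cats1 big_cat big_seq1 addnA.
  - move=> s1 [fr r20 _ _] /=.
    by rewrite r20 (fr.1 5 isT) (ba_size B) ltnn mod0n.
  - split.
    + by frame_tac.
    + by rewrite /upd /= mod0n.
    + apply: (@graph_at_frame [:: 20] [::] s) G => //.
      by frame_tac.
    + by rewrite take0 big_nil addn0.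
move=> c1 s1 [c1le [_ _ _ T1]]; rewrite take_size in T1; split => //.
(* Both sides of a block are nonempty, so the overhead per block and per row is absorbed by its
   pairs. *)
apply: leq_trans (_ : 2 + (\sum_(0 <= j < size bl)
   (40 * k + 300) * block_sum (fun _ _ => 1) (nth block0 bl j) + 4) <= _).
  move: c1le => /= c1le; rewrite leq_add2l; apply: leq_trans c1le _.
  rewrite leq_add2r big_nat [X in _ <= X]big_nat; apply: leq_sum => j /andP[_ jb].
  have /andP[p1 p2] := allP pos _ (mem_nth block0 jb).
  rewrite /block_sum sum_const sum_const /K.
  by move: p1 p2; case: (nth _ _ _) => [[o1 n1] [o2 n2]] /=; clear; nia.
by rewrite -big_distrr /= (big_nth block0); lia.
Qed.

End Count.

Section Program.

Variables (p : cmd) (cm : nat) (mmcost : nat -> nat).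
Hypothesis mm : multiplies p cm mmcost.
Variables (w : nat) (a : expr) (k h l D : nat).
Local Notation M := (2 ^ w).
Local Notation n := (nverts a).
Hypothesis codeM : (size (encode a) + 10) ^ 2 < M.
Hypothesis mmM : (2 * size (encode a) + 2) ^ cm <= M.
Hypothesis D0 : 0 < D.
Hypothesis hD : h <= D.
Hypothesis mmD : forall t, 0 < t <= h -> mmcost t <= D * t.

(** Weight the pairs by the indicator of leaving the vertex range: the sum over edges is 0, so every
    term of the sum over blocks is 0. *)
Lemma trace_inside kk T bl L : trace kk 0 n (eadj a) T bl L ->
  forall b u v, b \in bl -> u < b.1.2 -> v < b.2.2 ->
  (b.1.1 + u < n) && (b.2.1 + v < n).
Proof.
move=> tr b u v bbl ub vb.
pose F u v := (n <= u) || (n <= v) : nat.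
have Fsym x y : F x y = F y x by rewrite /F orbC.
have := tr_blocks tr Fsym.
rewrite [LHS]big1_seq; last first.
  move=> x; rewrite mem_index_iota => /andP[_ /= xn].
  rewrite big1_seq // => y; rewrite mem_index_iota => /andP[_ /= yn].
  by rewrite /F !add0n (leqNgt n x) (leqNgt n y) xn yn muln0.
move/esym/eqP; rewrite muln_eq0 /= sum_nat_seq_eq0 => /allP /(_ b bbl) /=.
rewrite /block_sum sum_nat_seq_eq0 => /allP /(_ u); rewrite mem_index_iota ub.
move=> /(_ isT) /=; rewrite sum_nat_seq_eq0 => /allP /(_ v); rewrite mem_index_iota vb.
by move=> /(_ isT) /=; rewrite /F eqb0 negb_or -!ltnNge.
Qed.

(** The final pass sees each edge once, whereas [tr_tri] sums over ordered pairs with factor 3; this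
    is where the weight 6 comes from. *)
Lemma trace_total kk T bl L : trace kk 0 n (eadj a) T bl L ->
  T + \sum_(b <- bl) block_sum (fun u v => 6 * common L u v) b = tri_sum n (eadj a).
Proof.
move=> tr; rewrite -(tr_tri tr); congr (_ + _).
rewrite (tr_blocks tr) => [|u v]; last by apply: commonC; exact: tr_uniq tr _.
rewrite mulnA big_distrr /=; apply: eq_bigr => b _.
rewrite /block_sum big_distrr /=; apply: eq_bigr => u _.
by rewrite big_distrr.
Qed.

Lemma trace_degs kk T bl L : trace kk 0 n (eadj a) T bl L ->
  2 * \sum_(b <- bl) block_sum (fun _ _ => 1) b = degs a.
Proof.
move=> tr; rewrite -(tr_blocks tr) // /degs /deg_sum.
by apply: eq_bigr => u _; apply: eq_bigr => v _; rewrite muln1.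
Qed.

Lemma triangle_program_spec s :
  word_state w s -> input_at s (encode a) ->
  wf_expr h l a -> inc_depth a <= k -> irredundant a ->
  tri_sum n (eadj a) < M ->
  wp w (triangle_program p) s (fun c s' =>
    c <= 4000 * D * (3 * n + 2) + 1200 * (k + l) * degs a /\
    reg s' 0 = tri_sum n (eadj a) %/ 6).
Proof.
move=> ws I wf da ir triM; have [M1 M2] := square_large codeM.
have l0 : 0 %% M = 0 by rewrite mod0n.
have l6 : 6 %% M = 6 by rewrite lit_small //; mlia.
rewrite /triangle_program; do 12 wstep; rewrite !l0; set s1 := State _ _.
have fr : frame [:: 1; 2; 3; 4; 5; 6] [::] s s1 by rewrite /s1; frame_tac.
have ws1 : word_state w s1.
  case: ws => hr ha; split => // x; rewrite /s1 /= /upd.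
  by do 6 (case: (x == _); first by rewrite expn_gt0).
have rp1 : rep w (encode a) s1 0 [::] 0 0 [::] [::].
  split.
  - exact: I.
  - by [].
  - by split.
  - by [].
  - by rewrite mod0n.
  - by split.
  - by split.
  - by [].
  - by [].
have oc : occurs_at (encode a) 0 (encode a) by split.
wstep.
have [c [s2 [T [bl [L [[st2 ws2] cle rp2 tr]]]]]] :=
  @parse p cm mmcost mm w (encode a) codeM mmM k h l D D0 hD mmD
   (4000 * D) (600 * (k + l)) (leqnn _) (leqnn _) a wf da ir
   s1 0 [::] 0 0 [::] [::] ws1 rp1 oc.
rewrite /= !add0n in rp2.
case: rp2 => I2 p2 Sk r3 rT B G A /and3P[b1 b2 b3].
have ew : exec w (While guard (do_token p)) s1 (c + 4) s2.
  by apply: st2; apply: ExWhileF; rewrite /= p2 I2.1 ltnn l0.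
exists (c + 4), s2; split => //; wstep; apply: wp_if => /=.
have tot := trace_total tr; have dg := trace_degs tr.
have fin c3 s3 : reg s3 4 = (T + \sum_(b <- bl) block_sum
      (fun u v => 6 * common L u v) b) %% M ->
    c3 <= 300 * k * degs a + 10 ->
    wp w (Set_ 0 (Bin Div (Reg 4) (Lit 6))) s3 (fun k' s' =>
      c + 4 + (2 + c3 + k') + 12 <= 4000 * D * (3 * n + 2) + 1200 * (k + l) * degs a /\
      reg s' 0 = tri_sum n (eadj a) %/ 6).
  move=> r4 c3le; wstep; rewrite /upd /= r4 tot l6 (@modn_small (tri_sum _ _)) //.
  split => //.
  have le1 : 4000 * D * (3 * n + 2 * (n == 0)) <= 4000 * D * (3 * n + 2).
    by rewrite leq_mul2l leq_add2l; case: (n == 0); rewrite orbT.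
  have le2 : 300 * k * degs a <= 600 * (k + l) * degs a.
    by rewrite leq_mul2r; apply/orP; right; clear; lia.
  have le3 : 4000 <= 4000 * D by move: D0; clear; lia.
  have -> : 1200 * (k + l) = 600 * (k + l) + 600 * (k + l) by clear; lia.
  rewrite mulnDl; move: cle c3le le1 le2 le3; clear.
  set u1 := 4000 * D * (3 * n + 2); set u2 := 4000 * D * (3 * n + 2 * _).
  set u3 := 600 * (k + l) * degs a; set u4 := 300 * k * degs a; set u5 := 4000 * D.
  clearbody u1 u2 u3 u4 u5; simpl; lia.
have r6 : reg s2 6 = size L := ga_cnt G.
(* If there are no arcs, the final pass must be skipped: k and l may both be 0, and then nothing
   pays for visiting the edges. An arc, on the other hand, forces [0 < k]. *)
have [L0|L0] := posnP (size L).
  rewrite r6 L0 /=; wstep; apply: wp_weaken; [apply: (fin 1)|].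
  2: by clear; lia.
  2: by move=> k' s' [h1 h2]; split => //; apply: leq_trans h1; clear; simpl; lia.
  rewrite rT big1 ?addn0 // => b _; rewrite /block_sum big1 // => u _.
  by rewrite big1 // => v _; rewrite (size0nil L0) /common big_nil.
have k0 : 0 < k.
  case eL: L L0 => [//|[u x] L'] _.
  apply: leq_trans da; apply: leq_trans (tr_out tr u).
  by case eo: (out L u) => //; have := mem_out L u x; rewrite eo eL mem_head.
rewrite r6 -lt0n L0.
have nL : n + size bl + size L + 10 < M.
  by move: b1 b2 b3 M1; simpl; clear; set N := 2 ^ w; clearbody N; lia.
apply: wp_weaken.
  apply: (count_pairs_spec nL (fun u => leq_trans (tr_out tr u) da)
    (trace_inside tr) (tr_pos tr) B G rT).
move=> c3 s3 [c3le r4]; apply: wp_weaken; [apply: (fin c3 s3 r4)|]; last first.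
  by move=> k' s' [h1 h2]; split => //; apply: leq_trans h1; clear; simpl; lia.
apply: leq_trans c3le _; rewrite -dg leq_add2r mulnA leq_mul2r.
by apply/orP; right; move: k0; clear; lia.
Qed.

End Program.

(** * The length of an expression *)

(** The credit scheme of [parsed] applied to code length instead of time. It is needed because the
    word size is assumed large in terms of n only, while the counters range up to the length of the
    code. *)
Definition short (c e : nat) (a : expr) : Prop :=
  size (encode a) + c <= c * (3 * nverts a + 2 * (nverts a == 0)) + e * degs a.

Lemma short_list c e es : each (short c e) es ->
  all (fun a => 0 < nverts a) es ->
  size (flatten (map encode es)) + c * size es <=
    3 * c * sumn (map nverts es) + e * sumn (map degs es).
Proof.
elim: es => [|a es IH] /=; first by rewrite !muln0.
move=> [sa ses] /andP[a0 /(IH ses)].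
move: sa; rewrite /short (gtn_eqF a0) muln0 addn0 size_cat mulnS !mulnDr.
by clear; lia.
Qed.

Lemma short_union c e es : 2 <= c -> 1 < size es -> each (short c e) es ->
  all (fun a => 0 < nverts a) es -> short c e (Union es) /\ short c e (Join es).
Proof.
move=> c2 sz ses pos; have := short_list ses pos.
rewrite /short /degs /= !size_cat /=.
have := degs_subst (fun _ _ => false) es; have := degs_subst (fun _ _ => true) es.
set d := deg_sum _ _; set d' := deg_sum _ _; set m := sumn (map degs es).
set v := sumn _; move=> h1 h2 h3.
have e1 : e * m <= e * d by rewrite leq_mul2l h1 orbT.
have e2 : e * m <= e * d' by rewrite leq_mul2l h2 orbT.
have e3 : 2 * c <= c * size es by rewrite mulnC leq_mul2l sz orbT.
have e4 : 3 * c * v <= c * (3 * v + 2 * (v == 0)).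
  by rewrite mulnDr mulnA (mulnC c 3) leq_addr.
move: h3 e1 e2 e3 e4 c2; clear; set u := c * (_ + _); clearbody u.
by split; lia.
Qed.

Lemma short_inc c e N b : 2 <= c -> 0 < e -> wf_nbrs (nverts b) N ->
  short c e b -> short c e (Inc N b).
Proof.
move=> c2 e0 wf; rewrite /short /degs /= deg_sum_inc // size_cat /=.
move: c2 e0; clear; set d := deg_sum _ _; case: eqP => /= _; rewrite !mulnDr; nia.
Qed.

Lemma short_td d : wf_td d -> irredundant d -> short 20 4 d.
Proof.
elim/expr_nested_ind: d => //= [es IH|N b IH].
  move=> /andP[sz wf] /andP[pos ir].
  have [] // := @short_union 20 4 es; last first.
  elim: es IH wf pos ir {sz} => //= a es IHes [IHa IH'] /andP[wa wes] /andP[_ pos].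
  by move=> /andP[ia ies]; split; [exact: IHa|exact: IHes].
by move=> /andP[wN wf] ir; apply: short_inc => //; exact: IH.
Qed.

Lemma degs_td l t E d : wf_edges t E -> td_witness l t E d -> degs d = 2 * size E.
Proof.
move=> wfE /and4P[wf _ /eqP nd /allP h].
rewrite -sum1_size big_distrr /=.
have := sum_list_adj (fun _ _ => 1) wfE => /= <-.
rewrite /degs /deg_sum nd; apply: eq_big_nat => i it; apply: eq_big_nat => j jt.
have ii : i \in iota 0 t by rewrite mem_iota.
have ji : j \in iota 0 t by rewrite mem_iota.
have /eqP -> := allP (h i ii) j ji; rewrite muln1; case: eqP => //= <-.
case: (boolP (list_adj E i i)) => //; rewrite /list_adj orbb => iE.
by case/andP: wfE => _ /allP /(_ _ iE) /=; rewrite ltnn.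
Qed.

Lemma short_expr h l a : wf_expr h l a -> irredundant a -> short 200 5 a.
Proof.
have list es : each (fun a => wf_expr h l a -> irredundant a -> short 200 5 a) es ->
    all (wf_expr h l) es -> all irredundant es -> each (short 200 5) es.
  elim: es => //= e es IHes [IHe IH] /andP[we wes] /andP[ie ies].
  by split; [exact: IHe|exact: IHes].
elim/expr_nested_ind: a => //=.
- move=> es IH /andP[sz wf] /andP[pos ir].
  by have [] // := @short_union 200 5 es; exact: list.
- move=> es IH /andP[sz wf] /andP[pos ir].
  by have [] // := @short_union 200 5 es; exact: list.
- by move=> N b IH /andP[wN wf] ir; apply: short_inc => //; exact: IH.
move=> E d es _ IH /and3P[wE wd wf] /and4P[sz pos ir ird].
have := short_list (list es IH wf ir) pos.
have := degs_edges wE pos.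
rewrite /short {3}/degs /= size_cat /= size_cat size_pairs_code.
set dg := deg_sum _ _; set m := sumn _; set v := sumn (map nverts es).
(* The bound comes from [short_td], with 20 * 3 per vertex of H and 4 * 2 per edge. Together with
   the edge list this makes 10 words per edge of H, which the coefficient 5 pays, as the degree sum
   grows by at least 2 per edge. *)
have : size (if d is Some b then encode_seq (encode b) else [::]) <=
    60 * size es + 8 * size E.
  case: d wd ird => //= b wb ib.
  have := degs_td wE wb; case/and4P: wb => wb _ /eqP nb _ db.
  have := short_td wb ib; rewrite /short db nb.
  by rewrite (gtn_eqF (ltnW sz)); lia.
by move: sz; clear; set sd := size (match d with Some _ => _ | None => _ end); clearbody sd; case: (v == 0); lia.
Qed.

Lemma deg_sum_le n e : deg_sum n e <= n * n.
Proof.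
apply: leq_trans (_ : \sum_(0 <= u < n) \sum_(0 <= v < n) 1 <= _).
  by apply: leq_sum => u _; apply: leq_sum => v _; case: (e u v).
by rewrite !sum_const muln1.
Qed.

Lemma tri_sum_le n e : tri_sum n e <= n * (n * n).
Proof.
apply: leq_trans (_ : \sum_(0 <= u < n) \sum_(0 <= v < n) \sum_(0 <= x < n) 1 <= _).
  apply: leq_sum => u _; apply: leq_sum => v _; apply: leq_sum => x _.
  by case: (e u v); case: (e v x); case: (e u x).
by rewrite !sum_const muln1.
Qed.

(** The length is quadratic in n; as n + 2 is at least 2, the constant [1024 = 2 ^ 10] is absorbed
    by ten further factors. *)
Lemma size_encode h l a : wf_expr h l a -> irredundant a ->
  size (encode a) + 10 <= (nverts a + 2) ^ 12.
Proof.
move=> wf ir; have := short_expr wf ir; have := deg_sum_le (nverts a) (eadj a).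
rewrite /short -/(degs a); set N := nverts a => h1 h2.
have h3 : size (encode a) + 10 <= 1024 * ((N + 2) * (N + 2)).
  by move: h1 h2; case: eqP => /= _; clear; nia.
apply: leq_trans h3 _; rewrite (expnD _ 10 2) -mulnn leq_mul2r; apply/orP; right.
by change 1024 with (2 ^ 10); rewrite leq_exp2r //; lia.
Qed.

(** * Ordered pairs and triples *)

Section Count.

Variable G : sgraph.

Lemma card_edge (S : {set G}) : S \in edges G -> #|S| = 2.
Proof.
rewrite inE => /existsP[x /existsP[y /andP[xy /eqP ->]]]; rewrite cards2.
by case: eqP xy => // ->; rewrite adj_irr.
Qed.

(** Double counting of edges together with an ordering of their ends: two orderings for each edge,
    one edge for each ordered adjacent pair. *)
Lemma double_edges : 2 * #|edges G| = \sum_(x : G) \sum_(y : G) adj x y.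
Proof.
transitivity (\sum_(S in edges G) \sum_(x : G) \sum_(y : G)
    ((x \in S) && (y \in S :\ x) : nat)).
  rewrite mulnC -sum_nat_const; apply: eq_bigr => S SE.
  rewrite -(card_edge SE) -sum1_card big_mkcond /=; apply: eq_bigr => x _.
  case xS: (x \in S) => /=; last by rewrite big1.
  have := card_edge SE; rewrite (cardsD1 x) xS => -[<-].
  by rewrite -sum1_card big_mkcond.
rewrite exchange_big; apply: eq_bigr => x _ /=.
rewrite exchange_big; apply: eq_bigr => y _ /=.
have [xy|xy] := boolP (adj x y).
  have xE : [set x; y] \in edges G.
    by rewrite inE; apply/existsP; exists x; apply/existsP; exists y; rewrite xy /=.
  have yx : y != x by apply: contraTneq xy => ->; rewrite adj_irr.
  rewrite (bigD1 [set x; y]) //= !inE !eqxx yx orbT big1 // => S /andP[SE nS].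
  apply/eqP; rewrite eqb0; apply: contra nS => /andP[xS]; rewrite in_setD1 => /andP[_ yS].
  rewrite eq_sym eqEcard (card_edge SE) (card_edge xE) leqnn andbT.
  by apply/subsetP => z; rewrite !inE => /orP[] /eqP ->.
rewrite big1 // => S; rewrite inE => /existsP[u /existsP[v /andP[uv /eqP ->]]].
apply/eqP; rewrite eqb0; apply: contra xy; rewrite !inE.
case/andP=> /orP[] /eqP -> /andP[] vu /orP[] /eqP e; rewrite e in vu *.
all: by rewrite ?eqxx ?uv // adj_sym ?uv in vu *.
Qed.

(** The same double counting with the six orderings of the vertices of a triangle. *)
Lemma sextuple_triangles : 6 * #|triangles G| =
  \sum_(x : G) \sum_(y : G) \sum_(z : G) adj x y * adj y z * adj x z.
Proof.
transitivity (\sum_(S in triangles G) \sum_(x : G) \sum_(y : G) \sum_(z : G)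
    ([&& x \in S, y \in S :\ x & z \in S :\ x :\ y] : nat)).
  rewrite mulnC -sum_nat_const; apply: eq_bigr => S; rewrite inE => /andP[/eqP S3 _].
  transitivity (\sum_(x in S) 2); first by rewrite sum_nat_const S3.
  rewrite big_mkcond; apply: eq_bigr => x _.
  case xS: (x \in S) => /=; last by rewrite big1 // => y _; rewrite big1.
  move: S3; rewrite (cardsD1 x) xS add1n => -[S2].
  transitivity (\sum_(y in S :\ x) 1); first by rewrite sum_nat_const S2.
  rewrite big_mkcond; apply: eq_bigr => y _.
  case yS: (y \in S :\ x) => /=; last by rewrite big1.
  move: S2; rewrite (cardsD1 y) yS add1n => -[<-].
  by rewrite -sum1_card big_mkcond.
rewrite exchange_big; apply: eq_bigr => x _ /=.
rewrite exchange_big; apply: eq_bigr => y _ /=.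
rewrite exchange_big; apply: eq_bigr => z _ /=.
have TE S : S \in triangles G -> #|S| = 3 /\
    forall u v, u \in S -> v \in S -> u != v -> adj u v.
  rewrite inE => /andP[/eqP -> /forall_inP h]; split => // u v uS vS uv.
  by have /forall_inP/(_ v vS) /implyP/(_ uv) := h u uS.
case: (boolP [&& adj x y, adj y z & adj x z]) => [/and3P[xy yz xz]|nxyz].
  rewrite xy yz xz.
  have yx : y != x by apply: contraTneq xy => ->; rewrite adj_irr.
  have zy : z != y by apply: contraTneq yz => ->; rewrite adj_irr.
  have zx : z != x by apply: contraTneq xz => ->; rewrite adj_irr.
  have c3 : #|[set x; y; z]| = 3.
    by rewrite setUC cardsU1 cards2 !inE negb_or zx zy eq_sym yx.
  have xT : [set x; y; z] \in triangles G.
    rewrite inE c3 eqxx /=; apply/forall_inP => u uS; apply/forall_inP => v vS.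
    have ayx : adj y x by rewrite adj_sym.
    have azy : adj z y by rewrite adj_sym.
    have azx : adj z x by rewrite adj_sym.
    move: uS vS; rewrite !inE -!orbA => /or3P[] /eqP -> /or3P[] /eqP ->;
      by rewrite ?eqxx ?(xy, yz, xz, ayx, azy, azx) ?implybT.
  rewrite (bigD1 [set x; y; z]) //= !inE !eqxx yx zy zx !orbT big1 // => S /andP[ST nS].
  apply/eqP; rewrite eqb0; apply: contra nS; rewrite !inE.
  move=> /and4P[xS /andP[_ yS] _ /andP[_ zS]].
  rewrite eq_sym eqEcard c3 (TE S ST).1 leqnn andbT.
  by apply/subsetP => u; rewrite !inE -orbA => /or3P[] /eqP ->.
rewrite big1.
  by move: nxyz; case: (adj x y); case: (adj y z); case: (adj x z).
move=> S /TE[_ SA]; apply/eqP; rewrite eqb0; apply: contra nxyz; rewrite !inE.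
move=> /and4P[xS /andP[yx yS] zy /andP[zx zS]].
by rewrite !SA // eq_sym.
Qed.

End Count.

Section Denotes.

Variables (a : expr) (G : sgraph).
Hypothesis aG : denotes a G.

Lemma denotes_card : #|G| = nverts a.
Proof. by have [f bf _] := aG; rewrite -(bij_eq_card bf) card_ord. Qed.

Lemma denotes_degs : degs a = 2 * #|edges G|.
Proof.
have [f bf fE] := aG; have fo : forall P : pred G, {on P, bijective f}
  by move=> P; exact: onW_bij.
rewrite double_edges (reindex f (fo _)) /degs /deg_sum big_mkord.
apply: eq_bigr => i _; rewrite (reindex f (fo _)) big_mkord.
by apply: eq_bigr => j _; rewrite fE.
Qed.

Lemma denotes_tri : tri_sum (nverts a) (eadj a) = 6 * #|triangles G|.
Proof.
have [f bf fE] := aG; have fo : forall P : pred G, {on P, bijective f}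
  by move=> P; exact: onW_bij.
rewrite sextuple_triangles (reindex f (fo _)) /tri_sum big_mkord.
apply: eq_bigr => i _; rewrite (reindex f (fo _)) big_mkord.
apply: eq_bigr => j _; rewrite (reindex f (fo _)) big_mkord.
by apply: eq_bigr => x _; rewrite !fE.
Qed.

End Denotes.

Import Order.TTheory GRing.Theory Num.Theory.

(** * The exponent *)

(** Origin of the exponent: squaring the code length gives 24, strictness makes it 25, and
    [2 * S + 2] is at most [N ^ 13], since the factor 2 is at most [N]. *)
Lemma large_words (N S c : nat) : 2 <= N -> S + 10 <= N ^ 12 ->
  [/\ (S + 10) ^ 2 < N ^ (25 + 13 * c), (2 * S + 2) ^ c <= N ^ (25 + 13 * c)
    & N * (N * N) <= N ^ (25 + 13 * c)].
Proof.
move=> N2 SN; have N0 : 0 < N by exact: ltnW.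
have le25 : N ^ 25 <= N ^ (25 + 13 * c) by rewrite leq_pexp2l // leq_addr.
split.
- apply: leq_trans le25; apply: (@leq_ltn_trans (N ^ 24)).
    by rewrite (expnM N 12 2) leq_exp2r.
  by rewrite ltn_exp2l.
- apply: (@leq_trans (N ^ (13 * c))); last by rewrite leq_pexp2l // leq_addl.
  case: c {le25} => [|c] //; rewrite expnM leq_exp2r // expnS.
  by apply: (@leq_trans (2 * (S + 10))); [clear; lia|exact: leq_mul].
- by apply: leq_trans le25; rewrite mulnn -expnS leq_pexp2l.
Qed.

Section Exponent.

Variables (R : realType) (omega : R) (p : cmd) (c : nat) (C : R).
Local Open Scope ring_scope.

Hypothesis mm : forall (t b : nat) (A B : 'M[nat]_t) (w : nat) (s : state),
  (0 < t)%N -> (forall i j, (A i j < b)%N) -> (forall i j, (B i j < b)%N) ->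
  ((t + b) ^ c <= 2 ^ w)%N -> word_state w s -> reg s 0 = t ->
  holds_mx (arr s 0) A -> holds_mx (arr s 1) B ->
  runs_within w p s (C * t%:R `^ omega)
    (fun s' => holds_mx (arr s' 2) (A *m B)).

(* The product of two zero matrices has to overwrite an array of ones. *)
Lemma mm_writes t : (0 < t)%N -> (t * t)%:R <= C * t%:R `^ omega.
Proof.
(* Zero matrices have entries below [b = 1]; this [w] makes [2 ^ w] exceed both [(t + 1) ^ c] and
   [t]. *)
move=> t0; pose w := ((t + 1) ^ c + t)%N.
pose s := State (fun x => if x == 0%N then t else 0%N)
  (fun a _ => if a == 2%N then 1%N else 0%N).
have w2 : (w < 2 ^ w)%N by rewrite ltn_expl.
have ws : word_state w s.
  split=> [x|a i] /=; case: ifP => _; rewrite ?expn_gt0 //.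
    by apply: leq_ltn_trans w2; rewrite leq_addl.
  by apply: leq_ltn_trans w2; rewrite /w; clear -t0; lia.
have [k [s' [e kle res]]] : runs_within w p s (C * t%:R `^ omega)
    (fun s' => holds_mx (arr s' 2) ((0 : 'M[nat]_t) *m 0)).
  apply: (@mm t 1%N 0 0 w s) => //; try by move=> i j; rewrite mxE.
  by apply: ltnW; apply: leq_ltn_trans w2; rewrite leq_addr.
apply: le_trans kle; rewrite ler_nat -(size_iota 0 (t * t)).
apply: (exec_changed (t := 2%N) e); first exact: iota_uniq.
apply/allP => i; rewrite mem_iota /= add0n => it.
have it' : (i %/ t < t)%N by rewrite ltn_divLR.
have im : (i %% t < t)%N by rewrite ltn_mod.
have := res (Ordinal it') (Ordinal im); rewrite /= -divn_eq => ->.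
by rewrite mul0mx mxE.
Qed.

Lemma mm_const : 1 <= C.
Proof. by have := @mm_writes 1 isT; rewrite muln1 powR1 mulr1. Qed.

(** By [mm_writes], an exponent below 2 would keep [t ^ (2 - omega)] below [C] for all positive
    [t]. *)
Lemma omega_ge2 : 2 <= omega.
Proof.
rewrite leNgt; apply/negP => om2; pose d := 2 - omega.
have d0 : 0 < d by rewrite subr_gt0.
have C0 : 0 <= C by apply: le_trans mm_const.
(* This [t] is chosen so that its power with exponent [d] is at least [C + 1]. *)
pose x := (C + 1) `^ d^-1; pose t := (Num.truncn x).+1.
have xt : x < t%:R by exact: truncnS_gt.
have t0 : 0 < t%:R :> R by rewrite ltr0n.
have : t%:R `^ d <= C.
  rewrite -(ler_pM2r (powR_gt0 omega t0)) -powRD; last first.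
    by rewrite (gt_eqF t0) implybT.
  rewrite subrK powR_mulrn ?ler0n // expr2 -natrM.
  exact: mm_writes.
apply/negP; rewrite -ltNge; apply: (@lt_le_trans _ _ (C + 1)).
  by rewrite ltrDl.
have -> : C + 1 = x `^ d.
  by rewrite /x -powRrM mulVf ?(gt_eqF d0) // powRr1 // addr_ge0.
apply: ge0_ler_powR; rewrite ?nnegrE ?powR_ge0 //; exact: ltW.
Qed.

Definition mm_bound (t : nat) : nat := Num.truncn (C * t%:R `^ omega).

(** Running times are natural numbers, so truncating the real bound loses nothing and the whole cost
    analysis can stay in [nat]. *)
Lemma mm_multiplies : multiplies p c mm_bound.
Proof.
move=> t b A B w s t0 Ab Bb tb ws r0 hA hB.
have [k [s' [e kle res]]] := mm t0 Ab Bb tb ws r0 hA hB.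
exists k, s'; split => //; rewrite /mm_bound truncn_ge_nat //.
exact: le_trans kle.
Qed.

(** This is the parameter [D] of the cost analysis, the time per argument. The maximum with 1 keeps
    the power at least 1 when [h = 0], where operations still take constant time per argument. *)
Definition mm_factor (h : nat) : nat :=
  (Num.truncn (C * (maxn h 1)%:R `^ (omega - 1))).+1.

Lemma powR_max (h : nat) : (maxn h 1)%:R <= (maxn h 1)%:R `^ (omega - 1) :> R.
Proof.
apply: le1r_powR; first by rewrite ler1n leq_max orbT.
by rewrite lerBrDr; exact: omega_ge2.
Qed.

(** Clearing the matrices and listing the edges take time t * t <= h * t, which the same factor must
    cover; this rests on [omega - 1 >= 1] and [1 <= C]. *)
Lemma mm_factor_ge h : (h <= mm_factor h)%N.
Proof.
apply: leqW; apply: leq_trans (leq_maxl h 1) _.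
have x0 : 0 <= C * (maxn h 1)%:R `^ (omega - 1).
  by rewrite mulr_ge0 ?powR_ge0 // (le_trans _ mm_const).
rewrite truncn_ge_nat //; apply: le_trans (powR_max h) _.
by rewrite ler_peMl ?powR_ge0 // mm_const.
Qed.

Lemma mm_factor_le h :
  (mm_factor h)%:R <= 2 * C * (maxn h 1)%:R `^ (omega - 1).
Proof.
set y := _ `^ _.
have y1 : 1 <= y.
  by apply: le_trans (powR_max h); rewrite ler1n leq_max orbT.
have x1 : 1 <= C * y by rewrite -(mulr1 1) ler_pM // mm_const.
rewrite /mm_factor -natr1 -mulrA mulr_natl mulr2n lerD // truncn_le.
exact: le_trans x1.
Qed.

(** One factor t is split off t ^ omega; the remaining power is monotone because its exponent
    [omega - 1] is nonnegative. *)
Lemma mm_bound_le h t : (0 < t <= h)%N -> (mm_bound t <= mm_factor h * t)%N.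
Proof.
move=> /andP[t0 th]; rewrite -(ler_nat R).
have C0 : 0 <= C by apply: le_trans mm_const.
have o0 : 0 < omega by apply: lt_le_trans omega_ge2.
have o1 : 0 <= omega - 1.
  by rewrite subr_ge0; apply: le_trans omega_ge2; rewrite ler1n.
apply: le_trans (_ : C * t%:R `^ omega <= _).
  by rewrite truncn_le mulr_ge0 // powR_ge0.
rewrite -mulr_powRB1 ?ler0n // mulrCA mulrC natrM ler_wpM2r ?ler0n //.
apply: le_trans (ltW (truncnS_gt _)).
rewrite ler_wpM2l // ge0_ler_powR ?nnegrE ?ler0n // ler_nat.
exact: leq_trans th (leq_maxl _ _).
Qed.

End Exponent.

(** * The running time of the whole computation *)

Lemma nverts_eq0 h l a : wf_expr h l a -> irredundant a -> nverts a = 0 ->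
  a = Empty.
Proof.
have no es : 1 < size es -> all (fun b => 0 < nverts b) es ->
    sumn (map nverts es) = 0 -> False.
  move=> sz pos e0; have : all (fun n => 0 < n) (map nverts es) by rewrite all_map.
  move/size_le_sumn; rewrite size_map e0; move: sz; clear; lia.
case: a => //= [es|es|E d es].
- by move=> /andP[sz _] /andP[pos _] /(no es sz pos).
- by move=> /andP[sz _] /andP[pos _] /(no es sz pos).
- by move=> _ /and4P[sz pos _ _] /(no es sz pos).
Qed.

Theorem theorem8 (R : realType) (omega : R) (homega : mm_exponent omega) :
  exists (p : cmd) (c : nat) (C : R),
    forall (k h l : nat) (G : sgraph) (a : expr) (w : nat) (s : state),
      witnesses k h l a G ->
      irredundant a ->
      ((#|G| + 2) ^ c <= 2 ^ w)%N ->
      word_state w s ->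
      input_expr a s ->
      runs_within w p s
        (C * ((maxn h 1)%:R `^ (omega - 1) * #|G|%:R
              + ((k + l) * #|edges G|)%:R + 1))%R
        (fun s' => reg s' 0 = #|triangles G|).
Proof.
have [p [cm [C mm]]] := homega.
have C1 := mm_const mm.
(* For [n > 0], the time [4000 * D * (3 * n + 2)] is at most [20000 * D * n]. The constant is hidden
   behind [K] to keep the numeral from being expanded; the factor [2 * C] comes from
   [mm_factor_le]. *)
have [K K0] : exists K, 100 * 200 <= K by exists (100 * 200).
exists (triangle_program p), (25 + 13 * cm), (2 * K%:R * C)%R.
move=> k h l G a w s [wf da aG] ir.
rewrite (denotes_card aG) => Mw ws I.
have N2 : 2 <= nverts a + 2 by rewrite leq_addl.
have [l1 l2 l3] := large_words cm N2 (size_encode wf ir).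
have codeM := leq_trans l1 Mw; have mmM := leq_trans l2 Mw.
have triM : tri_sum (nverts a) (eadj a) < 2 ^ w.
  apply: leq_ltn_trans (tri_sum_le _ _) (leq_trans _ Mw).
  by apply: leq_trans l3; clear; nia.
have fin (c' : nat) :
    wp w (triangle_program p) s (fun c s' => c <= c' /\
      reg s' 0 = tri_sum (nverts a) (eadj a) %/ 6) ->
    (c'%:R <= 2 * K%:R * C * ((maxn h 1)%:R `^ (omega - 1) * (nverts a)%:R
              + ((k + l) * #|edges G|)%:R + 1))%R ->
    runs_within w (triangle_program p) s
      (2 * K%:R * C * ((maxn h 1)%:R `^ (omega - 1) * (nverts a)%:R
              + ((k + l) * #|edges G|)%:R + 1))%R
      (fun s' => reg s' 0 = #|triangles G|).
  move=> [cc [s' [e [ccle r0]]]] c'le; exists cc, s'; split => //.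
    by apply: le_trans c'le; rewrite ler_nat.
  by rewrite r0 (denotes_tri aG) mulKn.
have CC : (0 <= C)%R by apply: le_trans C1.
have C2 : (1 <= 2 * C)%R.
  by apply: le_trans C1 _; rewrite ler_peMl // ler1n.
have [n0|n0] := posnP (nverts a).
  (* For the empty graph the allowance [4000 * D * 2] would still grow with h. The expression is
     then [Empty], which is also well formed for [h = l = 0], so [D = 1] suffices and the summand 1
     of the bound pays. *)
  have a0 := nverts_eq0 wf ir n0; apply: (fin K).
    have mm0 t : 0 < t <= 0 -> mm_bound omega C t <= 1 * t by case: t.
    have wf0 : wf_expr 0 0 a by rewrite a0.
    have := triangle_program_spec (mm_multiplies mm) codeM mmM (ltn0Sn 0)
      (leq0n 1) mm0 ws I wf0 da ir triM.
    move=> [c1 [s1 [e [c1le r0]]]]; exists c1, s1; split=> [//|]; split; last exact: r0.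
    have d0 : degs a = 0 by rewrite /degs /deg_sum n0 big_geq.
    by move: c1le K0; rewrite n0 d0; clear; lia.
  rewrite n0 mulr0 add0r mulrDr mulr1 -[leLHS]add0r lerD //.
    by rewrite !mulr_ge0 ?ler0n.
  by rewrite mulrAC ler_peMl ?ler0n.
apply: fin.
  apply: (triangle_program_spec (D := mm_factor omega C h) (mm_multiplies mm) codeM mmM (ltn0Sn _)
    (mm_factor_ge mm h) (@mm_bound_le _ _ _ _ _ mm h) ws I wf da ir triM).
rewrite (denotes_degs aG).
set D := mm_factor _ _ _; set n := nverts a; set m := #|edges G|.
apply: (@le_trans _ _ (K * (D * n) + K * ((k + l) * m))%:R%R).
  rewrite ler_nat; apply: (@leq_trans (100 * 200 * (D * n) + 100 * 200 * ((k + l) * m))).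
    by move: n0; rewrite -/n; clear; nia.
  by rewrite leq_add // leq_mul2r K0 orbT.
rewrite natrD (natrM _ K) (natrM _ K) mulrDr mulrDr -[leLHS]addr0.
apply: lerD; last by rewrite mulr1 !mulr_ge0 ?ler0n.
apply: lerD.
  rewrite natrM mulrA mulrA ler_wpM2r ?ler0n // -!mulrA mulrCA ler_wpM2l ?ler0n //.
  by rewrite mulrA; exact: mm_factor_le mm h.
by rewrite ler_wpM2r ?ler0n // mulrAC ler_peMl ?ler0n.
Qed.
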